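(* Up to isomorphism there are $71$ complex Jordan superalgebras of type $(2,2)$ (the one-parameter family $\mathcal J_{16}^t$ being counted as one entry). With even basis $e_1,e_2$ and odd basis $f_1,f_2$, they are listed below; in square brackets are given the orbit dimension and the decomposition into indecomposables (''Indec.'' means indecomposable): $\mathcal J_{1}$ [$12$; $\mathcal U_1\oplus\mathcal U_1\oplus\mathcal S_1^1\oplus\mathcal S_1^1$]: $e_1^2=e_1,\ e_2^2=e_2$; $\mathcal J_{2}$ [$13$; $\mathcal U_1\oplus\mathcal S_2^2\oplus\mathcal S_1^1$]: $e_1^2=e_1,\ e_2^2=e_2,\ e_2f_2=f_2$; $\mathcal J_{3}$ [$13$; $\mathcal U_1\oplus\mathcal S_1^2\oplus\mathcal S_1^1$]: $e_1^2=e_1,\ e_2^2=e_2,\ e_2f_2=\frac12f_2$; $\mathcal J_{4}$ [$12$; $\mathcal U_1\oplus\mathcal S_6^3$]: $e_1^2=e_1,\ e_2^2=e_2,\ e_2f_1=f_1,\ e_2f_2=f_2$; $\mathcal J_{5}$ [$13$; $\mathcal U_1\oplus\mathcal S_4^3$]: $e_1^2=e_1,\ e_2^2=e_2,\ e_2f_1=f_1,\ e_2f_2=\frac12f_2$; $\mathcal J_{6}$ [$13$; $\mathcal U_1\oplus\mathcal S_8^3$]: $e_1^2=e_1,\ e_2^2=e_2,\ e_2f_1=f_1,\ e_2f_2=f_2,\ f_1f_2=e_2$; $\mathcal J_{7}$ [$10$; $\mathcal U_1\oplus\mathcal S_5^3$]: $e_1^2=e_1,\ e_2^2=e_2,\ e_2f_1=\frac12f_1,\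 e_2f_2=\frac12f_2$; $\mathcal J_{8}$ [$11$; $\mathcal U_1\oplus\mathcal S_7^3$]: $e_1^2=e_1,\ e_2^2=e_2,\ e_2f_1=\frac12f_1,\ e_2f_2=\frac12f_2,\ f_1f_2=e_2$; $\mathcal J_{9}$ [$13$; $\mathcal S_{13}^3\oplus\mathcal S_1^1$]: $e_1^2=e_1,\ e_2^2=e_2,\ e_1f_2=\frac12f_2,\ e_2f_2=\frac12f_2$; $\mathcal J_{10}$ [$12$; $\mathcal S_1^2\oplus\mathcal S_2^2$]: $e_1^2=e_1,\ e_2^2=e_2,\ e_1f_2=\frac12f_2,\ e_2f_1=f_1$; $\mathcal J_{11}$ [$13$; Indec.]: $e_1^2=e_1,\ e_2^2=e_2,\ e_1f_2=\frac12f_2,\ e_2f_1=f_1,\ e_2f_2=\frac12f_2$; $\mathcal J_{12}$ [$12$; $\mathcal S_1^2\oplus\mathcal S_1^2$]: $e_1^2=e_1,\ e_2^2=e_2,\ e_1f_2=\frac12f_2,\ e_2f_1=\frac12f_1$; $\mathcal J_{13}$ [$12$; Indec.]: $e_1^2=e_1,\ e_2^2=e_2,\ e_1f_2=\frac12f_2,\ e_2f_1=\frac12f_1,\ e_2f_2=\frac12f_2$; $\mathcal J_{14}$ [$12$; $\mathcal S_2^2\oplus\mathcal S_2^2$]: $e_1^2=e_1,\ e_2^2=e_2,\ e_1f_2=f_2,\ e_2f_1=f_1$; $\mathcal J_{15}$ [$10$; Indec.]: $e_1^2=e_1,\ e_2^2=e_2,\ e_1f_1=\frac12f_1,\ e_1f_2=\frac12f_2,\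 e_2f_1=\frac12f_1,\ e_2f_2=\frac12f_2$; $\mathcal J_{16}^t$ [$12$; Indec.]: $e_1^2=e_1,\ e_2^2=e_2,\ e_1f_1=\frac12f_1,\ e_1f_2=\frac12f_2,\ e_2f_1=\frac12f_1,\ e_2f_2=\frac12f_2,\ f_1f_2=e_1+te_2$; $\mathcal J_{17}$ [$6$; $\mathcal U_2\oplus\mathcal S_2^3$]: $f_1f_2=e_1$; $\mathcal J_{18}$ [$7$; $\mathcal U_2\oplus\mathcal S_3^3$]: $e_2f_1=f_2$; $\mathcal J_{19}$ [$9$; Indec.]: $e_2f_1=f_2,\ f_1f_2=e_1$; $\mathcal J_{20}$ [$10$; $\mathcal U_2\oplus\mathcal S_1^3$]: $e_2f_1=f_2,\ f_1f_2=e_2$; $\mathcal J_{21}$ [$7$; $\mathcal U_1\oplus\mathcal U_2\oplus\mathcal S_1^1\oplus\mathcal S_1^1$]: $e_1^2=e_1$; $\mathcal J_{22}$ [$10$; $\mathcal U_1\oplus\mathcal S_2^3$]: $e_1^2=e_1,\ f_1f_2=e_2$; $\mathcal J_{23}$ [$11$; $\mathcal U_1\oplus\mathcal S_3^3$]: $e_1^2=e_1,\ e_2f_1=f_2$; $\mathcal J_{24}$ [$12$; $\mathcal U_1\oplus\mathcal S_1^3$]: $e_1^2=e_1,\ e_2f_1=f_2,\ f_1f_2=e_2$; $\mathcal J_{25}$ [$10$; $\mathcal U_2\oplus\mathcal S_1^2\oplus\mathcal S_1^1$]: $e_1^2=e_1,\ e_1f_2=\frac12f_2$; $\mathcal J_{26}$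 [$10$; $\mathcal U_2\oplus\mathcal S_2^2\oplus\mathcal S_1^1$]: $e_1^2=e_1,\ e_1f_2=f_2$; $\mathcal J_{27}$ [$9$; $\mathcal U_2\oplus\mathcal S_5^3$]: $e_1^2=e_1,\ e_1f_1=\frac12f_1,\ e_1f_2=\frac12f_2$; $\mathcal J_{28}$ [$10$; Indec.]: $e_1^2=e_1,\ e_1f_1=\frac12f_1,\ e_1f_2=\frac12f_2,\ f_1f_2=e_2$; $\mathcal J_{29}$ [$10$; $\mathcal U_2\oplus\mathcal S_7^3$]: $e_1^2=e_1,\ e_1f_1=\frac12f_1,\ e_1f_2=\frac12f_2,\ f_1f_2=e_1$; $\mathcal J_{30}$ [$11$; Indec.]: $e_1^2=e_1,\ e_1f_1=\frac12f_1,\ e_1f_2=\frac12f_2,\ f_1f_2=e_1+e_2$; $\mathcal J_{31}$ [$11$; Indec.]: $e_1^2=e_1,\ e_1f_1=\frac12f_1,\ e_1f_2=\frac12f_2,\ e_2f_1=f_2$; $\mathcal J_{32}$ [$12$; Indec.]: $e_1^2=e_1,\ e_1f_1=\frac12f_1,\ e_1f_2=\frac12f_2,\ e_2f_1=f_2,\ f_1f_2=e_2$; $\mathcal J_{33}$ [$12$; $\mathcal U_2\oplus\mathcal S_4^3$]: $e_1^2=e_1,\ e_1f_1=\frac12f_1,\ e_1f_2=f_2$; $\mathcal J_{34}$ [$11$; $\mathcal U_2\oplus\mathcal S_6^3$]: $e_1^2=e_1,\ e_1f_1=f_1,\ e_1f_2=f_2$; $\mathcal J_{35}$ [$12$; $\mathcal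 U_2\oplus\mathcal S_8^3$]: $e_1^2=e_1,\ e_1f_1=f_1,\ e_1f_2=f_2,\ f_1f_2=e_1$; $\mathcal J_{36}$ [$11$; $\mathcal B_1\oplus\mathcal S_1^1\oplus\mathcal S_1^1$]: $e_1^2=e_1,\ e_1e_2=e_2$; $\mathcal J_{37}$ [$12$; $\mathcal S_9^3\oplus\mathcal S_1^1$]: $e_1^2=e_1,\ e_1e_2=e_2,\ e_1f_2=\frac12f_2$; $\mathcal J_{38}$ [$11$; $\mathcal S_{10}^3\oplus\mathcal S_1^1$]: $e_1^2=e_1,\ e_1e_2=e_2,\ e_1f_2=f_2$; $\mathcal J_{39}$ [$9$; Indec.]: $e_1^2=e_1,\ e_1e_2=e_2,\ e_1f_1=\frac12f_1,\ e_1f_2=\frac12f_2$; $\mathcal J_{40}$ [$10$; Indec.]: $e_1^2=e_1,\ e_1e_2=e_2,\ e_1f_1=\frac12f_1,\ e_1f_2=\frac12f_2,\ f_1f_2=e_2$; $\mathcal J_{41}$ [$11$; Indec.]: $e_1^2=e_1,\ e_1e_2=e_2,\ e_1f_1=\frac12f_1,\ e_1f_2=\frac12f_2,\ e_2f_1=f_2$; $\mathcal J_{42}$ [$12$; Indec.]: $e_1^2=e_1,\ e_1e_2=e_2,\ e_1f_1=\frac12f_1,\ e_1f_2=\frac12f_2,\ e_2f_1=f_2,\ f_1f_2=e_2$; $\mathcal J_{43}$ [$10$; Indec.]: $e_1^2=e_1,\ e_1e_2=e_2,\ e_1f_1=\frac12f_1,\ e_1f_2=f_2$; $\mathcal J_{44}$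 [$7$; Indec.]: $e_1^2=e_1,\ e_1e_2=e_2,\ e_1f_1=f_1,\ e_1f_2=f_2$; $\mathcal J_{45}$ [$8$; Indec.]: $e_1^2=e_1,\ e_1e_2=e_2,\ e_1f_1=f_1,\ e_1f_2=f_2,\ f_1f_2=e_2$; $\mathcal J_{46}$ [$10$; Indec.]: $e_1^2=e_1,\ e_1e_2=e_2,\ e_1f_1=f_1,\ e_1f_2=f_2,\ f_1f_2=e_1$; $\mathcal J_{47}$ [$11$; Indec.]: $e_1^2=e_1,\ e_1e_2=e_2,\ e_1f_1=f_1,\ e_1f_2=f_2,\ f_1f_2=e_1+e_2$; $\mathcal J_{48}$ [$10$; Indec.]: $e_1^2=e_1,\ e_1e_2=e_2,\ e_1f_1=f_1,\ e_1f_2=f_2,\ e_2f_1=f_2$; $\mathcal J_{49}$ [$11$; Indec.]: $e_1^2=e_1,\ e_1e_2=e_2,\ e_1f_1=f_1,\ e_1f_2=f_2,\ e_2f_1=f_2,\ f_1f_2=e_2$; $\mathcal J_{50}$ [$10$; $\mathcal B_2\oplus\mathcal S_1^1\oplus\mathcal S_1^1$]: $e_1^2=e_1,\ e_1e_2=\frac12e_2$; $\mathcal J_{51}$ [$9$; $\mathcal S_{11}^3\oplus\mathcal S_1^1$]: $e_1^2=e_1,\ e_1e_2=\frac12e_2,\ e_1f_2=\frac12f_2$; $\mathcal J_{52}$ [$11$; Indec.]: $e_1^2=e_1,\ e_1e_2=\frac12e_2,\ e_1f_2=\frac12f_2,\ f_1f_2=e_2$; $\mathcal J_{53}$ [$11$;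 Indec.]: $e_1^2=e_1,\ e_1e_2=\frac12e_2,\ e_1f_2=\frac12f_2,\ e_2f_2=f_1$; $\mathcal J_{54}$ [$12$; Indec.]: $e_1^2=e_1,\ e_1e_2=\frac12e_2,\ e_1f_2=\frac12f_2,\ e_2f_2=f_1,\ f_1f_2=e_2$; $\mathcal J_{55}$ [$11$; Indec.]: $e_1^2=e_1,\ e_1e_2=\frac12e_2,\ e_1f_2=\frac12f_2,\ e_2f_1=f_2$; $\mathcal J_{56}$ [$13$; Indec.]: $e_1^2=e_1,\ e_1e_2=\frac12e_2,\ e_1f_2=\frac12f_2,\ e_2f_1=f_2,\ f_1f_2=e_2$; $\mathcal J_{57}$ [$12$; $\mathcal S_{12}^3\oplus\mathcal S_1^1$]: $e_1^2=e_1,\ e_1e_2=\frac12e_2,\ e_1f_2=f_2$; $\mathcal J_{58}$ [$4$; Indec.]: $e_1^2=e_1,\ e_1e_2=\frac12e_2,\ e_1f_1=\frac12f_1,\ e_1f_2=\frac12f_2$; $\mathcal J_{59}$ [$9$; Indec.]: $e_1^2=e_1,\ e_1e_2=\frac12e_2,\ e_1f_1=\frac12f_1,\ e_1f_2=f_2$; $\mathcal J_{60}$ [$10$; Indec.]: $e_1^2=e_1,\ e_1e_2=\frac12e_2,\ e_1f_1=\frac12f_1,\ e_1f_2=f_2,\ f_1f_2=e_2$; $\mathcal J_{61}$ [$10$; Indec.]: $e_1^2=e_1,\ e_1e_2=\frac12e_2,\ e_1f_1=\frac12f_1,\ e_1f_2=f_2,\ e_2f_2=f_1$; $\mathcal J_{62}$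 [$11$; Indec.]: $e_1^2=e_1,\ e_1e_2=\frac12e_2,\ e_1f_1=\frac12f_1,\ e_1f_2=f_2,\ e_2f_2=f_1,\ f_1f_2=e_2$; $\mathcal J_{63}$ [$11$; Indec.]: $e_1^2=e_1,\ e_1e_2=\frac12e_2,\ e_1f_1=\frac12f_1,\ e_1f_2=f_2,\ e_2f_1=f_2$; $\mathcal J_{64}$ [$12$; Indec.]: $e_1^2=e_1,\ e_1e_2=\frac12e_2,\ e_1f_1=\frac12f_1,\ e_1f_2=f_2,\ e_2f_1=f_2,\ f_1f_2=e_2$; $\mathcal J_{65}$ [$10$; Indec.]: $e_1^2=e_1,\ e_1e_2=\frac12e_2,\ e_1f_1=f_1,\ e_1f_2=f_2$; $\mathcal J_{66}$ [$6$; $\mathcal B_3\oplus\mathcal S_1^1\oplus\mathcal S_1^1$]: $e_1^2=e_2$; $\mathcal J_{67}$ [$7$; Indec.]: $e_1^2=e_2,\ f_1f_2=e_2$; $\mathcal J_{68}$ [$10$; Indec.]: $e_1^2=e_2,\ f_1f_2=e_1$; $\mathcal J_{69}$ [$11$; Indec.]: $e_1^2=e_2,\ e_2f_1=f_2$; $\mathcal J_{70}$ [$8$; Indec.]: $e_1^2=e_2,\ e_1f_1=f_2$; $\mathcal J_{71}$ [$10$; Indec.]: $e_1^2=e_2,\ e_1f_1=f_2,\ f_1f_2=e_2$.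
   Context: All vector spaces are over $\mathbb C$. A superalgebra is a $\mathbb Z_2$-graded algebra $\mathfrak J=\mathfrak J_0\oplus\mathfrak J_1$ with $\mathfrak J_i\mathfrak J_j\subseteq\mathfrak J_{i+j}$; its type is $(\dim\mathfrak J_0,\dim\mathfrak J_1)$; $|x|=i$ for $x\in\mathfrak J_i$. It is a Jordan superalgebra if for all homogeneous $x,y,z,t$: $xy=(-1)^{|x||y|}yx$ and $$((xy)z)t+(-1)^{|y||z|+|y||t|+|z||t|}((xt)z)y+(-1)^{|x||y|+|x||z|+|x||t|+|z||t|}((yt)z)x=(xy)(zt)+(-1)^{|t|(|y|+|z|)}(xt)(yz)+(-1)^{|y||z|}(xz)(yt).$$ Isomorphisms are grading-preserving algebra isomorphisms. Multiplication tables list only nonzero products of basis vectors, up to supercommutativity ($e_ie_j=e_je_i$, $e_if_j=f_je_i$, $f_if_j=-f_jf_i$); all unlisted products are zero. The parameter $t$ in $\mathcal J_{16}^t$ is a complex number. The orbit dimension is calculated by the formula $\dim O=n^2-\dim\mathrm{Der}(\mathfrak J)$, where $n=4$ is the dimension of the superalgebra and $\mathrm{Der}(\mathfrak J)$ is the Lie algebra of derivations, spanned by the homogeneous linear maps $D$ (with $|D|=0$ if $D$ preserves the grading and $|D|=1$ otherwise) satisfying $D(xy)=D(x)y+(-1)^{|D||x|}xD(y)$. The summands in the decompositions are the following indecomposable (super)algebras, with $e,e_1,e_2$ even and $f,f_1,f_2$ odd. One-dimensional: $\mathcal U_1$: $e^2=e$; $\mathcal U_2$: $e^2=0$; $\mathcal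 S_1^1$: $f^2=0$. Basis $e_1,e_2$: $\mathcal B_1$: $e_1^2=e_1,\ e_1e_2=e_2$; $\mathcal B_2$: $e_1^2=e_1,\ e_1e_2=\frac12e_2$; $\mathcal B_3$: $e_1^2=e_2$. Basis $e,f$: $\mathcal S_1^2$: $e^2=e,\ ef=\frac12f$; $\mathcal S_2^2$: $e^2=e,\ ef=f$. Basis $e,f_1,f_2$: $\mathcal S_1^3$: $ef_1=f_2,\ f_1f_2=e$; $\mathcal S_2^3$: $f_1f_2=e$; $\mathcal S_3^3$: $ef_1=f_2$; $\mathcal S_4^3$: $e^2=e,\ ef_1=f_1,\ ef_2=\frac12f_2$; $\mathcal S_5^3$: $e^2=e,\ ef_1=\frac12f_1,\ ef_2=\frac12f_2$; $\mathcal S_6^3$: $e^2=e,\ ef_1=f_1,\ ef_2=f_2$; $\mathcal S_7^3$: $e^2=e,\ ef_1=\frac12f_1,\ ef_2=\frac12f_2,\ f_1f_2=e$; $\mathcal S_8^3$: $e^2=e,\ ef_1=f_1,\ ef_2=f_2,\ f_1f_2=e$. Basis $e_1,e_2,f$: $\mathcal S_9^3$: $e_1^2=e_1,\ e_1e_2=e_2,\ e_1f=\frac12f$; $\mathcal S_{10}^3$: $e_1^2=e_1,\ e_1e_2=e_2,\ e_1f=f$; $\mathcal S_{11}^3$: $e_1^2=e_1,\ e_1e_2=\frac12e_2,\ e_1f=\frac12f$; $\mathcal S_{12}^3$: $e_1^2=e_1,\ e_1e_2=\frac12e_2,\ e_1f=f$; $\mathcal S_{13}^3$: $e_1^2=e_1,\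 e_2^2=e_2,\ e_1f=\frac12f,\ e_2f=\frac12f$.
   Formalization: Superalgebras with all products zero are excluded (the zero-product one of type (2,2) is missing from the list); the orbit dimension of J_56 is 12, not 13; for J_16^t each orbit has dimension 11, and the listed 12 is that of the one-parameter family. *)

(* Defs.v *)
From mathcomp Require Import all_boot all_algebra.
From mathcomp Require Import boolp reals.
From mathcomp.real_closed Require Export complex.

Set Implicit Arguments.
Unset Strict Implicit.
Unset Printing Implicit Defensive.

Import GRing.Theory.
Local Open Scope ring_scope.

(* Parities are booleans: false is even, true is odd, (+) is addition in Z/2;
   in exponents of signs they are read as the naturals 0 and 1. *)
Record superalgebra (F : fieldType) := Superalgebra {
  carrier :> vectType F;
  gr : bool -> {vspace carrier};
  smul : carrier -> carrier -> carrier;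
  gr_total : (gr false + gr true)%VS = fullv;
  gr_disjoint : (gr false :&: gr true)%VS = 0%VS;
  smul_linearr : forall x, linear (smul x);
  smul_linearl : forall y, linear (smul^~ y);
  gr_smul : forall i j x y,
    x \in gr i -> y \in gr j -> smul x y \in gr (i (+) j) }.

Notation "x ** y" := (smul x y) (at level 40, left associativity) : ring_scope.

Section Theory.
Variable F : fieldType.
Implicit Types A B : superalgebra F.

Definition of_type A (m n : nat) : Prop :=
  \dim (gr A false) = m /\ \dim (gr A true) = n.

Definition supercommutative A : Prop :=
  forall (i j : bool) (x y : A), x \in gr A i -> y \in gr A j ->
    x ** y = (-1) ^+ (i * j)%N *: (y ** x).

Definition jordan_identity A : Prop :=
  forall (i j k l : bool) (x y z t : A),
    x \in gr A i -> y \in gr A j -> z \in gr A k -> t \in gr A l ->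
    ((x ** y) ** z) ** t
      + (-1) ^+ (j * k + j * l + k * l)%N *: (((x ** t) ** z) ** y)
      + (-1) ^+ (i * j + i * k + i * l + k * l)%N *: (((y ** t) ** z) ** x)
    = (x ** y) ** (z ** t)
      + (-1) ^+ (l * (j + k))%N *: ((x ** t) ** (y ** z))
      + (-1) ^+ (j * k)%N *: ((x ** z) ** (y ** t)).

Definition jordan A : Prop := supercommutative A /\ jordan_identity A.

Definition has_nonzero_product A : Prop := exists x y : A, x ** y != 0.

Definition isomorphic A B : Prop :=
  exists f : {linear A -> B},
    [/\ bijective f,
        forall i x, x \in gr A i -> f x \in gr B i
      & forall x y, f (x ** y) = f x ** f y].

Lemma span_exists (V : vectType F) (P : V -> Prop) :
  exists U : {vspace V},
    (forall v, P v -> v \in U) /\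
    (forall W : {vspace V}, (forall v, P v -> v \in W) -> (U <= W)%VS).
Proof.
pose Q d := `[< exists U : {vspace V}, \dim U = d /\
  forall W : {vspace V}, (forall v, P v -> v \in W) -> (U <= W)%VS >].
have exQ : exists d, Q d.
  by exists 0%N; apply/asboolP; exists 0%VS; rewrite dimv0; split=> // W _;
     exact: sub0v.
have ubQ d : Q d -> (d <= \dim (fullv : {vspace V}))%N.
  by move=> /asboolP [U [<- _]]; exact/dimvS/subvf.
case: (ex_maxnP exQ ubQ) => d /asboolP [U [dU minU]] maxd.
exists U; split=> // v Pv.
suff -> : U = (U + <[v]>)%VS by exact: subvP (addvSr _ _) _ (memv_line v).
apply/eqP; rewrite eqEdim addvSl dU /=; apply: maxd; apply/asboolP.
exists (U + <[v]>)%VS; split=> // W PW.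
by rewrite subv_add minU //=; apply: PW.
Qed.

Definition linear_span (V : vectType F) (P : V -> Prop) : {vspace V} :=
  projT1 (cid (span_exists P)).

Lemma linear_spanP (V : vectType F) (P : V -> Prop) :
  (forall v, P v -> v \in linear_span P) /\
  (forall W : {vspace V}, (forall v, P v -> v \in W) -> (linear_span P <= W)%VS).
Proof. exact: projT2 (cid (span_exists P)). Qed.

Definition homogeneous_derivation A (d : bool) (D : 'End(A)) : Prop :=
  (forall (i : bool) x, x \in gr A i -> D x \in gr A (i (+) d)) /\
  (forall (i : bool) x y, x \in gr A i ->
     D (x ** y) = D x ** y + (-1) ^+ (d * i)%N *: (x ** D y)).

Definition Der A : {vspace 'End(A)} :=
  linear_span (fun D => exists d, homogeneous_derivation d D).

Definition orbit_dim A : nat := (\dim (fullv : {vspace A}) ^ 2 - \dim (Der A))%N.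

End Theory.

Section Table.
Variable F : fieldType.

(* (false, k) is the even basis vector e_(k+1), (true, k) is f_(k+1). *)
Definition gen := (bool * nat)%type.

Definition e1 : gen := (false, 0%N).
Definition e2 : gen := (false, 1%N).
Definition f1 : gen := (true, 0%N).
Definition f2 : gen := (true, 1%N).

Definition combination := seq (F * gen).

Definition one (g : gen) : combination := [:: (1, g)].
Definition onehalf (g : gen) : combination := [:: (2^-1, g)].

(* An entry (x, y, z) records the product x y = z of two basis vectors. *)
Definition table := seq (gen * gen * combination).

Definition well_graded (T : table) : bool :=
  all (fun p => all (fun q => q.2.1 == p.1.1.1 (+) p.1.2.1) p.2) T.

Section Construction.
Variables m n : nat.

Definition label (i : 'I_(m + n)) : gen :=
  match split i with
  | inl a => (false, val a)
  | inr b => (true, val b)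
  end.

Definition gen_vec (g : gen) : 'rV[F]_(m + n) := \row_i (label i == g)%:R.

Definition comb_vec (z : combination) : 'rV[F]_(m + n) :=
  \sum_(q <- z) q.1 *: gen_vec q.2.

Fixpoint lookup (T : table) (x y : gen) : 'rV[F]_(m + n) :=
  if T is (a, b, z) :: T' then
    if (a, b) == (x, y) then comb_vec z
    else if (a, b) == (y, x) then (-1) ^+ (x.1 * y.1)%N *: comb_vec z
    else lookup T' x y
  else 0.

Definition table_mul (T : table) (u v : 'rV[F]_(m + n)) : 'rV[F]_(m + n) :=
  \sum_i \sum_j (u 0 i * v 0 j) *: lookup T (label i) (label j).

Definition table_gr (b : bool) : {vspace 'rV[F]_(m + n)} :=
  <<[seq (delta_mx 0%R i : 'rV[F]_(m + n)) | i in [pred i | (label i).1 == b]]>>%VS.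

Lemma table_grP b (u : 'rV[F]_(m + n)) :
  reflect (forall i, (label i).1 != b -> u 0 i = 0) (u \in table_gr b).
Proof.
apply: (iffP idP) => [|u0].
  rewrite /table_gr span_def big_image /= => /memv_sumP [w wP ->] i ib.
  rewrite summxE big1 // => j jb.
  have /vlineP [c ->] := wP j jb.
  rewrite !mxE eqxx /=; case: eqP => [ij|_]; last by rewrite mulr0.
  by move: jb; rewrite unfold_in /= -ij (negPf ib).
rewrite (row_sum_delta u); apply: memv_suml => i _.
case: (eqVneq (label i).1 b) => [ib|/u0 ->]; last by rewrite scale0r mem0v.
by apply/memvZ/memv_span/imageP; exists i; rewrite // unfold_in /= ib.
Qed.

Lemma table_gr_total : (table_gr false + table_gr true)%VS = fullv.
Proof.
apply/vspaceP => u; rewrite memvf.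
rewrite (row_sum_delta u); apply: memv_suml => i _; apply: memvZ.
case E: (label i).1; [apply: (subvP (addvSr _ _))|apply: (subvP (addvSl _ _))];
  by apply/memv_span/imageP; exists i; rewrite // unfold_in /= E.
Qed.

Lemma table_gr_disjoint : (table_gr false :&: table_gr true)%VS = 0%VS.
Proof.
apply/eqP; rewrite -subv0; apply/subvP => u.
rewrite memv_cap memv0 => /andP [/table_grP u0 /table_grP u1].
apply/eqP/rowP => i; rewrite mxE.
by case E: (label i).1; [apply: u0|apply: u1]; rewrite E.
Qed.

Lemma table_mul_linearr T u : linear (table_mul T u).
Proof.
move=> c v w; rewrite /table_mul scaler_sumr -big_split /=.
apply: eq_bigr => i _; rewrite scaler_sumr -big_split /=.
apply: eq_bigr => j _; rewrite !mxE scalerA -scalerDl mulrDr.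
by rewrite mulrCA.
Qed.

Lemma table_mul_linearl T v : linear (table_mul T ^~ v).
Proof.
move=> c u w; rewrite /table_mul scaler_sumr -big_split /=.
apply: eq_bigr => i _; rewrite scaler_sumr -big_split /=.
apply: eq_bigr => j _; rewrite !mxE scalerA -scalerDl mulrDl.
by rewrite mulrA.
Qed.

Lemma comb_vec_gr (z : combination) b :
  all (fun q => q.2.1 == b) z -> comb_vec z \in table_gr b.
Proof.
move=> /allP zb; rewrite /comb_vec big_seq; apply: memv_suml => q /zb /eqP qb.
apply/memvZ/table_grP => i ib; rewrite mxE; case: eqP => // lab_i.
by move: ib; rewrite lab_i qb eqxx.
Qed.

Lemma lookup_gr T x y :
  well_graded T -> lookup T x y \in table_gr (x.1 (+) y.1).
Proof.
elim: T => [|[[a b] z] T IH] /=; first by rewrite mem0v.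
move=> /andP [zab /IH {}IH].
case: eqP => [[<- <-]|_]; first exact: comb_vec_gr.
case: eqP => [[<- <-]|_] //; rewrite addbC.
by apply: memvZ; exact: comb_vec_gr.
Qed.

Lemma table_gr_mul T : well_graded T -> forall i j u v,
  u \in table_gr i -> v \in table_gr j -> table_mul T u v \in table_gr (i (+) j).
Proof.
move=> wT i j u v /table_grP u0 /table_grP v0.
apply: memv_suml => k _; apply: memv_suml => l _.
case: (eqVneq (label k).1 i) => [<-|/u0 ->]; last by rewrite mul0r scale0r mem0v.
case: (eqVneq (label l).1 j) => [<-|/v0 ->]; last by rewrite mulr0 scale0r mem0v.
exact/memvZ/lookup_gr.
Qed.

Definition table_alg (T : table) (wT : well_graded T) : superalgebra F :=
  Superalgebra table_gr_total table_gr_disjoint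
    (table_mul_linearr T) (table_mul_linearl T) (table_gr_mul wT).

End Construction.
End Table.

Notation alg m n T := (@table_alg _ m n T isT).

Section DirectSum.
Variable F : fieldType.

Section Binary.
Variables A B : superalgebra F.

Definition dsum_gr (b : bool) : {vspace A * B} :=
  ((linfun fst @^-1: gr A b) :&: (linfun snd @^-1: gr B b))%VS.

Definition dsum_mul (x y : A * B) : A * B := (x.1 ** y.1, x.2 ** y.2).

Lemma dsum_grE b (x : A * B) :
  (x \in dsum_gr b) = (x.1 \in gr A b) && (x.2 \in gr B b).
Proof. by rewrite memv_cap -!memv_preim !lfunE. Qed.

Lemma dsum_gr_total : (dsum_gr false + dsum_gr true)%VS = fullv.
Proof.
apply/vspaceP => -[a b]; rewrite memvf.
have : a \in fullv by rewrite memvf.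
rewrite -gr_total => /memv_addP [a0 a0P [a1 a1P ->]].
have : b \in fullv by rewrite memvf.
rewrite -gr_total => /memv_addP [b0 b0P [b1 b1P ->]].
apply/memv_addP; exists (a0, b0); first by rewrite dsum_grE /= a0P.
by exists (a1, b1); first by rewrite dsum_grE /= a1P.
Qed.

Lemma dsum_gr_disjoint : (dsum_gr false :&: dsum_gr true)%VS = 0%VS.
Proof.
apply/eqP; rewrite -subv0; apply/subvP => -[a b].
rewrite memv_cap !dsum_grE /= memv0 => /andP [/andP [a0 b0] /andP [a1 b1]].
have : a \in (gr A false :&: gr A true)%VS by rewrite memv_cap a0.
have : b \in (gr B false :&: gr B true)%VS by rewrite memv_cap b0.
by rewrite !gr_disjoint !memv0 => /eqP -> /eqP ->.
Qed.

Lemma dsum_mul_linearr x : linear (dsum_mul x).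
Proof. by move=> c y z; rewrite /dsum_mul /= !smul_linearr. Qed.

Lemma dsum_mul_linearl y : linear (dsum_mul ^~ y).
Proof.
move=> c x z; rewrite /dsum_mul /=.
by rewrite (smul_linearl y.1 c) (smul_linearl y.2 c).
Qed.

Lemma dsum_gr_mul i j x y :
  x \in dsum_gr i -> y \in dsum_gr j -> dsum_mul x y \in dsum_gr (i (+) j).
Proof.
rewrite !dsum_grE /= => /andP [? ?] /andP [? ?].
by rewrite !gr_smul.
Qed.

Definition dsum : superalgebra F :=
  Superalgebra dsum_gr_total dsum_gr_disjoint
    dsum_mul_linearr dsum_mul_linearl dsum_gr_mul.

End Binary.

Definition direct_sum (s : seq (superalgebra F)) : superalgebra F :=
  if s is A :: s' then foldl dsum A s' else alg 0 0 [::].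

Definition nonzero (A : superalgebra F) : Prop := (0 < \dim (fullv : {vspace A}))%N.

Definition indecomposable (A : superalgebra F) : Prop :=
  nonzero A /\
  forall B C : superalgebra F,
    nonzero B -> nonzero C -> ~ isomorphic A (dsum B C).

End DirectSum.

Inductive decomposition (F : fieldType) :=
  | Indec
  | Sum of seq (superalgebra F).
Arguments Indec {F}.

Definition decomposes_as (F : fieldType)
    (A : superalgebra F) (d : decomposition F) : Prop :=
  match d with
  | Indec => indecomposable A
  | Sum s => (forall i, (i < size s)%N ->
                indecomposable (nth (direct_sum [::]) s i)) /\
             isomorphic A (direct_sum s)
  end.

(* Si_k is the k-dimensional superalgebra S_i^k. *)
Section Summands.
Variable F : fieldType.

Local Notation one := (one F).
Local Notation onehalf := (onehalf F).

Definition U1 : superalgebra F := alg 1 0 [:: (e1, e1, one e1)].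
Definition U2 : superalgebra F := alg 1 0 [::].
Definition S1_1 : superalgebra F := alg 0 1 [::].

Definition B1 : superalgebra F :=
  alg 2 0 [:: (e1, e1, one e1); (e1, e2, one e2)].
Definition B2 : superalgebra F :=
  alg 2 0 [:: (e1, e1, one e1); (e1, e2, onehalf e2)].
Definition B3 : superalgebra F := alg 2 0 [:: (e1, e1, one e2)].

Definition S1_2 : superalgebra F :=
  alg 1 1 [:: (e1, e1, one e1); (e1, f1, onehalf f1)].
Definition S2_2 : superalgebra F :=
  alg 1 1 [:: (e1, e1, one e1); (e1, f1, one f1)].

Definition S1_3 : superalgebra F :=
  alg 1 2 [:: (e1, f1, one f2); (f1, f2, one e1)].
Definition S2_3 : superalgebra F := alg 1 2 [:: (f1, f2, one e1)].
Definition S3_3 : superalgebra F := alg 1 2 [:: (e1, f1, one f2)].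
Definition S4_3 : superalgebra F :=
  alg 1 2 [:: (e1, e1, one e1); (e1, f1, one f1); (e1, f2, onehalf f2)].
Definition S5_3 : superalgebra F :=
  alg 1 2 [:: (e1, e1, one e1); (e1, f1, onehalf f1); (e1, f2, onehalf f2)].
Definition S6_3 : superalgebra F :=
  alg 1 2 [:: (e1, e1, one e1); (e1, f1, one f1); (e1, f2, one f2)].
Definition S7_3 : superalgebra F :=
  alg 1 2 [:: (e1, e1, one e1); (e1, f1, onehalf f1); (e1, f2, onehalf f2);
              (f1, f2, one e1)].
Definition S8_3 : superalgebra F :=
  alg 1 2 [:: (e1, e1, one e1); (e1, f1, one f1); (e1, f2, one f2);
              (f1, f2, one e1)].
Definition S9_3 : superalgebra F :=
  alg 2 1 [:: (e1, e1, one e1); (e1, e2, one e2); (e1, f1, onehalf f1)].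
Definition S10_3 : superalgebra F :=
  alg 2 1 [:: (e1, e1, one e1); (e1, e2, one e2); (e1, f1, one f1)].
Definition S11_3 : superalgebra F :=
  alg 2 1 [:: (e1, e1, one e1); (e1, e2, onehalf e2); (e1, f1, onehalf f1)].
Definition S12_3 : superalgebra F :=
  alg 2 1 [:: (e1, e1, one e1); (e1, e2, onehalf e2); (e1, f1, one f1)].
Definition S13_3 : superalgebra F :=
  alg 2 1 [:: (e1, e1, one e1); (e2, e2, one e2);
              (e1, f1, onehalf f1); (e2, f1, onehalf f1)].

End Summands.

Record entry (F : fieldType) := Entry {
  listed_dim : nat;
  listed_decomposition : decomposition F;
  listed_alg : superalgebra F }.

Section Listing.
Variables (F : fieldType) (t : F).

Local Notation one := (one F).
Local Notation onehalf := (onehalf F).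

(* Only entry 16 depends on t.  Entries are listed for 1 <= k <= 71.
   The algebra of entry 56 has a 4-dimensional Der, hence orbit dimension 12;
   the value 13 found in print is a misprint. *)
Definition listing (k : nat) : entry F :=
  match k with
  | 1 => Entry 12 (Sum [:: U1 F; U1 F; S1_1 F; S1_1 F])
      (alg 2 2 [:: (e1, e1, one e1); (e2, e2, one e2)])
  | 2 => Entry 13 (Sum [:: U1 F; S2_2 F; S1_1 F])
      (alg 2 2 [:: (e1, e1, one e1); (e2, e2, one e2); (e2, f2, one f2)])
  | 3 => Entry 13 (Sum [:: U1 F; S1_2 F; S1_1 F])
      (alg 2 2 [:: (e1, e1, one e1); (e2, e2, one e2); (e2, f2, onehalf f2)])
  | 4 => Entry 12 (Sum [:: U1 F; S6_3 F])
      (alg 2 2 [:: (e1, e1, one e1); (e2, e2, one e2); (e2, f1, one f1);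
                  (e2, f2, one f2)])
  | 5 => Entry 13 (Sum [:: U1 F; S4_3 F])
      (alg 2 2 [:: (e1, e1, one e1); (e2, e2, one e2); (e2, f1, one f1);
                  (e2, f2, onehalf f2)])
  | 6 => Entry 13 (Sum [:: U1 F; S8_3 F])
      (alg 2 2 [:: (e1, e1, one e1); (e2, e2, one e2); (e2, f1, one f1);
                  (e2, f2, one f2); (f1, f2, one e2)])
  | 7 => Entry 10 (Sum [:: U1 F; S5_3 F])
      (alg 2 2 [:: (e1, e1, one e1); (e2, e2, one e2); (e2, f1, onehalf f1);
                  (e2, f2, onehalf f2)])
  | 8 => Entry 11 (Sum [:: U1 F; S7_3 F])
      (alg 2 2 [:: (e1, e1, one e1); (e2, e2, one e2); (e2, f1, onehalf f1);
                  (e2, f2, onehalf f2); (f1, f2, one e2)])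
  | 9 => Entry 13 (Sum [:: S13_3 F; S1_1 F])
      (alg 2 2 [:: (e1, e1, one e1); (e2, e2, one e2); (e1, f2, onehalf f2);
                  (e2, f2, onehalf f2)])
  | 10 => Entry 12 (Sum [:: S1_2 F; S2_2 F])
      (alg 2 2 [:: (e1, e1, one e1); (e2, e2, one e2); (e1, f2, onehalf f2);
                  (e2, f1, one f1)])
  | 11 => Entry 13 Indec
      (alg 2 2 [:: (e1, e1, one e1); (e2, e2, one e2); (e1, f2, onehalf f2);
                  (e2, f1, one f1); (e2, f2, onehalf f2)])
  | 12 => Entry 12 (Sum [:: S1_2 F; S1_2 F])
      (alg 2 2 [:: (e1, e1, one e1); (e2, e2, one e2); (e1, f2, onehalf f2);
                  (e2, f1, onehalf f1)])
  | 13 => Entry 12 Indec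
      (alg 2 2 [:: (e1, e1, one e1); (e2, e2, one e2); (e1, f2, onehalf f2);
                  (e2, f1, onehalf f1); (e2, f2, onehalf f2)])
  | 14 => Entry 12 (Sum [:: S2_2 F; S2_2 F])
      (alg 2 2 [:: (e1, e1, one e1); (e2, e2, one e2); (e1, f2, one f2);
                  (e2, f1, one f1)])
  | 15 => Entry 10 Indec
      (alg 2 2 [:: (e1, e1, one e1); (e2, e2, one e2); (e1, f1, onehalf f1);
                  (e1, f2, onehalf f2); (e2, f1, onehalf f1); (e2, f2, onehalf f2)])
  | 16 => Entry 12 Indec
      (alg 2 2 [:: (e1, e1, one e1); (e2, e2, one e2); (e1, f1, onehalf f1);
                  (e1, f2, onehalf f2); (e2, f1, onehalf f1); (e2, f2, onehalf f2);
                  (f1, f2, one e1 ++ [:: (t, e2)])])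
  | 17 => Entry 6 (Sum [:: U2 F; S2_3 F])
      (alg 2 2 [:: (f1, f2, one e1)])
  | 18 => Entry 7 (Sum [:: U2 F; S3_3 F])
      (alg 2 2 [:: (e2, f1, one f2)])
  | 19 => Entry 9 Indec
      (alg 2 2 [:: (e2, f1, one f2); (f1, f2, one e1)])
  | 20 => Entry 10 (Sum [:: U2 F; S1_3 F])
      (alg 2 2 [:: (e2, f1, one f2); (f1, f2, one e2)])
  | 21 => Entry 7 (Sum [:: U1 F; U2 F; S1_1 F; S1_1 F])
      (alg 2 2 [:: (e1, e1, one e1)])
  | 22 => Entry 10 (Sum [:: U1 F; S2_3 F])
      (alg 2 2 [:: (e1, e1, one e1); (f1, f2, one e2)])
  | 23 => Entry 11 (Sum [:: U1 F; S3_3 F])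
      (alg 2 2 [:: (e1, e1, one e1); (e2, f1, one f2)])
  | 24 => Entry 12 (Sum [:: U1 F; S1_3 F])
      (alg 2 2 [:: (e1, e1, one e1); (e2, f1, one f2); (f1, f2, one e2)])
  | 25 => Entry 10 (Sum [:: U2 F; S1_2 F; S1_1 F])
      (alg 2 2 [:: (e1, e1, one e1); (e1, f2, onehalf f2)])
  | 26 => Entry 10 (Sum [:: U2 F; S2_2 F; S1_1 F])
      (alg 2 2 [:: (e1, e1, one e1); (e1, f2, one f2)])
  | 27 => Entry 9 (Sum [:: U2 F; S5_3 F])
      (alg 2 2 [:: (e1, e1, one e1); (e1, f1, onehalf f1); (e1, f2, onehalf f2)])
  | 28 => Entry 10 Indec
      (alg 2 2 [:: (e1, e1, one e1); (e1, f1, onehalf f1); (e1, f2, onehalf f2);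
                  (f1, f2, one e2)])
  | 29 => Entry 10 (Sum [:: U2 F; S7_3 F])
      (alg 2 2 [:: (e1, e1, one e1); (e1, f1, onehalf f1); (e1, f2, onehalf f2);
                  (f1, f2, one e1)])
  | 30 => Entry 11 Indec
      (alg 2 2 [:: (e1, e1, one e1); (e1, f1, onehalf f1); (e1, f2, onehalf f2);
                  (f1, f2, one e1 ++ one e2)])
  | 31 => Entry 11 Indec
      (alg 2 2 [:: (e1, e1, one e1); (e1, f1, onehalf f1); (e1, f2, onehalf f2);
                  (e2, f1, one f2)])
  | 32 => Entry 12 Indec
      (alg 2 2 [:: (e1, e1, one e1); (e1, f1, onehalf f1); (e1, f2, onehalf f2);
                  (e2, f1, one f2); (f1, f2, one e2)])
  | 33 => Entry 12 (Sum [:: U2 F; S4_3 F])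
      (alg 2 2 [:: (e1, e1, one e1); (e1, f1, onehalf f1); (e1, f2, one f2)])
  | 34 => Entry 11 (Sum [:: U2 F; S6_3 F])
      (alg 2 2 [:: (e1, e1, one e1); (e1, f1, one f1); (e1, f2, one f2)])
  | 35 => Entry 12 (Sum [:: U2 F; S8_3 F])
      (alg 2 2 [:: (e1, e1, one e1); (e1, f1, one f1); (e1, f2, one f2);
                  (f1, f2, one e1)])
  | 36 => Entry 11 (Sum [:: B1 F; S1_1 F; S1_1 F])
      (alg 2 2 [:: (e1, e1, one e1); (e1, e2, one e2)])
  | 37 => Entry 12 (Sum [:: S9_3 F; S1_1 F])
      (alg 2 2 [:: (e1, e1, one e1); (e1, e2, one e2); (e1, f2, onehalf f2)])
  | 38 => Entry 11 (Sum [:: S10_3 F; S1_1 F])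
      (alg 2 2 [:: (e1, e1, one e1); (e1, e2, one e2); (e1, f2, one f2)])
  | 39 => Entry 9 Indec
      (alg 2 2 [:: (e1, e1, one e1); (e1, e2, one e2); (e1, f1, onehalf f1);
                  (e1, f2, onehalf f2)])
  | 40 => Entry 10 Indec
      (alg 2 2 [:: (e1, e1, one e1); (e1, e2, one e2); (e1, f1, onehalf f1);
                  (e1, f2, onehalf f2); (f1, f2, one e2)])
  | 41 => Entry 11 Indec
      (alg 2 2 [:: (e1, e1, one e1); (e1, e2, one e2); (e1, f1, onehalf f1);
                  (e1, f2, onehalf f2); (e2, f1, one f2)])
  | 42 => Entry 12 Indec
      (alg 2 2 [:: (e1, e1, one e1); (e1, e2, one e2); (e1, f1, onehalf f1);
                  (e1, f2, onehalf f2); (e2, f1, one f2); (f1, f2, one e2)])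
  | 43 => Entry 10 Indec
      (alg 2 2 [:: (e1, e1, one e1); (e1, e2, one e2); (e1, f1, onehalf f1);
                  (e1, f2, one f2)])
  | 44 => Entry 7 Indec
      (alg 2 2 [:: (e1, e1, one e1); (e1, e2, one e2); (e1, f1, one f1);
                  (e1, f2, one f2)])
  | 45 => Entry 8 Indec
      (alg 2 2 [:: (e1, e1, one e1); (e1, e2, one e2); (e1, f1, one f1);
                  (e1, f2, one f2); (f1, f2, one e2)])
  | 46 => Entry 10 Indec
      (alg 2 2 [:: (e1, e1, one e1); (e1, e2, one e2); (e1, f1, one f1);
                  (e1, f2, one f2); (f1, f2, one e1)])
  | 47 => Entry 11 Indec
      (alg 2 2 [:: (e1, e1, one e1); (e1, e2, one e2); (e1, f1, one f1);
                  (e1, f2, one f2); (f1, f2, one e1 ++ one e2)])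
  | 48 => Entry 10 Indec
      (alg 2 2 [:: (e1, e1, one e1); (e1, e2, one e2); (e1, f1, one f1);
                  (e1, f2, one f2); (e2, f1, one f2)])
  | 49 => Entry 11 Indec
      (alg 2 2 [:: (e1, e1, one e1); (e1, e2, one e2); (e1, f1, one f1);
                  (e1, f2, one f2); (e2, f1, one f2); (f1, f2, one e2)])
  | 50 => Entry 10 (Sum [:: B2 F; S1_1 F; S1_1 F])
      (alg 2 2 [:: (e1, e1, one e1); (e1, e2, onehalf e2)])
  | 51 => Entry 9 (Sum [:: S11_3 F; S1_1 F])
      (alg 2 2 [:: (e1, e1, one e1); (e1, e2, onehalf e2); (e1, f2, onehalf f2)])
  | 52 => Entry 11 Indec
      (alg 2 2 [:: (e1, e1, one e1); (e1, e2, onehalf e2); (e1, f2, onehalf f2);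
                  (f1, f2, one e2)])
  | 53 => Entry 11 Indec
      (alg 2 2 [:: (e1, e1, one e1); (e1, e2, onehalf e2); (e1, f2, onehalf f2);
                  (e2, f2, one f1)])
  | 54 => Entry 12 Indec
      (alg 2 2 [:: (e1, e1, one e1); (e1, e2, onehalf e2); (e1, f2, onehalf f2);
                  (e2, f2, one f1); (f1, f2, one e2)])
  | 55 => Entry 11 Indec
      (alg 2 2 [:: (e1, e1, one e1); (e1, e2, onehalf e2); (e1, f2, onehalf f2);
                  (e2, f1, one f2)])
  | 56 => Entry 12 Indec
      (alg 2 2 [:: (e1, e1, one e1); (e1, e2, onehalf e2); (e1, f2, onehalf f2);
                  (e2, f1, one f2); (f1, f2, one e2)])
  | 57 => Entry 12 (Sum [:: S12_3 F; S1_1 F])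
      (alg 2 2 [:: (e1, e1, one e1); (e1, e2, onehalf e2); (e1, f2, one f2)])
  | 58 => Entry 4 Indec
      (alg 2 2 [:: (e1, e1, one e1); (e1, e2, onehalf e2); (e1, f1, onehalf f1);
                  (e1, f2, onehalf f2)])
  | 59 => Entry 9 Indec
      (alg 2 2 [:: (e1, e1, one e1); (e1, e2, onehalf e2); (e1, f1, onehalf f1);
                  (e1, f2, one f2)])
  | 60 => Entry 10 Indec
      (alg 2 2 [:: (e1, e1, one e1); (e1, e2, onehalf e2); (e1, f1, onehalf f1);
                  (e1, f2, one f2); (f1, f2, one e2)])
  | 61 => Entry 10 Indec
      (alg 2 2 [:: (e1, e1, one e1); (e1, e2, onehalf e2); (e1, f1, onehalf f1);
                  (e1, f2, one f2); (e2, f2, one f1)])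
  | 62 => Entry 11 Indec
      (alg 2 2 [:: (e1, e1, one e1); (e1, e2, onehalf e2); (e1, f1, onehalf f1);
                  (e1, f2, one f2); (e2, f2, one f1); (f1, f2, one e2)])
  | 63 => Entry 11 Indec
      (alg 2 2 [:: (e1, e1, one e1); (e1, e2, onehalf e2); (e1, f1, onehalf f1);
                  (e1, f2, one f2); (e2, f1, one f2)])
  | 64 => Entry 12 Indec
      (alg 2 2 [:: (e1, e1, one e1); (e1, e2, onehalf e2); (e1, f1, onehalf f1);
                  (e1, f2, one f2); (e2, f1, one f2); (f1, f2, one e2)])
  | 65 => Entry 10 Indec
      (alg 2 2 [:: (e1, e1, one e1); (e1, e2, onehalf e2); (e1, f1, one f1);
                  (e1, f2, one f2)])
  | 66 => Entry 6 (Sum [:: B3 F; S1_1 F; S1_1 F])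
      (alg 2 2 [:: (e1, e1, one e2)])
  | 67 => Entry 7 Indec
      (alg 2 2 [:: (e1, e1, one e2); (f1, f2, one e2)])
  | 68 => Entry 10 Indec
      (alg 2 2 [:: (e1, e1, one e2); (f1, f2, one e1)])
  | 69 => Entry 11 Indec
      (alg 2 2 [:: (e1, e1, one e2); (e2, f1, one f2)])
  | 70 => Entry 8 Indec
      (alg 2 2 [:: (e1, e1, one e2); (e1, f1, one f2)])
  | 71 => Entry 10 Indec
      (alg 2 2 [:: (e1, e1, one e2); (e1, f1, one f2); (f1, f2, one e2)])
  | _ => Entry 0 Indec (alg 2 2 [::])
  end%N.

End Listing.

(* The number of parameters of the k-th entry.  The dimension listed for the
   one-parameter family is that of the union of the orbits of its members; as
   each member is isomorphic to only finitely many others (t and t^-1), it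
   exceeds the dimension of each of these orbits by one. *)
Definition nparams (k : nat) : nat := (k == 16)%N.

(* Main.v *)
(** Everything is expressed by the structure constants of a homogeneous basis.

    The Jordan identity is multilinear, hence a finite list of polynomial equations in
    the structure constants.  For the listed tables, twice the constants are integer
    polynomials in t, and the equations are checked by computation.

    For weights (al, be, ga) depending on the parities involved, the linear maps D with
    al D(xy) = be D(x) y + ga x D(y) form a space whose dimension is an isomorphism
    invariant and the nullity of an explicit matrix.  The weights (1, 1, +-1) give Der,
    hence the orbit dimensions; five choices of weights separate the 71 entries.

    A decomposition into a direct sum is an idempotent of the even centroid.  For the
    algebras said to be indecomposable, every element of the even centroid is, up to a
    permutation of the basis, triangular with a constant diagonal, so that its only
    idempotents are 0 and 1.  The other algebras split along a permutation of the basis.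

    For completeness, either the even part contains an idempotent e1, which acts on the
    whole algebra diagonalizably with eigenvalues 0, 1/2, 1 (Peirce decomposition), or the
    even part is nil and acts on the odd part by nilpotent maps.  In each case the Jordan
    identity leaves few nonzero structure constants, which are normalized by rescaling the
    basis. *)
From Stdlib Require Import ZArith.
From HB Require Import structures.
Require Import Defs.
From mathcomp Require Import all_boot all_order all_algebra.
From mathcomp Require Import boolp reals.
From mathcomp.real_closed Require Import complex.
From mathcomp Require Import ssrZ zify ring.

Set Implicit Arguments.
Unset Strict Implicit.
Unset Printing Implicit Defensive.

Import GRing.Theory Num.Theory.
Local Open Scope ring_scope.

(** The difficulty in completeness is that [e1] and [e2] act on the odd part at once, and an odd
    basis adapted to one action may spoil the other. Multiplication by an idempotent is annihilated
    by x(1 - 2x)(1 - x), which has simple roots. If the idempotent has two distinct eigenvalues on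
    the odd part, the Jordan identity kills most coordinates of the other action. If they coincide,
    it acts as a scalar, which no change of odd basis disturbs, and that freedom brings the other
    action to triangular or diagonal form. The clauses about a scalar [s] in [odd_triangular] and
    [odd_diagonal] record this.

    In the computations [t] is an indeterminate, but a rank computed over the rational functions in
    [t] would only be valid for generic [t]. Pivots are therefore restricted to nonzero integers, so
    that each verdict holds for every value of [t] simultaneously. *)

(** * Bilinearity, gradings and isomorphisms *)

Lemma linear_exists (F : fieldType) (U V : lmodType F) (f : U -> V) :
  linear f -> exists g : {linear U -> V}, g =1 f.
Proof.
move=> lf.
pose g : {linear U -> V} := HB.pack f (GRing.isLinear.Build _ _ _ _ f lf).
by exists g.
Qed.

Section Bilinear.
Variables (F : fieldType) (A : superalgebra F).
Implicit Types x y z : A.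

Lemma smulDr x y z : x ** (y + z) = x ** y + x ** z.
Proof. by have := smul_linearr x 1 y z; rewrite !scale1r. Qed.

Lemma smulDl x y z : (x + y) ** z = x ** z + y ** z.
Proof. by have := smul_linearl z 1 x y; rewrite !scale1r. Qed.

Lemma smul0r x : 0 ** x = 0.
Proof. by apply: (addrI (0 ** x)); rewrite -smulDl !addr0. Qed.

Lemma smulr0 x : x ** 0 = 0.
Proof. by apply: (addrI (x ** 0)); rewrite -smulDr !addr0. Qed.

Lemma smulZr a x y : x ** (a *: y) = a *: (x ** y).
Proof. by have := smul_linearr x a y 0; rewrite smulr0 !addr0. Qed.

Lemma smulZl a x y : (a *: x) ** y = a *: (x ** y).
Proof. by have := smul_linearl y a x 0; rewrite smul0r !addr0. Qed.

Lemma smul_suml I (r : seq I) (P : pred I) (f : I -> A) x :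
  (\sum_(i <- r | P i) f i) ** x = \sum_(i <- r | P i) f i ** x.
Proof.
apply: (big_morph (fun y => y ** x)); last exact: smul0r.
by move=> y z; exact: smulDl.
Qed.

Lemma smul_sumr I (r : seq I) (P : pred I) (f : I -> A) x :
  x ** (\sum_(i <- r | P i) f i) = \sum_(i <- r | P i) x ** f i.
Proof.
apply: (big_morph (fun y => x ** y)); last exact: smulr0.
by move=> y z; exact: smulDr.
Qed.

Lemma gr_decomp x : exists x0 x1,
  [/\ x0 \in gr A false, x1 \in gr A true & x = x0 + x1].
Proof.
have : x \in fullv by rewrite memvf.
by rewrite -gr_total => /memv_addP [x0 P0 [x1 P1 ->]]; exists x0, x1.
Qed.

Lemma gr_disj b x : x \in gr A b -> x \in gr A (~~ b) -> x = 0.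
Proof.
move=> xb xNb; apply/eqP; rewrite -memv0 -(gr_disjoint A) memv_cap.
by case: b xb xNb => -> ->.
Qed.

End Bilinear.

(** Only the grading needs an argument: after splitting g x into its two homogeneous parts, [f]
    sends the part of the wrong parity to a vector lying in both components of [B], hence to 0. *)
Lemma isomorphism_inverse (F : fieldType) (A B : superalgebra F) (f : {linear A -> B}) :
  bijective f -> (forall i x, x \in gr A i -> f x \in gr B i) ->
  (forall x y, f (x ** y) = f x ** f y) ->
  exists g : {linear B -> A}, [/\ cancel f g, cancel g f,
    forall i x, x \in gr B i -> g x \in gr A i
  & forall x y, g (x ** y) = g x ** g y].
Proof.
case=> g fK gK fgr fM; have [gl glE] := linear_exists (can2_linear fK gK).
exists gl; split=> [x|x|i x xi|x y]; rewrite ?glE ?fK ?gK //.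
- have [x0 [x1 [P0 P1 E]]] := gr_decomp (g x).
  have /eqP : x - f x0 - f x1 = 0 by rewrite -addrA -opprD -linearD -E gK subrr.
  rewrite /= E; case: i xi => xi; rewrite subr_eq0 => /eqP H.
    have /(gr_disj (fgr _ _ P0)) : f x0 \in gr B true.
      by rewrite -[f x0](subKr x) H rpredB // fgr.
    by rewrite -(linear0 f) => /(can_inj fK) ->; rewrite add0r.
  have : f x1 = 0.
    by apply: (gr_disj (fgr _ _ P1)); rewrite /= -H rpredB // fgr.
  by rewrite -(linear0 f) => /(can_inj fK) ->; rewrite addr0.
- by apply: (can_inj fK); rewrite fM !gK.
Qed.

Lemma isomorphic_sym (F : fieldType) (A B : superalgebra F) :
  isomorphic A B -> isomorphic B A.
Proof.
case=> f [fb fgr fM]; have [g [fK gK ggr gM]] := isomorphism_inverse fb fgr fM.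
by exists g; split=> //; exists f.
Qed.

(** * Structure constants of a homogeneous basis *)

(** Parities and constants are functions on [nat] rather than on ordinals, so that tables,
    permutations and the shifted indices of a direct sum need no casts; only values at indices below
    [N] matter. *)
Definition coordinates (F : fieldType) (A : superalgebra F) (N : nat)
    (par : nat -> bool) (c : nat -> nat -> nat -> F)
    (phi : {linear 'rV[F]_N -> A}) (psi : {linear A -> 'rV[F]_N}) : Prop :=
  [/\ cancel phi psi, cancel psi phi,
      forall i : 'I_N, phi (delta_mx 0 i) \in gr A (par i)
    & forall i j : 'I_N,
        phi (delta_mx 0 i) ** phi (delta_mx 0 j) = phi (\row_k c i j k)].

Definition presented (F : fieldType) (A : superalgebra F) N par c : Prop :=
  exists phi psi, @coordinates F A N par c phi psi.

Section Coordinates.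
Variables (F : fieldType) (A : superalgebra F) (N : nat).
Variables (par : nat -> bool) (c : nat -> nat -> nat -> F).
Variables (phi : {linear 'rV[F]_N -> A}) (psi : {linear A -> 'rV[F]_N}).
Hypothesis co : coordinates par c phi psi.

Let phiK : cancel phi psi. Proof. by case: co. Qed.
Let psiK : cancel psi phi. Proof. by case: co. Qed.

Lemma coord_phi_gr b (u : 'rV_N) :
  (forall i : 'I_N, par i != b -> u 0 i = 0) -> phi u \in gr A b.
Proof.
move=> u0; rewrite [u]row_sum_delta linear_sum; apply: rpred_sum => i _.
rewrite linearZ /=; case: (eqVneq (par i) b) => [<-|/u0 ->].
  by apply: rpredZ; case: co.
by rewrite scale0r mem0v.
Qed.

Lemma coord_gr b x :
  x \in gr A b <-> (forall i : 'I_N, par i != b -> psi x 0 i = 0).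
Proof.
split=> [xb i ib|]; last by move/coord_phi_gr; rewrite psiK.
pose u b' := \row_i (if par i == b' then psi x 0 i else 0).
have uE : phi (u b) + phi (u (~~ b)) = x.
  rewrite -linearD -[RHS]psiK; congr (phi _); apply/rowP => j; rewrite !mxE.
  by case: (par j); case: (b); rewrite /= ?addr0 ?add0r.
have ugr b' : phi (u b') \in gr A b'.
  by apply: coord_phi_gr => j jb; rewrite mxE (negPf jb).
have : phi (u (~~ b)) = 0.
  apply: (@gr_disj _ _ (~~ b)) => //; rewrite negbK.
  have -> : phi (u (~~ b)) = x - phi (u b) by rewrite -uE addrC addKr.
  by rewrite rpredB.
rewrite -(linear0 phi) => /(can_inj phiK) /rowP /(_ i).
rewrite !mxE; case: eqP => // /eqP; move: ib.
by case: (par i); case: (b).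
Qed.

Definition cmul (u v : 'rV[F]_N) : 'rV[F]_N :=
  \row_k \sum_(i < N) \sum_(j < N) u 0 i * v 0 j * c i j k.

Lemma coord_smul u v : phi u ** phi v = phi (cmul u v).
Proof.
rewrite {1}[u]row_sum_delta {1}[v]row_sum_delta !linear_sum smul_suml.
have -> : cmul u v =
    \sum_(i < N) \sum_(j < N) (u 0 i * v 0 j) *: \row_k c i j k.
  apply/rowP => k; rewrite summxE mxE; apply: eq_bigr => i _.
  by rewrite summxE; apply: eq_bigr => j _; rewrite !mxE.
rewrite linear_sum; apply: eq_bigr => i _.
rewrite smul_sumr linear_sum; apply: eq_bigr => j _.
by rewrite !linearZ /= smulZl smulZr scalerA; case: co => _ _ _ ->.
Qed.

Lemma coord_smul_basis (i j : 'I_N) :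
  phi (delta_mx 0 i) ** phi (delta_mx 0 j) = phi (\row_k c i j k).
Proof. by case: co. Qed.

Lemma coord_graded (i j k : 'I_N) :
  par k != par i (+) par j -> c i j k = 0.
Proof.
move=> H; case: co => _ _ gP mP.
have /coord_gr/(_ k H) := gr_smul (gP i) (gP j).
by rewrite mP phiK mxE.
Qed.

Lemma coord_dim : \dim (fullv : {vspace A}) = N.
Proof.
have <- : \dim (fullv : {vspace 'rV[F]_N}) = N.
  by rewrite dimvf /dim /= mul1n.
have : (lker (linfun psi) == 0)%VS.
  by apply/lker0P => x y; rewrite !lfunE => /(can_inj psiK).
move/eqP => ker0.
rewrite -(@limg_dim_eq _ _ _ (linfun psi)); last by rewrite ker0 capv0.
congr (\dim _); apply/vspaceP => u; rewrite memvf.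
by apply/memv_imgP; exists (phi u); rewrite ?memvf // lfunE /= phiK.
Qed.

End Coordinates.

Lemma presented_ext (F : fieldType) (A : superalgebra F) N
    (par par' : nat -> bool) (c c' : nat -> nat -> nat -> F) :
  presented A N par c ->
  (forall i : 'I_N, par i = par' i) ->
  (forall i j k : 'I_N, c i j k = c' i j k) ->
  presented A N par' c'.
Proof.
case=> phi [psi [phiK psiK gP mP]] pE cE; exists phi, psi.
split=> // [i|i j]; first by rewrite -pE.
by rewrite mP; congr (phi _); apply/rowP => k; rewrite !mxE.
Qed.

Lemma presented_isomorphic (F : fieldType) (A B : superalgebra F) N par c :
  presented A N par c -> presented B N par c -> isomorphic A B.
Proof.
case=> phi [psi co] [phi' [psi' co']].
case: (co) (co') => phiK psiK gP _ [phiK' psiK' gP' _].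
exists (phi' \o psi); split=> [|i x /(coord_gr co) xi|x y] /=.
- by exists (phi \o psi') => x /=; rewrite ?phiK ?psiK ?phiK' ?psiK'.
- by apply: (coord_phi_gr co').
- by rewrite (coord_smul co') -{1}[x]psiK -{1}[y]psiK (coord_smul co) phiK.
Qed.

Lemma isomorphic_presented (F : fieldType) (A B : superalgebra F) N par c :
  isomorphic A B -> presented B N par c -> presented A N par c.
Proof.
move=> /isomorphic_sym [f [[g fK gK] fgr fM]] [phi [psi [phiK psiK gP mP]]].
have [gl glE] := linear_exists (can2_linear fK gK).
exists (f \o phi), (psi \o gl); split=> [u|x|i|i j] /=.
- by rewrite glE fK phiK.
- by rewrite psiK glE gK.
- exact/fgr.
- by rewrite -fM mP.
Qed.

(** The rows of [G] are the new basis vectors. The last hypothesis equates two expansions in the old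
    basis of a product of new vectors, so the inverse matrix never enters the equations on the
    constants. *)
Lemma base_change (F : fieldType) (A : superalgebra F) N par c
    (G G' : 'M[F]_N) (par' : nat -> bool) (c' : nat -> nat -> nat -> F) :
  presented A N par c -> G *m G' = 1%:M ->
  (forall i j : 'I_N, par j != par' i -> G i j = 0) ->
  (forall i j k : 'I_N,
     \sum_(a < N) \sum_(b < N) G i a * G j b * c a b k
       = \sum_(l < N) c' i j l * G l k) ->
  presented A N par' c'.
Proof.
case=> phi [psi co] GG' Gpar Gmul; case: (co) => phiK psiK gP mP.
have G'G := mulmx1C GG'.
have dE i : phi (delta_mx 0 i *m G) = phi (row i G) by rewrite rowE.
exists (phi \o mulmxr G), (mulmxr G' \o psi); split=> [u|x|i|i j] /=.
- by rewrite phiK -mulmxA GG' mulmx1.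
- by rewrite -mulmxA G'G mulmx1 psiK.
- by rewrite dE; apply: (coord_phi_gr co) => j /Gpar; rewrite mxE.
- rewrite !dE (coord_smul co); congr (phi _); apply/rowP => k; rewrite !mxE.
  transitivity (\sum_(a < N) \sum_(b < N) G i a * G j b * c a b k).
    by apply: eq_bigr => a _; apply: eq_bigr => b _; rewrite !mxE.
  by rewrite Gmul; apply: eq_bigr => l _; rewrite !mxE.
Qed.

Lemma presented_perm (F : fieldType) (A : superalgebra F) N par c
    (s s' : nat -> nat) :
  presented A N par c ->
  (forall i, (i < N)%N -> (s i < N)%N /\ s' (s i) = i) ->
  presented A N (par \o s) (fun i j k => c (s i) (s j) (s k)).
Proof.
move=> pA sP.
pose f (i : 'I_N) : 'I_N := insubd i (s i).
have fE i : f i = s i :> nat by rewrite val_insubd; have [-> _] := sP _ (ltn_ord i).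
have finj : injective f.
  move=> i j /(congr1 (@nat_of_ord N)); rewrite !fE => sij.
  have [_ iK] := sP _ (ltn_ord i); have [_ jK] := sP _ (ltn_ord j).
  by apply: val_inj; rewrite /= -iK sij jK.
pose G : 'M[F]_N := \matrix_(i, j) (j == f i)%:R.
have sum_f (g : 'I_N -> F) i : \sum_a G i a * g a = g (f i).
  rewrite (bigD1 (f i)) //= big1 ?addr0 => [|a /negPf ai].
    by rewrite mxE eqxx mul1r.
  by rewrite mxE ai mul0r.
apply: (@base_change _ _ _ _ _ G G^T _ _ pA).
- apply/matrixP => i j; rewrite !mxE sum_f !mxE.
  by rewrite (inj_eq finj).
- by move=> i j; rewrite mxE; case: (j =P f i) => // ->; rewrite /= fE eqxx.
- move=> i j k.
  transitivity (c (s i) (s j) k).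
    under eq_bigr => a _.
      under eq_bigr => b _ do rewrite -mulrA.
      rewrite -mulr_sumr (sum_f (fun b => c a b k)); over.
    by rewrite (sum_f (fun a => c a (f j) k)) !fE.
  have [h _ hK] : bijective f by exact: injF_bij.
  rewrite (bigD1 (h k)) //= big1 ?addr0 => [|a ak].
    by rewrite mxE hK eqxx mulr1 -(fE (h k)) hK.
  rewrite mxE; case: eqP => [kE|_]; last by rewrite mulr0.
  by case/eqP: ak; apply: finj; rewrite hK.
Qed.

Lemma presented_dsum (F : fieldType) (A B : superalgebra F) N N' par par' c c' :
  presented A N par c -> presented B N' par' c' ->
  presented (dsum A B) (N + N')
    (fun i => if (i < N)%N then par i else par' (i - N)%N)
    (fun i j k =>
       if [&& i < N, j < N & k < N]%N then c i j k
       else if [&& N <= i, N <= j & N <= k]%N then c' (i - N)%N (j - N)%N (k - N)%N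
       else 0).
Proof.
case=> phi [psi [phiK psiK gP mP]] [phi' [psi' [phiK' psiK' gP' mP']]].
pose f (u : 'rV[F]_(N + N')) : dsum A B := (phi (lsubmx u), phi' (rsubmx u)).
have [fl flE] : exists fl : {linear 'rV[F]_(N + N') -> dsum A B}, fl =1 f.
  by apply: linear_exists => a u v; rewrite /f !linearP.
pose g (x : dsum A B) : 'rV[F]_(N + N') := row_mx (psi x.1) (psi' x.2).
have [gl glE] : exists gl : {linear dsum A B -> 'rV[F]_(N + N')}, gl =1 g.
  by apply: linear_exists => a x y; rewrite /g /= !linearP /= scale_row_mx add_row_mx.
exists fl, gl.
have dl i : lsubmx (delta_mx 0 (lshift N' i) : 'rV[F]_(N + N')) = delta_mx 0 i.
  by apply/rowP => k; rewrite !mxE -!val_eqE /=.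
have dr i : rsubmx (delta_mx 0 (rshift N i) : 'rV[F]_(N + N')) = delta_mx 0 i.
  by apply/rowP => k; rewrite !mxE -!val_eqE /= eqn_add2l.
have dl0 i : lsubmx (delta_mx 0 (rshift N i) : 'rV[F]_(N + N')) = 0.
  by apply/rowP => k; rewrite !mxE eq_lrshift.
have dr0 i : rsubmx (delta_mx 0 (lshift N' i) : 'rV[F]_(N + N')) = 0.
  by apply/rowP => k; rewrite !mxE eq_rlshift.
have ltl (a : 'I_N) : (lshift N' a < N)%N by exact: (ltn_ord a).
have gel (a : 'I_N) : (N <= lshift N' a)%N = false by rewrite leqNgt ltl.
have ltr (a : 'I_N') : (rshift N a < N)%N = false by rewrite /= ltnNge leq_addr.
have ger (a : 'I_N') : (N <= rshift N a)%N by exact: leq_addr.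
have rK (a : 'I_N') : (rshift N a - N)%N = a by rewrite /= addKn.
split=> [u|[x y]|i|i j].
- by rewrite glE flE /g /f /= phiK phiK' hsubmxK.
- by rewrite glE flE /g /f /= row_mxKl row_mxKr psiK psiK'.
- rewrite flE dsum_grE /f /=; case: (split_ordP i) => a ->.
    by rewrite dl dr0 linear0 mem0v andbT gP.
  by rewrite rK dl0 dr linear0 mem0v gP'.
- rewrite !flE /f /= /dsum_mul /=.
  case: (split_ordP i) => a ->; case: (split_ordP j) => b ->;
    rewrite ?dl ?dr ?dl0 ?dr0 ?linear0 ?smul0r ?smulr0 ?mP ?mP';
    congr (_, _); apply: esym; rewrite -?(linear0 phi) -?(linear0 phi');
    congr (_ _); apply/rowP => k.
all: rewrite !mxE ?ltl ?ltr ?gel ?ger ?rK //=.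
all: rewrite ?andbF.
Qed.

(** [linear_span] is minimal among subspaces, whereas [Q] is only a predicate. A subspace of maximal
    dimension inside [Q] absorbs every [w] satisfying [P], since adding the line of [w] stays inside
    [Q]; minimality then applies to it. *)
Lemma linear_span_ind (F : fieldType) (V : vectType F) (P Q : V -> Prop) :
  (forall v, P v -> Q v) -> Q 0 -> (forall a u v, Q u -> Q v -> Q (a *: u + v)) ->
  forall v, v \in linear_span P -> Q v.
Proof.
move=> PQ Q0 Qlin.
pose D d := `[< exists U : {vspace V}, \dim U = d /\ forall v, v \in U -> Q v >].
have exD : exists d, D d.
  exists 0%N; apply/asboolP; exists 0%VS; rewrite dimv0; split=> // v.
  by rewrite memv0 => /eqP ->.
have ubD d : D d -> (d <= \dim (fullv : {vspace V}))%N.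
  by move=> /asboolP [U [<- _]]; exact/dimvS/subvf.
case: (ex_maxnP exD ubD) => d /asboolP [U [dU UQ]] maxd.
have [_ minU] := linear_spanP P.
move=> v vP; apply: (UQ); apply: subvP vP; apply: minU => w Pw.
suff -> : U = (U + <[w]>)%VS by exact: subvP (addvSr _ _) _ (memv_line w).
apply/eqP; rewrite eqEdim addvSl dU /=; apply: maxd; apply/asboolP.
exists (U + <[w]>)%VS; split=> // _ /memv_addP [u uU [_ /vlineP [a ->] ->]].
by rewrite addrC; apply: Qlin; [exact: PQ | exact: UQ].
Qed.

Definition on_ord (F : nmodType) N (f : 'I_N -> 'I_N -> 'I_N -> F) (i j k : nat) : F :=
  if (insub i, insub j, insub k) is (Some a, Some b, Some d) then f a b d else 0.

Lemma on_ordE (F : nmodType) N (f : 'I_N -> 'I_N -> 'I_N -> F) (i j k : 'I_N) :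
  on_ord f i j k = f i j k.
Proof. by rewrite /on_ord !valK. Qed.

Lemma of_type_presented (F : fieldType) (A : superalgebra F) m n :
  of_type A m n -> exists c, presented A (m + n) (fun i => (m <= i)%N) c.
Proof.
case=> <- <-; set d0 := \dim _; set d1 := \dim _.
pose X : (d0 + d1).-tuple A := cat_tuple (vbasis (gr A false)) (vbasis (gr A true)).
have sX : <<X>>%VS = fullv.
  by rewrite span_cat !(span_basis (vbasisP _)) gr_total.
have dX : \dim (fullv : {vspace A}) = (d0 + d1)%N.
  by rewrite -(gr_total A) dimv_disjoint_sum // gr_disjoint.
have bX : basis_of fullv X by rewrite basisEdim sX subvv dX size_tuple leqnn.
have fX := basis_free bX.
have [phi phiE] : exists phi : {linear 'rV[F]_(d0 + d1) -> A},
    phi =1 fun u => \sum_i u 0 i *: X`_i.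
  apply: linear_exists => a u v; rewrite scaler_sumr -big_split /=.
  by apply: eq_bigr => i _; rewrite !mxE scalerDl scalerA.
have [psi psiE] : exists psi : {linear A -> 'rV[F]_(d0 + d1)},
    psi =1 fun x => \row_i coord X i x.
  by apply: linear_exists => a x y; apply/rowP => i; rewrite !mxE linearP.
have phid i : phi (delta_mx 0 i) = X`_i.
  rewrite phiE (bigD1 i) //= big1 ?addr0 => [|j /negPf ji]; rewrite mxE.
    by rewrite !eqxx scale1r.
  by rewrite ji andbF scale0r.
have psiK : cancel psi phi.
  move=> x; rewrite phiE [RHS](coord_basis bX (memvf x)).
  by apply: eq_bigr => i _; rewrite psiE mxE.
exists (on_ord (fun i j k => psi (phi (delta_mx 0 i) ** phi (delta_mx 0 j)) 0 k)).
exists phi, psi; split=> // [u|i|i j].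
- apply/rowP => i; rewrite phiE psiE mxE.
  by rewrite (@coord_sum_free _ _ _ _ _ i fX).
- rewrite phid nth_cat size_tuple ltnNge; case: leqP => /= H.
    apply: vbasis_mem; apply: mem_nth; rewrite size_tuple.
    by rewrite ltn_subLR.
  by apply: vbasis_mem; apply: mem_nth; rewrite size_tuple.
- rewrite -[LHS]psiK; congr (phi _); apply/rowP => k.
  by rewrite mxE on_ordE.
Qed.

(** * The Jordan identity as polynomial equations *)

Section Jordan.
Variables (F : fieldType) (N : nat) (par : nat -> bool) (c : nat -> nat -> nat -> F).

Definition trip i j k l m : F :=
  \sum_(a < N) \sum_(b < N) c i j a * c a k b * c b l m.
Definition quad i j k l m : F :=
  \sum_(a < N) \sum_(b < N) c i j a * c k l b * c a b m.
Definition sgn (b : bool) (x : F) := if b then - x else x.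

Definition jordan_defect i j k l m : F :=
  let: (x, y, z, t) := (par i, par j, par k, par l) in
  trip i j k l m + sgn ((y && z) (+) (y && t) (+) (z && t)) (trip i l k j m)
  + sgn ((x && y) (+) (x && z) (+) (x && t) (+) (z && t)) (trip j l k i m)
  - quad i j k l m - sgn (t && (y (+) z)) (quad i l j k m)
  - sgn (y && z) (quad i k j l m).

Definition jordan_constants :=
  (forall i j k : 'I_N, c i j k = sgn (par i && par j) (c j i k)) /\
  (forall i j k l m : 'I_N, jordan_defect i j k l m = 0).

Variables (A : superalgebra F).
Variables (phi : {linear 'rV[F]_N -> A}) (psi : {linear A -> 'rV[F]_N}).
Hypothesis co : coordinates par c phi psi.

Let e (i : 'I_N) : A := phi (delta_mx 0 i).

(** Reduces a property that is linear in a homogeneous argument to basis vectors of that parity; the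
    signs, which depend on the parity alone, stay fixed meanwhile. *)
Lemma coord_gr_ind b (P : A -> Prop) :
  P 0 -> (forall a x y, P x -> P y -> P (a *: x + y)) ->
  (forall i : 'I_N, par i = b -> P (e i)) -> forall x, x \in gr A b -> P x.
Proof.
move=> P0 Plin Pe x /(coord_gr co) x0; case: co => _ psiK _ _.
rewrite -[x]psiK [psi x]row_sum_delta linear_sum.
apply: (big_ind P) => // [y z Py Pz|i _]; first by rewrite -[y]scale1r; apply: Plin.
rewrite linearZ /=; case: (eqVneq (par i) b) => [/Pe Pi|/x0 ->].
  by rewrite -[_ *: _]addr0; apply: Plin.
by rewrite scale0r.
Qed.

Lemma mul_row_basis (r : nat -> F) (k : 'I_N) :
  phi (\row_a r a) ** e k = phi (\row_m \sum_(a < N) r a * c a k m).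
Proof.
rewrite /e (coord_smul co); congr (phi _); apply/rowP => m; rewrite !mxE.
apply: eq_bigr => a _; rewrite (bigD1 k) //= big1 ?addr0 => [|b /negPf bk].
  by rewrite !mxE !eqxx mulr1.
by rewrite !mxE bk andbF mulr0 mul0r.
Qed.

Lemma tripE (i j k l : 'I_N) :
  ((e i ** e j) ** e k) ** e l = phi (\row_m trip i j k l m).
Proof.
rewrite (coord_smul_basis co) mul_row_basis.
rewrite (mul_row_basis (fun b => \sum_(a < N) c i j a * c a k b)).
congr (phi _); apply/rowP => m; rewrite !mxE /trip exchange_big.
by apply: eq_bigr => b _; rewrite mulr_suml.
Qed.

Lemma quadE (i j k l : 'I_N) :
  (e i ** e j) ** (e k ** e l) = phi (\row_m quad i j k l m).
Proof.
rewrite !(coord_smul_basis co) (coord_smul co); congr (phi _).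
apply/rowP => m; rewrite !mxE; apply: eq_bigr => a _; apply: eq_bigr => b _.
by rewrite !mxE.
Qed.

Lemma sgnE b (x : F) : sgn b x = (-1) ^+ b * x.
Proof. by case: b; rewrite ?mulN1r ?mul1r. Qed.

Lemma jordan_defectE (i j k l : 'I_N) (w := fun i : 'I_N => nat_of_bool (par i)) :
  (e i ** e j) ** e k ** e l
    + (-1) ^+ (w j * w k + w j * w l + w k * w l)%N *: (((e i ** e l) ** e k) ** e j)
    + (-1) ^+ (w i * w j + w i * w k + w i * w l + w k * w l)%N
        *: (((e j ** e l) ** e k) ** e i)
    = (e i ** e j) ** (e k ** e l)
      + (-1) ^+ (w l * (w j + w k))%N *: ((e i ** e l) ** (e j ** e k))
      + (-1) ^+ (w j * w k)%N *: ((e i ** e k) ** (e j ** e l))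
  <-> (forall m : 'I_N, jordan_defect i j k l m = 0).
Proof.
rewrite !tripE !quadE /w -!linearZ -!linearD; case: (co) => phiK _ _ _.
have sg n b (x : F) : odd n = b -> (-1) ^+ n * x = (-1) ^+ b * x.
  by move=> <-; rewrite signr_odd.
pose p i := nat_of_bool (par i).
have s1 := sg (p j * p k + p j * p l + p k * p l)%N
  ((par j && par k) (+) (par j && par l) (+) (par k && par l)) _
  ltac:(by rewrite !oddD !oddM !oddb).
have s2 := sg (p i * p j + p i * p k + p i * p l + p k * p l)%N
  ((par i && par j) (+) (par i && par k) (+) (par i && par l) (+) (par k && par l))
  _ ltac:(by rewrite !oddD !oddM !oddb).
have s3 := sg (p l * (p j + p k))%N (par l && (par j (+) par k)) _
  ltac:(by rewrite !oddM !oddD !oddb).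
have s4 := sg (p j * p k)%N (par j && par k) _ ltac:(by rewrite !oddM !oddb).
split=> [/(can_inj phiK)/rowP H m|H].
  move: (H m); rewrite !mxE s1 s2 s3 s4 /jordan_defect !sgnE => ->.
  by rewrite -!addrA -!opprD !addrA subrr.
congr (phi _); apply/rowP => m; move: (H m).
rewrite !mxE s1 s2 s3 s4 /jordan_defect !sgnE.
by move/eqP; rewrite -!addrA -!opprD !addrA subr_eq0 => /eqP.
Qed.

Lemma coord_jordan : jordan A <-> jordan_constants.
Proof.
case: (co) => phiK psiK gP mP; split=> [[sc ji]|[sc ji]].
  split=> [i j k|i j k l]; last first.
    apply/jordan_defectE.
    exact: (ji _ _ _ _ _ _ _ _ (gP i) (gP j) (gP k) (gP l)).
  have := sc (par i) (par j) _ _ (gP i) (gP j).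
  rewrite !mP -linearZ => /(can_inj phiK) /rowP /(_ k).
  by rewrite !mxE sgnE => ->; case: (par i); case: (par j).
split=> [i j x y xi yj|i j k l x y z t xi yj zk tl].
  move: x xi; apply: coord_gr_ind => [|a x x' Hx Hx'|a aP].
  - by rewrite smul0r smulr0 scaler0.
  - rewrite smulDl smulZl smulDr smulZr scalerDr Hx Hx'.
    by rewrite !scalerA [_ * a]mulrC.
  move: y yj; apply: coord_gr_ind => [|b y y' Hy Hy'|b bP].
  - by rewrite smul0r smulr0 scaler0.
  - rewrite smulDl smulZl smulDr smulZr scalerDr Hy Hy'.
    by rewrite !scalerA [_ * b]mulrC.
  rewrite /e !mP -linearZ; congr (phi _); apply/rowP => m.
  by rewrite !mxE sc sgnE aP bP; case: (i); case: (j).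
pose L x y z t : A := ((x ** y) ** z) ** t
      + (-1) ^+ (j * k + j * l + k * l)%N *: (((x ** t) ** z) ** y)
      + (-1) ^+ (i * j + i * k + i * l + k * l)%N *: (((y ** t) ** z) ** x).
pose R x y z t : A := (x ** y) ** (z ** t)
      + (-1) ^+ (l * (j + k))%N *: ((x ** t) ** (y ** z))
      + (-1) ^+ (j * k)%N *: ((x ** z) ** (y ** t)).
suff : L x y z t - R x y z t = 0 by move/eqP; rewrite subr_eq0 => /eqP.
pose E x y z t := L x y z t - R x y z t.
rewrite -/(E x y z t).
(* Linearity of the six-term expression in any one argument. It is checked coordinatewise because
   [ring] works on scalars, not on vectors of [A]. *)
have shuffle (a : F) (x1 x2 x3 x4 x5 x6 y1 y2 y3 y4 y5 y6 : A) s1 s2 s3 s4 :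
    a *: x1 + y1 + s1 *: (a *: x2 + y2) + s2 *: (a *: x3 + y3)
    - (a *: x4 + y4 + s3 *: (a *: x5 + y5) + s4 *: (a *: x6 + y6))
    = a *: (x1 + s1 *: x2 + s2 *: x3 - (x4 + s3 *: x5 + s4 *: x6))
      + (y1 + s1 *: y2 + s2 *: y3 - (y4 + s3 *: y5 + s4 *: y6)).
  apply: (can_inj psiK); apply/rowP => m.
  by rewrite !(linearD, linearN, linearZ) /= !mxE; ring.
move: x xi; apply: coord_gr_ind => [|a x x' Hx Hx'|a aP].
- by rewrite /E /L /R !(smul0r, smulr0) !scaler0 !addr0 subrr.
- rewrite /E /L /R !(smulDl, smulDr, smulZl, smulZr) shuffle.
  by rewrite -/(E x y z t) -/(E x' y z t) Hx Hx' scaler0 addr0.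
move: y yj; apply: coord_gr_ind => [|b y y' Hy Hy'|b bP].
- by rewrite /E /L /R !(smul0r, smulr0) !scaler0 !addr0 subrr.
- rewrite /E /L /R !(smulDl, smulDr, smulZl, smulZr) shuffle.
  by rewrite -/(E (e a) y z t) -/(E (e a) y' z t) Hy Hy' scaler0 addr0.
move: z zk; apply: coord_gr_ind => [|d z z' Hz Hz'|d dP].
- by rewrite /E /L /R !(smul0r, smulr0) !scaler0 !addr0 subrr.
- rewrite /E /L /R !(smulDl, smulDr, smulZl, smulZr) shuffle.
  by rewrite -/(E (e a) (e b) z t) -/(E (e a) (e b) z' t) Hz Hz' scaler0 addr0.
move: t tl; apply: coord_gr_ind => [|h t t' Ht Ht'|h hP].
- by rewrite /E /L /R !(smul0r, smulr0) !scaler0 !addr0 subrr.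
- rewrite /E /L /R !(smulDl, smulDr, smulZl, smulZr) shuffle.
  by rewrite -/(E (e a) (e b) (e d) t) -/(E (e a) (e b) (e d) t') Ht Ht' scaler0 addr0.
apply/eqP; rewrite /E subr_eq0; apply/eqP; rewrite /L /R -aP -bP -dP -hP.
by apply/jordan_defectE => m; apply: ji.
Qed.
End Jordan.

(** * Certified linear algebra with a formal parameter *)

(* A polynomial in t is the list of its coefficients, constant term first. *)
Definition pol := seq Z.

Fixpoint padd (p q : pol) : pol :=
  match p, q with
  | [::], _ => q
  | _, [::] => p
  | a :: p', b :: q' => Z.add a b :: padd p' q'
  end.
Definition pscale (a : Z) (p : pol) : pol := map (Z.mul a) p.
Definition popp := pscale (Zneg xH).
Fixpoint pmul (p q : pol) : pol :=
  if p is a :: p' then padd (pscale a q) (Z0 :: pmul p' q) else [::].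
Definition ptrim (p : pol) : pol :=
  foldr (fun a q => if (a == Z0) && nilp q then [::] else a :: q) [::] p.
Definition psgn (b : bool) (p : pol) := if b then popp p else p.
Definition psum (n : nat) (f : nat -> pol) : pol :=
  foldr (fun a s => padd (f a) s) [::] (iota 0 n).
Definition pzero (p : pol) : bool := all (fun a => a == Z0) p.
Definition punit (p : pol) : bool :=
  if p is a :: p' then (a != Z0) && pzero p' else false.

Definition entry_at (r : seq pol) (i : nat) : pol := nth [::] r i.

Definition eliminate (n p : nat) (r q : seq pol) : seq pol :=
  if pzero (entry_at q p) then q
  else mkseq (fun i => ptrim (padd (pmul (entry_at r p) (entry_at q i))
                              (popp (pmul (entry_at q p) (entry_at r i))))) n.

Definition pivot (r : seq pol) : nat := find punit r.

(* Fraction-free Gauss-Jordan elimination; only entries free of t serve as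
   pivots, so that no division by a polynomial in t ever occurs. *)
Fixpoint gauss (n fuel : nat) (todo done : seq (seq pol)) : seq (seq pol) :=
  if fuel is fuel'.+1 then
    if todo is r :: todo' then
      let p := pivot r in
      if (p < size r)%N then
        gauss n fuel' (map (eliminate n p r) todo') (r :: map (eliminate n p r) done)
      else gauss n fuel' todo' done
    else done
  else done.

Definition reduced (n : nat) (rows : seq (seq pol)) : seq (seq pol) :=
  gauss n (size rows) rows [::].

Fixpoint implied (n : nat) (R : seq (seq pol)) (r : seq pol) : bool :=
  if R is q :: R' then
    if punit (entry_at q (pivot q)) then implied n R' (eliminate n (pivot q) q r)
    else implied n R' r
  else all (fun i => pzero (entry_at r i)) (iota 0 n).

Definition free_unknowns (n : nat) (R : seq (seq pol)) : seq nat :=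
  let ps := map pivot R in [seq i <- iota 0 n | i \notin ps].

(** The solution whose free unknown [s] equals K and whose other free unknowns vanish. K is the
    product of all pivots, so that the divisions by the individual pivots are exact over the
    integers. *)
Definition kernel_vector (n : nat) (R : seq (seq pol)) (s : nat) : seq pol :=
  let lead r := head Z0 (entry_at r (pivot r)) in
  let K := foldr (fun r a => Z.mul (lead r) a) (Zpos xH) R in
  foldr (fun r v => set_nth [::] v (pivot r)
           (ptrim (pscale (Z.opp (Z.div K (lead r))) (entry_at r s))))
        (set_nth [::] (nseq n [::]) s [:: K]) R.

(* The elimination is untrusted: its output is only used after the checks below,
   which bound the dimension from above (first check) and from below (second). *)
Definition nullity (n : nat) (rows : seq (seq pol)) : option nat :=
  let R := reduced n rows in
  let S := free_unknowns n R in
  let K := map (kernel_vector n R) S in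
  if all (fun r => punit (entry_at r (pivot r)) &&
            all (fun i => [|| i == pivot r, i \in S | pzero (entry_at r i)])
                (iota 0 n)) R
     && all2 (fun s v =>
          [&& punit (entry_at v s),
              all (fun s' => (s' == s) || pzero (entry_at v s')) S
            & all (fun r => pzero (psum n (fun i => pmul (entry_at r i) (entry_at v i))))
                  rows]) S K
  then Some (size S) else None.

Section Evaluation.
Variables (F : numFieldType) (t : F).

Definition zval (a : Z) : F := (int_of_Z a)%:~R.

Fixpoint pev (p : pol) : F := if p is a :: p' then zval a + t * pev p' else 0.

Lemma zvalD a b : zval (Z.add a b) = zval a + zval b.
Proof. by rewrite /zval -[Z.add a b]/(GRing.add a b) rmorphD rmorphD. Qed.
Lemma zvalM a b : zval (Z.mul a b) = zval a * zval b.
Proof. by rewrite /zval -[Z.mul a b]/(GRing.mul a b) rmorphM rmorphM. Qed.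
Lemma zval_eq0 a : (zval a == 0) = (a == Z0).
Proof. by rewrite /zval intr_eq0; apply/eqP/eqP => [|->] //; case: a => //= p; lia. Qed.

Lemma pevD p q : pev (padd p q) = pev p + pev q.
Proof.
elim: p q => [|a p IH] [|b q] //=; rewrite ?add0r ?addr0 //.
by rewrite zvalD IH; ring.
Qed.
Lemma pev_scale a p : pev (pscale a p) = zval a * pev p.
Proof. by elim: p => [|b p /= ->] /=; rewrite ?mulr0 // zvalM; ring. Qed.
Lemma pevN p : pev (popp p) = - pev p.
Proof. by rewrite pev_scale mulN1r. Qed.
Lemma pevM p q : pev (pmul p q) = pev p * pev q.
Proof.
elim: p => [|a p IH] /=; first by rewrite mul0r.
by rewrite pevD pev_scale /= IH /zval /=; ring.
Qed.
Lemma pev_trim p : pev (ptrim p) = pev p.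
Proof.
elim: p => //= a p <-; case: eqP => [->|] //=; case: (ptrim p) => //=.
by rewrite mulr0 /zval addr0.
Qed.
Lemma pev_sgn b p : pev (psgn b p) = sgn b (pev p).
Proof. by case: b => //; exact: pevN. Qed.
Lemma pev_sum n f : pev (psum n f) = \sum_(a < n) pev (f a).
Proof.
rewrite -(big_mkord xpredT (fun a => pev (f a))) /psum /index_iota subn0.
by elim: (iota 0 n) => [|a s IH] /=; rewrite ?big_nil // big_cons pevD IH.
Qed.
Lemma pev0 p : pzero p -> pev p = 0.
Proof. by elim: p => //= a p IH /andP [/eqP -> /IH ->]; rewrite mulr0 addr0. Qed.
Lemma pev_unit p : punit p -> pev p != 0.
Proof. by case: p => //= a p /andP [a0 /pev0 ->]; rewrite mulr0 addr0 zval_eq0. Qed.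

Section Linear.
Variable n : nat.

Definition dot (r : seq pol) (x : nat -> F) : F := \sum_(i < n) pev (entry_at r i) * x i.

(** The factor [u] is 1 when the row is left alone and the pivot otherwise. Keeping this information
    lets [implied_sound] cancel it. *)
Lemma dot_eliminate p r q x : dot r x = 0 ->
  exists2 u, dot (eliminate n p r q) x = u * dot q x
           & u = 1 \/ u = pev (entry_at r p).
Proof.
move=> r0; rewrite /eliminate; case: ifP => _.
  by exists 1; rewrite ?mul1r; auto.
exists (pev (entry_at r p)); last by right.
have -> : pev (entry_at r p) * dot q x
    = pev (entry_at r p) * dot q x - pev (entry_at q p) * dot r x.
  by rewrite r0 mulr0 subr0.
rewrite /dot !mulr_sumr -sumrB; apply: eq_bigr => i _.
by rewrite {1}/entry_at nth_mkseq // pev_trim pevD pevN !pevM; ring.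
Qed.

Lemma gauss_sound fuel todo done x :
  (forall r, r \in todo -> dot r x = 0) -> (forall r, r \in done -> dot r x = 0) ->
  forall r, r \in gauss n fuel todo done -> dot r x = 0.
Proof.
elim: fuel todo done => [|fuel IH] [|r todo] done //= Ht Hd.
have r0 : dot r x = 0 by apply: Ht; rewrite mem_head.
case: ifP => _; last by apply: IH => // q qt; apply: Ht; rewrite inE qt orbT.
apply: IH => [_ /mapP [q qt ->]|q]; last rewrite inE => /predU1P [->|/mapP [s sd ->]] //.
- by have [u ->] := dot_eliminate (pivot r) q r0; rewrite Ht ?inE ?qt ?orbT ?mulr0.
- by have [u ->] := dot_eliminate (pivot r) s r0; rewrite Hd ?mulr0.
Qed.

Lemma reduced_sound rows x :
  (forall r, r \in rows -> dot r x = 0) ->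
  forall r, r \in reduced n rows -> dot r x = 0.
Proof. by move=> H; apply: gauss_sound. Qed.

(** Only nonzero integer pivots are used, so each elimination multiplies the value of [r] at [x] by
    a nonzero factor; a row reduced to zero forces that value to vanish. *)
Lemma implied_sound R r x :
  implied n R r -> (forall q, q \in R -> dot q x = 0) -> dot r x = 0.
Proof.
elim: R r => [|q R IH] r /=.
  move=> /allP H _; apply: big1 => i _.
  by rewrite pev0 ?mul0r // H // mem_iota ltn_ord.
move=> H HR; have HR' s : s \in R -> dot s x = 0.
  by move=> sR; apply: HR; rewrite inE sR orbT.
move: H; case: ifP => [/pev_unit u|_] /IH /(_ HR') //.
have [v -> vE] := dot_eliminate (pivot q) r (HR q (mem_head _ _)).
have /negPf v0 : v != 0 by case: vE => ->; rewrite ?oner_eq0.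
by move/eqP; rewrite mulf_eq0 v0 => /eqP.
Qed.

Lemma nullityP rows d : nullity n rows = Some d ->
  exists S : d.-tuple nat, [/\ uniq S, (forall s, s \in S -> s < n)%N,
   (forall x, (forall r, r \in rows -> dot r x = 0) ->
      (forall s, s \in S -> x s = 0) -> forall i : 'I_n, x i = 0)
   & (forall s, s \in S -> exists x,
      [/\ forall r, r \in rows -> dot r x = 0, x s != 0
        & forall s', s' \in S -> s' != s -> x s' = 0])].
Proof.
rewrite /nullity; set R := reduced n rows; set S := free_unknowns n R.
case: ifP => // /andP [/allP HR HK] [dE]; subst d.
exists (in_tuple S); split=> [|s|x xrows xS i|s sS].
- by rewrite filter_uniq // iota_uniq.
- by rewrite mem_filter mem_iota => /andP [].
- have xR := reduced_sound xrows.
  case: (boolP (val i \in S)) => [/xS //|iS].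
  have /mapP [r rR iE] : val i \in map pivot R.
    by move: iS; rewrite mem_filter mem_iota /= add0n ltn_ord andbT negbK.
  have /andP [u /allP z] := HR r rR.
  have := xR r rR; rewrite /dot (bigD1 i) //= big1 ?addr0 => [/eqP|j ji].
    by rewrite mulf_eq0 iE (negPf (pev_unit u)) => /eqP.
  have := z j; rewrite mem_iota ltn_ord => /(_ isT).
  case/or3P=> [|/xS ->|/pev0 ->]; rewrite ?mulr0 ?mul0r //.
  by rewrite -iE val_eqE (negPf ji).
- move: HK; rewrite all2E size_map eqxx /= => /allP HK.
  have := HK (s, kernel_vector n R s).
  rewrite -[X in zip X]map_id zip_map => /(_ (map_f _ sS)) /=.
  set v := kernel_vector n R s => /and3P [u /allP z /allP k].
  exists (fun i => pev (entry_at v i)); split=> [r /k /pev0|| s' /z].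
  + by rewrite pev_sum => e; rewrite -[RHS]e; apply: eq_bigr => i _; rewrite pevM.
  + exact: pev_unit.
  + by case/orP=> [->|/pev0].
Qed.

End Linear.

Lemma dim_by_coordinates (V : vectType F) (U : {vspace V}) d
    (f : V -> 'rV[F]_d) :
  linear f -> (forall u, u \in U -> f u = 0 -> u = 0) ->
  (forall i, exists2 u, u \in U & f u 0 i != 0 /\ forall j, j != i -> f u 0 j = 0) ->
  \dim U = d.
Proof.
move=> /linear_exists [g gE] finj fsurj.
rewrite -[RHS]mul1n -[RHS](dimvf 'rV[F]_d).
rewrite -(@limg_dim_eq _ _ _ (linfun g)); last first.
  apply/eqP; rewrite -subv0; apply/subvP => u; rewrite memv_cap memv_ker memv0 lfunE /=.
  by rewrite gE => /andP [uU /eqP fu]; rewrite (finj u).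
congr (\dim _); apply/vspaceP => v; rewrite memvf.
rewrite [v]row_sum_delta; apply: rpred_sum => i _; apply: rpredZ.
have [u uU [ui uj]] := fsurj i.
have -> : delta_mx 0 i = (f u 0 i)^-1 *: linfun g u.
  apply/rowP => j; rewrite lfunE /= gE !mxE /=; case: (eqVneq j i) => [->|/uj ->].
    by rewrite mulVf.
  by rewrite mulr0.
by apply: rpredZ; apply: memv_img.
Qed.

End Evaluation.

(** * Weighted derivations and the dimension of their span *)

Definition weight := bool -> bool -> bool -> Z * Z * Z.

Definition weighted_derivation (F : numFieldType) (A : superalgebra F) (w : weight)
    (d : bool) (D : 'End(A)) : Prop :=
  (forall (i : bool) x, x \in gr A i -> D x \in gr A (i (+) d)) /\
  (forall (i j : bool) x y, x \in gr A i -> y \in gr A j ->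
     let: (al, be, ga) := w d i j in
     zval F al *: D (x ** y) = zval F be *: (D x ** y) + zval F ga *: (x ** D y)).

Definition weighted_Der (F : numFieldType) (A : superalgebra F) (w : weight) :
    {vspace 'End(A)} :=
  linear_span (fun D => exists d, weighted_derivation w d D).

Definition der_weight : weight := fun d i _ =>
  (Zpos xH, Zpos xH, if d && i then Zneg xH else Zpos xH).

(** The two notions differ in that weights may depend on the parity of the second factor, so that
    factor is required to be homogeneous; splitting [y] into its even and odd parts bridges the
    gap. *)
Lemma Der_weighted (F : numFieldType) (A : superalgebra F) :
  Der A = weighted_Der A der_weight.
Proof.
have derE D d : homogeneous_derivation d D <-> @weighted_derivation _ A der_weight d D.
  have sE (i : bool) : zval F (if d && i then Zneg xH else Zpos xH) = (-1) ^+ (d * i)%N.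
    by case: d; case: i.
  split=> [[Dgr DM]|[Dgr DM]]; (split; first by []).
    move=> i j x y xi yj; by rewrite /der_weight sE !scale1r; exact: DM.
  move=> i x y xi; have [y0 [y1 [y0P y1P ->]]] := gr_decomp y.
  have := DM _ _ _ _ xi y0P; have := DM _ _ _ _ xi y1P.
  rewrite /der_weight sE !scale1r !smulDr !linearD /= !smulDr => -> ->.
  by rewrite scalerDr addrACA.
have [DerP Der_min] := linear_spanP (fun D => exists d, @homogeneous_derivation F A d D).
have [wP w_min] := linear_spanP (fun D => exists d, @weighted_derivation F A der_weight d D).
apply/eqP; rewrite eqEsubv; apply/andP; split.
  by apply: Der_min => D [d /derE DP]; apply: wP; exists d.
by apply: w_min => D [d /derE DP]; apply: DerP; exists d.
Qed.

Definition weighted_coef (sc : nat -> nat -> nat -> pol) (u : Z * Z * Z)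
    (i j k a b : nat) : pol :=
  let: (al, be, ga) := u in
  padd (if b == k then pscale al (sc i j a) else [::])
 (padd (if a == i then pscale (Z.opp be) (sc b j k) else [::])
       (if a == j then pscale (Z.opp ga) (sc i b k) else [::])).

(* The unknowns are the entries of the matrix of D, in row-major order. *)
Definition weighted_row (N : nat) (par : nat -> bool) (sc : nat -> nat -> nat -> pol)
    (w : weight) (i j k : nat) : seq pol :=
  let u := w (par i (+) par j (+) par k) (par i) (par j) in
  mkseq (fun q => weighted_coef sc u i j k (q %/ N)%N (q %% N)%N) (N * N).

Definition weighted_rows N par sc w : seq (seq pol) :=
  [seq weighted_row N par sc w ij.1 ij.2 k
    | ij <- [seq (i, j) | i <- iota 0 N, j <- iota 0 N], k <- iota 0 N].

Lemma weighted_rowsP N par sc w r :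
  reflect (exists i j k : 'I_N, r = weighted_row N par sc w i j k)
          (r \in weighted_rows N par sc w).
Proof.
apply: (iffP allpairsP) => [[[[i j] k] /= [/allpairsP [[i' j'] /= [iP jP [-> ->]]] kP ->]]|].
  move: iP jP kP; rewrite !mem_iota /= => iP jP kP.
  by exists (Ordinal iP), (Ordinal jP), (Ordinal kP).
case=> i [j [k ->]]; exists ((val i, val j), val k); rewrite mem_iota ltn_ord.
by split=> //; apply/allpairsP; exists (val i, val j); rewrite !mem_iota !ltn_ord.
Qed.

Lemma sum_square (V : nmodType) (N M : nat) (f : nat -> V) :
  \sum_(q < M * N) f q = \sum_(a < M) \sum_(b < N) f (a * N + b)%N.
Proof.
elim: M => [|M IH]; first by rewrite mul0n !big_ord0.
rewrite mulSn addnC big_split_ord big_ord_recr /= IH; congr (_ + _).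
Qed.

Section Weighted.
Variables (F : numFieldType) (t : F) (N : nat) (par : nat -> bool).
Variables (sc : nat -> nat -> nat -> pol) (w : weight).

Let c i j k : F := pev t (sc i j k) / 2.

Definition unknown (M : 'M[F]_N) (q : nat) : F :=
  if (insub (q %/ N)%N, insub (q %% N)%N) is (Some a, Some b) then M a b else 0.

Lemma unknownE M (a b : 'I_N) : unknown M (a * N + b) = M a b.
Proof.
have N0 : (0 < N)%N by apply: leq_ltn_trans (ltn_ord a).
by rewrite /unknown divnMDl // modnMDl divn_small // modn_small // addn0 !valK.
Qed.

Definition weighted_eqn (u : Z * Z * Z) (M : 'M[F]_N) (i j k : 'I_N) : Prop :=
  let: (al, be, ga) := u in
  zval F al * (\sum_(a < N) c i j a * M a k)
  = zval F be * (\sum_(b < N) M i b * c b j k)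
    + zval F ga * (\sum_(b < N) M j b * c i b k).

(** The row uses doubled constants and thus represents twice the equation, which is harmless because
    the equation is homogeneous. *)
Lemma dot_weighted_row (x : nat -> F) (i j k : 'I_N) :
  dot t (N * N) (weighted_row N par sc w i j k) x = 0 <->
  weighted_eqn (w (par i (+) par j (+) par k) (par i) (par j)) (\matrix_(a, b) x (a * N + b)%N) i j k.
Proof.
rewrite /weighted_eqn /weighted_row.
case: (w _ _ _) => [[al be] ga].
have N0 : (0 < N)%N by apply: leq_ltn_trans (ltn_ord i).
have zN a : zval F (Z.opp a) = - zval F a.
  have -> : Z.opp a = Z.mul (Zneg xH) a by lia.
  by rewrite zvalM mulN1r.
have -> : dot t (N * N) (mkseq (fun q => weighted_coef sc (al, be, ga) i j k
      (q %/ N)%N (q %% N)%N) (N * N)) x =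
  2 * (zval F al * (\sum_(a < N) c i j a * x (a * N + k)%N)
  - zval F be * (\sum_(b < N) x (i * N + b)%N * c b j k)
  - zval F ga * (\sum_(b < N) x (j * N + b)%N * c i b k)).
  rewrite /dot; under eq_bigr => q _ do rewrite /entry_at nth_mkseq //.
  rewrite (sum_square N N (fun q => pev t (weighted_coef sc (al, be, ga) i j k
     (q %/ N)%N (q %% N)%N) * x q)).
  have delta (f : 'I_N -> F) (l : 'I_N) :
      \sum_(b < N) (if b == l :> nat then f b else 0) = f l.
    by rewrite (bigD1 l) //= eqxx big1 ?addr0 // => b /negPf; rewrite -val_eqE => /= ->.
  transitivity (\sum_(a < N) \sum_(b < N) (
     (if b == k :> nat then zval F al * (2 * c i j a) * x (a * N + b)%N else 0)
     - (if a == i :> nat then zval F be * (2 * c b j k) * x (a * N + b)%N else 0)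
     - (if a == j :> nat then zval F ga * (2 * c i b k) * x (a * N + b)%N else 0))).
    apply: eq_bigr => a _; apply: eq_bigr => b _.
    rewrite divnMDl // modnMDl divn_small // modn_small // addn0 /weighted_coef !pevD.
    have c2 i' j' k' : 2 * c i' j' k' = pev t (sc i' j' k').
      by rewrite /c mulrC divfK // pnatr_eq0.
    rewrite !c2; case: ifP => _; case: ifP => _; case: ifP => _;
      rewrite ?pev_scale ?zN /=; ring.
  under eq_bigr => a _ do rewrite !sumrB delta.
  rewrite !sumrB.
  have swap (g : 'I_N -> 'I_N -> F) (l : 'I_N) :
      \sum_(a < N) \sum_(b < N) (if a == l :> nat then g a b else 0) = \sum_(b < N) g l b.
    by rewrite exchange_big; apply: eq_bigr => b _; rewrite (delta (g^~ b)).
  rewrite !swap !mulrBr !mulr_sumr.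
  congr (_ - _ - _); apply: eq_bigr => a _; ring.
have -> : (\sum_(a < N) c i j a * (\matrix_(a, b) x (a * N + b)%N) a k)
    = (\sum_(a < N) c i j a * x (a * N + k)%N).
  by apply: eq_bigr => a _; rewrite mxE.
have -> : \sum_(b < N) (\matrix_(a, b) x (a * N + b)%N) i b * c b j k
    = \sum_(b < N) x (i * N + b)%N * c b j k.
  by apply: eq_bigr => a _; rewrite mxE.
have -> : \sum_(b < N) (\matrix_(a, b) x (a * N + b)%N) j b * c i b k
    = \sum_(b < N) x (j * N + b)%N * c i b k.
  by apply: eq_bigr => a _; rewrite mxE.
split=> [/eqP|->]; last by rewrite addrAC addrK subrr mulr0.
rewrite mulf_eq0 pnatr_eq0 /= -addrA -opprD subr_eq0 => /eqP ->.
by [].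
Qed.

Variables (A : superalgebra F).
Variables (phi : {linear 'rV[F]_N -> A}) (psi : {linear A -> 'rV[F]_N}).
Hypothesis co : coordinates par c phi psi.

Definition mx_of (D : 'End(A)) : 'M[F]_N :=
  \matrix_(i, j) psi (D (phi (delta_mx 0 i))) 0 j.

Definition end_of (M : 'M[F]_N) : 'End(A) :=
  linfun (phi \o mulmxr M \o psi).

Let phiK : cancel phi psi. Proof. by case: co. Qed.
Let psiK : cancel psi phi. Proof. by case: co. Qed.

Lemma mx_ofE (D : 'End(A)) u : D (phi u) = phi (u *m mx_of D).
Proof.
rewrite -[LHS]psiK; congr (phi _); rewrite {1}[u]row_sum_delta !linear_sum.
apply/rowP => j; rewrite summxE mxE; apply: eq_bigr => i _.
by rewrite !linearZ /= !mxE.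
Qed.

Lemma end_ofE M x : end_of M x = phi (psi x *m M).
Proof. by rewrite lfunE. Qed.

Lemma mx_ofK : cancel mx_of end_of.
Proof. by move=> D; apply/lfunP => x; rewrite end_ofE -mx_ofE psiK. Qed.

Lemma end_ofK : cancel end_of mx_of.
Proof.
by move=> M; apply/matrixP => i j; rewrite mxE end_ofE !phiK -rowE mxE.
Qed.

Lemma mx_of_linear : linear mx_of.
Proof.
move=> a D E; apply/matrixP => i j.
by rewrite !mxE add_lfunE scale_lfunE linearP !mxE.
Qed.

Lemma mx_of_smul (D : 'End(A)) (i j : 'I_N) :
  let e (i : 'I_N) := phi (delta_mx 0 i) in
  [/\ D (e i ** e j) = phi (\row_k \sum_(a < N) c i j a * mx_of D a k),
      D (e i) ** e j = phi (\row_k \sum_(b < N) mx_of D i b * c b j k)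
    & e i ** D (e j) = phi (\row_k \sum_(b < N) mx_of D j b * c i b k)].
Proof.
move=> e; rewrite /e !mx_ofE (coord_smul_basis co) mx_ofE -!rowE.
split; first by congr (phi _); apply/rowP => k; rewrite !mxE; apply: eq_bigr => a _; rewrite !mxE.
  rewrite (coord_smul co); congr (phi _); apply/rowP => k; rewrite !mxE.
  apply: eq_bigr => a _; rewrite (bigD1 j) //= big1 ?addr0 => [|b /negPf bj].
    by rewrite !mxE !eqxx mulr1.
  by rewrite !mxE bj andbF mulr0 mul0r.
rewrite (coord_smul co); congr (phi _); apply/rowP => k; rewrite !mxE.
rewrite (bigD1 i) //= [X in _ + X]big1 ?addr0 => [|b /negPf bj].
  by apply: eq_bigr => a _; rewrite !mxE !eqxx mul1r.
by apply: big1 => a _; rewrite !mxE bj andbF !mul0r.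
Qed.

Lemma weighted_derivation_mx d (D : 'End(A)) :
  weighted_derivation w d D <->
  (forall i j : 'I_N, par j != par i (+) d -> mx_of D i j = 0) /\
  (forall i j k : 'I_N, weighted_eqn (w d (par i) (par j)) (mx_of D) i j k).
Proof.
case: (co) => _ _ gP mP; split=> [[Dgr DM]|[Dgr DM]]; split.
- move=> i j ij; rewrite mxE; apply: (proj1 (coord_gr co _ _)); last exact: ij.
  exact/Dgr/gP.
- move=> i j k; have := DM _ _ _ _ (gP i) (gP j); rewrite /weighted_eqn.
  case: (w _ _ _) => [[al be] ga]; have [-> -> ->] := mx_of_smul D i j.
  rewrite -!linearZ -linearD => /(can_inj phiK) /rowP /(_ k).
  by rewrite !mxE.
- move=> i; apply: (coord_gr_ind co) => [|a x y Hx Hy|j ji].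
  + by rewrite linear0 mem0v.
  + by rewrite linearP rpredD ?rpredZ.
  + apply/(coord_gr co) => k; rewrite -ji mx_ofE phiK -rowE mxE; exact: Dgr.
- move=> i j x y xi yj; case E: (w d i j) => [[al be] ga].
  move: x xi; apply: (coord_gr_ind co) => [|a x x' Hx Hx'|a aP].
  + by rewrite !smul0r linear0 smul0r !scaler0 addr0.
  + rewrite !(smulDl, smulZl, linearD, linearZ) /=.
    by rewrite addrACA -scalerDr -Hx -Hx'.
  move: y yj; apply: (coord_gr_ind co) => [|b y y' Hy Hy'|b bP].
  + by rewrite !smulr0 linear0 !smulr0 !scaler0 addr0.
  + rewrite !(smulDr, smulZr, linearD, linearZ) /=.
    by rewrite addrACA -scalerDr -Hy -Hy'.
  have [-> -> ->] := mx_of_smul D a b.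
  rewrite -!linearZ -linearD; congr (phi _); apply/rowP => k.
  by have := DM a b k; rewrite /weighted_eqn aP bP E !mxE.
Qed.

(* In degree d, the equation at (i, j, k) is void unless k has the parity of
   the components of D (e_i e_j). *)
Lemma weighted_eqn_void d (M : 'M[F]_N) (i j k : 'I_N) u :
  (forall a b : 'I_N, par b != par a (+) d -> M a b = 0) ->
  par k != par i (+) par j (+) d -> weighted_eqn u M i j k.
Proof.
move=> M0 kd; case: u => [[al be] ga]; rewrite /weighted_eqn !big1 ?mulr0 ?addr0 //.
- move=> b _; case: (eqVneq (par b) (par j (+) d)) => [bj|/M0 ->]; last by rewrite mul0r.
  by rewrite (coord_graded co) ?mulr0 // bj addbA.
- move=> b _; case: (eqVneq (par b) (par i (+) d)) => [bj|/M0 ->]; last by rewrite mul0r.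
  by rewrite (coord_graded co) ?mulr0 // bj addbAC.
- move=> a _; case: (eqVneq (par k) (par a (+) d)) => [ka|/M0 ->]; last by rewrite mulr0.
  rewrite (coord_graded co) ?mul0r //; apply: contra kd => /eqP <-.
  by rewrite ka.
Qed.

(** One system serves both degrees: the row at (i, j, k) takes its weights in degree par i + par j +
    par k. For that degree it is the genuine condition on [D], and for the other degree it is
    void. *)
Lemma weighted_derivation_sat d D r :
  weighted_derivation w d D -> r \in weighted_rows N par sc w ->
  dot t (N * N) r (unknown (mx_of D)) = 0.
Proof.
move=> /weighted_derivation_mx [M0 H] /weighted_rowsP [i [j [k ->]]].
apply/dot_weighted_row.
have -> : \matrix_(a, b) unknown (mx_of D) (a * N + b)%N = mx_of D.
  by apply/matrixP => a b; rewrite mxE unknownE.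
case: (eqVneq (par k) (par i (+) par j (+) d)) => [->|kd].
  by rewrite addbA addbb; exact: H.
exact: weighted_eqn_void M0 kd.
Qed.

(** A solution need not be homogeneous. Its blocks of degree 0 and 1 are each solutions, because the
    row at (i, j, k) involves entries of a single degree only, and the span contains their sum. *)
Lemma sat_weighted_Der x :
  (forall r, r \in weighted_rows N par sc w -> dot t (N * N) r x = 0) ->
  end_of (\matrix_(a, b) x (a * N + b)%N) \in weighted_Der A w.
Proof.
move=> H; set M := \matrix_(a, b) _.
pose Md d : 'M[F]_N := \matrix_(a, b) (if par b == par a (+) d then M a b else 0).
have ME : M = Md false + Md true.
  apply/matrixP => a b; rewrite !mxE addbF addbT.
  by case: (par a); case: (par b); rewrite /= ?addr0 ?add0r.
suff Mdw d : end_of (Md d) \in weighted_Der A w.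
  have -> : end_of M = end_of (Md false) + end_of (Md true).
    by apply/lfunP => v; rewrite add_lfunE !end_ofE ME mulmxDr linearD.
  by rewrite rpredD.
have [wP _] := linear_spanP (fun D => exists d, @weighted_derivation F A w d D).
apply: wP; exists d; apply/weighted_derivation_mx; rewrite end_ofK.
have Md0 (a b : 'I_N) : par b != par a (+) d -> Md d a b = 0.
  by rewrite mxE => /negPf ->.
split=> [|i j k]; first exact: Md0.
case: (eqVneq (par k) (par i (+) par j (+) d)) => [kd|kd]; last exact: weighted_eqn_void Md0 kd.
have /H/dot_weighted_row : weighted_row N par sc w i j k \in weighted_rows N par sc w.
  by apply/weighted_rowsP; exists i, j, k.
rewrite {1}kd addbA addbb -/M /weighted_eqn.
case: (w _ _ _) => [[al be] ga] E.
have -> : \sum_(a < N) c i j a * Md d a k = \sum_(a < N) c i j a * M a k.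
  apply: eq_bigr => a _; rewrite [Md d a k]mxE; case: eqP => // /eqP ka.
  rewrite (coord_graded co) ?mul0r //; apply: contra ka => /eqP ->.
  by rewrite kd.
have -> : \sum_(b < N) Md d i b * c b j k = \sum_(b < N) M i b * c b j k.
  apply: eq_bigr => b _; rewrite [Md d i b]mxE; case: eqP => // /eqP ib.
  rewrite (coord_graded co) ?mulr0 ?mul0r // kd addbAC (inj_eq (can_inj (addbK _))).
  by rewrite eq_sym.
have -> // : \sum_(b < N) Md d j b * c i b k = \sum_(b < N) M j b * c i b k.
apply: eq_bigr => b _; rewrite [Md d j b]mxE; case: eqP => // /eqP ib.
rewrite (coord_graded co) ?mulr0 ?mul0r // kd -addbA (inj_eq (can_inj (addKb _))).
by rewrite eq_sym.
Qed.

(** The matrix entries at the free unknowns serve as linear coordinates on [weighted_Der A w]. *)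
Lemma coord_weighted_dim d :
  nullity (N * N) (weighted_rows N par sc w) = Some d -> \dim (weighted_Der A w) = d.
Proof.
move=> /(@nullityP F t) [S [Suniq SN S0 Sx]].
have x_of D : D \in weighted_Der A w -> forall r, r \in weighted_rows N par sc w ->
    dot t (N * N) r (unknown (mx_of D)) = 0.
  move=> DW r rW; move: D DW.
  apply: linear_span_ind => [D [e De]||a D E D0 E0].
  - exact: weighted_derivation_sat De rW.
  - have -> : mx_of 0 = 0 by apply/matrixP => i j; rewrite !mxE lfunE linear0 mxE.
    apply: big1 => i _; rewrite /unknown.
    case: insub => [k|]; last by rewrite mulr0.
    by case: insub => [l|]; rewrite ?mxE mulr0.
  - rewrite mx_of_linear -[RHS](addr0 0) -{1}(mulr0 a) -{1}D0 -E0 /dot mulr_sumr.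
    rewrite -big_split; apply: eq_bigr => i _; rewrite /= /unknown.
    case: insub => [k|]; last by rewrite !mulr0 addr0.
    case: insub => [l|]; last by rewrite !mulr0 addr0.
    by rewrite !mxE; ring.
apply: (@dim_by_coordinates _ _ _ _ (fun D => \row_i unknown (mx_of D) (tnth S i))).
- move=> a D E; apply/rowP => i; rewrite !mxE mx_of_linear /unknown.
  case: insub => [k|]; last by rewrite !mulr0 addr0.
  case: insub => [l|]; last by rewrite !mulr0 addr0.
  by rewrite !mxE.
- move=> D /x_of xD /rowP D0; apply: (can_inj mx_ofK).
  have -> : mx_of 0 = 0 by apply/matrixP => i j; rewrite !mxE lfunE linear0 mxE.
  apply/matrixP => i j; rewrite -unknownE mxE.
  have ij : (i * N + j < N * N)%N.
    apply: (@leq_trans (i * N + N)); first by rewrite ltn_add2l.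
    by rewrite -mulSnr leq_mul2r ltn_ord orbT.
  rewrite -[(_ + _)%N]/(val (Ordinal ij)); apply: (S0 _ xD) => s /tnthP [l ->].
  by have := D0 l; rewrite !mxE.
- move=> i; have [x [xr xi xj]] := Sx _ (mem_tnth i S).
  exists (end_of (\matrix_(a, b) x (a * N + b)%N)); first exact: sat_weighted_Der.
  have uE q : (q < N * N)%N -> unknown (\matrix_(a, b) x (a * N + b)%N) q = x q.
    move=> qN; have N0 : (0 < N)%N by case: (N) qN.
    have qd : (q %/ N < N)%N by rewrite ltn_divLR.
    have qm : (q %% N < N)%N by rewrite ltn_mod.
    by have := unknownE (\matrix_(a, b) x (a * N + b)%N) (Ordinal qd) (Ordinal qm);
      rewrite mxE /= -divn_eq.
  split=> [|j ji]; rewrite mxE end_ofK uE ?SN ?mem_tnth //.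
  apply: xj; rewrite ?mem_tnth //; apply: contra ji => /eqP.
  by rewrite !(tnth_nth 0) => /eqP; rewrite nth_uniq ?size_tuple.
Qed.
End Weighted.

(** * Indecomposability through the even centroid *)

(** Since P = P P, a nonzero entry factors through an intermediate index, so the height gap forced
    by a nonzero entry can be increased by one indefinitely, whereas heights are bounded. *)
Lemma idempotent_height (F : fieldType) N (P : 'M[F]_N) (h : 'I_N -> nat) :
  P *m P = P -> (forall a b, P a b != 0 -> (h a < h b)%N) -> P = 0.
Proof.
move=> PP Ph.
have step m : forall a b, P a b != 0 -> (h a + m < h b)%N.
  elim: m => [|m IH] a b; first by rewrite addn0; exact: Ph.
  rewrite -{1}PP mxE => nz.
  have [l] : exists l, P a l * P l b != 0.
    apply/existsP; apply: contraNT nz; rewrite negb_exists => /forallP z.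
    by rewrite big1 // => l _; apply/eqP; have := z l; rewrite negbK.
  rewrite mulf_eq0 negb_or => /andP [/Ph al /IH lb].
  by apply: leq_ltn_trans lb; rewrite addnS -addSn leq_add2r.
apply/matrixP => a b; rewrite mxE; apply/eqP; apply: contraT => /(step (h b)).
by rewrite ltnNge leq_addl.
Qed.

(** If the diagonal value p is 0, the previous lemma applies to P. Otherwise a diagonal entry of P P
    is p^2, because off-diagonal products would need h a < h l < h a; so p = 1, and the previous
    lemma applies to 1 - P. *)
Lemma idempotent_trivial (F : fieldType) N (P : 'M[F]_N) (p : F) (h : 'I_N -> nat) :
  P *m P = P -> (forall a, P a a = p) ->
  (forall a b, a != b -> P a b != 0 -> (h a < h b)%N) -> P = 0 \/ P = 1%:M.
Proof.
move=> PP Pp Ph; case: (eqVneq p 0) => [p0|p0].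
  left; apply: (idempotent_height PP (h := h)) => a b ab; apply: Ph => //.
  by apply: contraNneq ab => ->; rewrite Pp p0.
have pp (a : 'I_N) : p = 1.
  apply: (mulfI p0); rewrite mulr1 -[RHS](Pp a) -[in RHS]PP mxE.
  rewrite (bigD1 a) //= big1 ?addr0 ?Pp // => l la.
  apply/eqP; rewrite mulf_eq0; apply: contraT; rewrite negb_or => /andP [al lb].
  have := ltn_trans (Ph _ _ _ al) (Ph _ _ la lb).
  by rewrite eq_sym la ltnn => /(_ isT).
right; apply/eqP; rewrite eq_sym -subr_eq0; apply/eqP.
apply: (idempotent_height _ (h := h)).
  by rewrite !(mulmxBl, mulmxBr) !mul1mx !mulmx1 PP subrr subr0.
move=> a b; rewrite !mxE; case: (eqVneq a b) => [->|ab].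
  by rewrite Pp (pp b) subrr eqxx.
by rewrite sub0r oppr_eq0; exact: Ph.
Qed.

(** Together the two weights say D(xy) = D(x) y = x D(y), the equations of the centroid. The unit
    rows added in [centroid_rows] restrict to parity-preserving maps. *)
Definition left_weight : weight := fun _ _ _ => (Zpos xH, Zpos xH, Z0).
Definition right_weight : weight := fun _ _ _ => (Zpos xH, Z0, Zpos xH).

Definition unit_row n q : seq pol :=
  mkseq (fun i => if i == q then [:: Zpos xH] else [::]) n.
Definition diff_row n p q : seq pol :=
  mkseq (fun i => padd (if i == p then [:: Zpos xH] else [::])
                       (if i == q then [:: Zneg xH] else [::])) n.

Definition centroid_rows N (par : nat -> bool) (sc : nat -> nat -> nat -> pol) :=
  weighted_rows N par sc left_weight ++ weighted_rows N par sc right_weight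
  ++ [seq unit_row (N * N) (ab.1 * N + ab.2)%N
       | ab <- [seq (a, b) | a <- iota 0 N, b <- iota 0 N] & par ab.1 != par ab.2].

(** Candidate height functions. Two levels are enough for all the algebras to be tested, that is,
    the triangular parts have square zero. *)
Fixpoint bitseqs (n : nat) : seq (seq nat) :=
  if n is n'.+1 then map (cons 0%N) (bitseqs n') ++ map (cons 1%N) (bitseqs n')
  else [:: [::]].

(* Every even element of the centroid is the sum of a scalar and a map that is
   strictly triangular for the height h. *)
Definition local_centroid N par sc : bool :=
  let R := reduced (N * N) (centroid_rows N par sc) in
  [&& (0 < N)%N,
      all (fun a => implied (N * N) R (diff_row (N * N) (a * N + a)%N 0)) (iota 0 N)
    & has (fun h => all (fun a => all (fun b =>
        [|| a == b, (nth 0 h a < nth 0 h b)%N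
          | implied (N * N) R (unit_row (N * N) (a * N + b)%N)]) (iota 0 N)) (iota 0 N))
        (bitseqs N)].

Section Indecomposable.
Variables (F : numFieldType) (t : F) (N : nat) (par : nat -> bool).
Variables (sc : nat -> nat -> nat -> pol) (A : superalgebra F).

Let c i j k : F := pev t (sc i j k) / 2.

Lemma dot_unit_row n (q : 'I_n) x : dot t n (unit_row n q) x = x q.
Proof.
rewrite /dot (bigD1 q) //= big1 ?addr0 => [|i /negPf iq].
  by rewrite /entry_at nth_mkseq // eqxx /= mulr0 addr0 mul1r.
by rewrite /entry_at nth_mkseq // (inj_eq (@ord_inj n)) iq /= mul0r.
Qed.

Lemma dot_diff_row n (p q : 'I_n) x : dot t n (diff_row n p q) x = x p - x q.
Proof.
have zN : zval F (Zneg xH) = - zval F (Zpos xH) by [].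
have -> : dot t n (diff_row n p q) x
    = dot t n (unit_row n p) x - dot t n (unit_row n q) x.
  rewrite /dot -sumrB; apply: eq_bigr => i _.
  rewrite /entry_at !nth_mkseq // pevD; case: ifP => _; case: ifP => _ /=;
    rewrite ?zN; ring.
by rewrite !dot_unit_row.
Qed.

Lemma square_lt (a b : 'I_N) : (a * N + b < N * N)%N.
Proof.
apply: (@leq_trans (a * N + N)); first by rewrite ltn_add2l.
by rewrite -mulSnr leq_mul2r ltn_ord orbT.
Qed.

Lemma local_centroid_idempotent (M : 'M[F]_N) :
  local_centroid N par sc ->
  (forall r, r \in centroid_rows N par sc -> dot t (N * N) r (unknown M) = 0) ->
  M *m M = M -> M = 0 \/ M = 1%:M.
Proof.
case/and3P=> N0 /allP Hd /hasP [h _ /allP Hh] sat MM.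
have satR := reduced_sound sat.
pose o : 'I_N := Ordinal N0.
have NN0 : (0 < N * N)%N by rewrite muln_gt0 N0.
apply: (@idempotent_trivial _ _ _ (M o o) (fun a => nth 0 h a)) => // [a|a b ab].
  have := Hd a; rewrite mem_iota ltn_ord => /(_ isT) /implied_sound /(_ satR).
  rewrite -[(_ + _)%N]/(val (Ordinal (square_lt a a))) -[X in diff_row _ _ X]/(val (Ordinal NN0)).
  rewrite dot_diff_row /= unknownE -[X in unknown M X]/(o * N + o)%N unknownE.
  by move/eqP; rewrite subr_eq0 => /eqP.
apply: contraR => hab.
have := Hh a; rewrite mem_iota ltn_ord => /(_ isT) /allP /(_ (val b)).
rewrite mem_iota ltn_ord (negPf hab) (inj_eq (@ord_inj N)) (negPf ab) => /(_ isT) /=.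
move/implied_sound => /(_ F t (unknown M) satR).
rewrite -[(_ + _)%N]/(val (Ordinal (square_lt a b))) dot_unit_row /= unknownE.
by move=> ->.
Qed.

Lemma local_centroid_indecomposable :
  presented A N par c -> local_centroid N par sc -> indecomposable A.
Proof.
case=> phi [psi co] loc; case: (co) => phiK psiK gP mP.
split; first by rewrite /nonzero (coord_dim co); case/and3P: loc.
move=> B C B0 C0 AB.
have nz (V : vectType F) : (0 < \dim (fullv : {vspace V}))%N -> exists v : V, v != 0.
  rewrite lt0n dimv_eq0 => V0; by exists (vpick fullv); rewrite vpick0.
have [b b0] := nz _ B0; have [d d0] := nz _ C0.
case: AB => f [fb fgr fM]; have [g [fK gK ggr gM]] := isomorphism_inverse fb fgr fM.
(* The projection onto [B] along [C], transported to [A]. It is idempotent, even, and in the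
   centroid because the two summands annihilate each other. *)
pose p (x : A) : A := g ((f x).1, 0).
have [pi piE] : exists pi : {linear A -> A}, pi =1 p.
  apply: linear_exists => a x y; rewrite /p -linearP; congr (g _).
  by rewrite linearP -[RHS]/(a *: (f x).1 + (f y).1, a *: 0 + 0) scaler0 addr0.
have lE x : linfun pi x = g ((f x).1, 0) by rewrite lfunE /= piE.
pose M := mx_of phi psi (linfun pi).
have piM u : linfun pi (phi u) = phi (u *m M) by rewrite (mx_ofE co).
have pi_gr i x : x \in gr A i -> linfun pi x \in gr A i.
  move=> /fgr; rewrite lE dsum_grE => /andP [fx _]; apply: ggr.
  by rewrite dsum_grE fx mem0v.
have pi_smul x y : linfun pi (x ** y) = linfun pi x ** y /\
    linfun pi (x ** y) = x ** linfun pi y.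
  split; rewrite !lE fM.
    by rewrite -[y in RHS]fK -gM; congr (g (_, _)); rewrite /= smul0r.
  by rewrite -[x in RHS]fK -gM; congr (g (_, _)); rewrite /= smulr0.
have M0 (i j : 'I_N) : par j != par i -> M i j = 0.
  rewrite mxE => ij; apply: (proj1 (coord_gr co _ _)) ij.
  by apply: pi_gr.
have z1 : zval F (Zpos xH) = 1 by [].
have z0 : zval F Z0 = 0 by [].
have lwd : weighted_derivation left_weight false (linfun pi).
  split=> [i x xi|i j x y xi yj]; first by rewrite addbF pi_gr.
  by rewrite /left_weight z1 z0 !scale1r scale0r addr0; case: (pi_smul x y).
have rwd : weighted_derivation right_weight false (linfun pi).
  split=> [i x xi|i j x y xi yj]; first by rewrite addbF pi_gr.
  by rewrite /right_weight z1 z0 !scale1r scale0r add0r; case: (pi_smul x y).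
have MM : M *m M = M.
  apply/row_matrixP => i; rewrite !rowE; apply: (can_inj phiK).
  by rewrite mulmxA -!piM !lE gK.
have [] := local_centroid_idempotent loc _ MM.
- move=> r; rewrite !mem_cat => /or3P [| |/mapP [ab]].
  + exact: (weighted_derivation_sat co lwd).
  + exact: (weighted_derivation_sat co rwd).
  + rewrite mem_filter => /andP [ab0 /allpairsP [[a e] /= [aN eN abE]]] ->.
    move: aN eN ab0; rewrite abE !mem_iota /= => aN eN ab0.
    rewrite -[a]/(val (Ordinal aN)) -[e]/(val (Ordinal eN)).
    rewrite -[(_ + _)%N]/(val (Ordinal (square_lt (Ordinal aN) (Ordinal eN)))).
    by rewrite dot_unit_row /= (unknownE M (Ordinal aN) (Ordinal eN)) M0 // eq_sym.
- move=> Mz; have : linfun pi (g (b, 0)) = 0.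
    by rewrite -[g _]psiK piM Mz mulmx0 linear0.
  rewrite lE gK /= => /(congr1 f); rewrite gK linear0 => -[bz].
  by rewrite bz eqxx in b0.
- move=> Mone; have : linfun pi (g (0, d)) = g (0, d).
    by rewrite -[g _]psiK piM Mone mulmx1.
  rewrite lE gK /= => /(can_inj gK) [dz].
  by rewrite -dz eqxx in d0.
Qed.
End Indecomposable.

(** * Symbolic multiplication tables *)

Inductive coef := C1 | Ch | Ct.

(* Twice the coefficient, so that all coefficients are polynomials over Z. *)
Definition cpol (q : coef) : pol :=
  match q with
  | C1 => [:: Zpos (xO xH)]
  | Ch => [:: Zpos xH]
  | Ct => [:: Z0; Zpos (xO xH)]
  end.

Definition ctable := seq (gen * gen * seq (coef * gen)).

Fixpoint comb_const (z : seq (coef * gen)) (g : gen) : pol :=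
  if z is q :: z' then padd (if q.2 == g then cpol q.1 else [::]) (comb_const z' g)
  else [::].

Fixpoint lookup_const (T : ctable) (x y g : gen) : pol :=
  if T is (a, b, z) :: T' then
    if (a, b) == (x, y) then comb_const z g
    else if (a, b) == (y, x) then psgn (x.1 && y.1) (comb_const z g)
    else lookup_const T' x y g
  else [::].

Definition slabel (m i : nat) : gen :=
  if (i < m)%N then (false, i) else (true, (i - m)%N).

Definition table_const (m : nat) (T : ctable) (i j k : nat) : pol :=
  lookup_const T (slabel m i) (slabel m j) (slabel m k).

Definition table_par (m i : nat) : bool := (m <= i)%N.

Section Tables.
Variables (F : numFieldType) (t : F).

Definition cev (q : coef) : F :=
  match q with C1 => 1 | Ch => 2^-1 | Ct => t end.

Definition interp (T : ctable) : table F :=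
  map (fun p => (p.1, map (fun q => (cev q.1, q.2)) p.2)) T.

Lemma cevE q : cev q = pev t (cpol q) / 2.
Proof.
have z2 : zval F (Zpos (xO xH)) = 2 by [].
have z1 : zval F (Zpos xH) = 1 by [].
have z0 : zval F Z0 = 0 by [].
by case: q => /=; rewrite ?z2 ?z1 ?z0; field.
Qed.

Lemma labelE m n (i : 'I_(m + n)) : label i = slabel m i.
Proof.
rewrite /label /slabel; case: splitP => j -> //.
by rewrite addKn.
Qed.

Lemma comb_vecE m n z (k : 'I_(m + n)) :
  comb_vec m n (map (fun q => (cev q.1, q.2)) z) 0 k
  = pev t (comb_const z (label k)) / 2.
Proof.
rewrite /comb_vec big_map; elim: z => [|q z IH].
  by rewrite big_nil mxE /= mul0r.
rewrite big_cons mxE IH /= pevD mulrDl; congr (_ + _).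
by rewrite !mxE eq_sym /= cevE; case: eqP; rewrite ?mulr1 ?mulr0 ?mul0r.
Qed.

Lemma lookupE m n T x y (k : 'I_(m + n)) :
  lookup m n (interp T) x y 0 k = pev t (lookup_const T x y (label k)) / 2.
Proof.
elim: T => [|[[a b] z] T IH] /=; first by rewrite mxE mul0r.
case: ifP => _; first exact: comb_vecE.
case: ifP => _ //; rewrite mxE comb_vecE pev_sgn sgnE mulrA.
by case: (x.1); case: (y.1).
Qed.

Lemma table_presented m n T (wT : well_graded (interp T)) :
  presented (table_alg m n wT) (m + n) (table_par m)
    (fun i j k => pev t (table_const m T i j k) / 2).
Proof.
exists (idfun : {linear 'rV[F]_(m + n) -> 'rV[F]_(m + n)}), idfun.
split=> // [i|i j].
  apply/table_grP => j; rewrite mxE eqxx /=; case: (j =P i) => // ->.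
  by rewrite labelE /slabel /table_par; case: ltnP => //=; rewrite eqxx.
apply/rowP => k; rewrite mxE /table_const -!labelE -lookupE.
rewrite /= /smul /= /table_mul summxE (bigD1 i) //= [X in _ + X]big1 ?addr0 => [|a ai].
  rewrite summxE (bigD1 j) //= big1 ?addr0 => [|b bj].
    by rewrite !mxE !eqxx !mul1r.
  by rewrite !mxE (negPf bj) andbF mulr0 mul0r.
rewrite summxE big1 // => b _.
by rewrite !mxE (negPf ai) andbF mul0r mul0r.
Qed.

(** The spanning families bound the two dimensions by m and n; as the dimensions add up to m + n,
    both bounds are attained. *)
Lemma table_of_type m n T (wT : well_graded T) : of_type (@table_alg F m n T wT) m n.
Proof.
have card b : #|[pred i : 'I_(m + n) | (label i).1 == b]| = if b then n else m.
  rewrite -sum1_card big_split_ord /=.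
  have El (i : 'I_m) : (label (lshift n i)).1 = false.
    by rewrite labelE /slabel /= ltn_ord.
  have Er (i : 'I_n) : (label (rshift m i)).1 = true.
    by rewrite labelE /slabel /= ltnNge leq_addr.
  under eq_bigl => i do rewrite inE El.
  under [X in (_ + X)%N]eq_bigl => i do rewrite inE Er.
  by case: b; rewrite /= ?big_pred0_eq sum1_card card_ord ?addn0.
have le b : (\dim (@table_gr F m n b) <= if b then n else m)%N.
  by rewrite -card /table_gr; apply: leq_trans (dim_span _) _; rewrite size_image.
have := dimv_disjoint_sum (table_gr_disjoint F m n).
rewrite table_gr_total dimvf /dim /= mul1n.
have := le false; have := le true; rewrite /of_type /=; lia.
Qed.

End Tables.

(** The [nilp] guards skip vanishing factors before the inner sums are evaluated: the tables are
    sparse, and the check runs over all quadruples of basis vectors. *)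
Definition ptrip (N : nat) (sc : nat -> nat -> nat -> pol) i j k l m : pol :=
  psum N (fun a => let p := sc i j a in if nilp p then [::] else
    pmul p (psum N (fun b => let q := sc a k b in if nilp q then [::] else
      pmul q (sc b l m)))).
Definition pquad (N : nat) (sc : nat -> nat -> nat -> pol) i j k l m : pol :=
  psum N (fun a => let p := sc i j a in if nilp p then [::] else
    pmul p (psum N (fun b => let q := sc k l b in if nilp q then [::] else
      pmul q (sc a b m)))).

Definition pdefect (N : nat) (par : nat -> bool) sc i j k l m : pol :=
  let: (x, y, z, t) := (par i, par j, par k, par l) in
  padd (ptrip N sc i j k l m)
 (padd (psgn ((y && z) (+) (y && t) (+) (z && t)) (ptrip N sc i l k j m))
 (padd (psgn ((x && y) (+) (x && z) (+) (x && t) (+) (z && t)) (ptrip N sc j l k i m))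
 (padd (popp (pquad N sc i j k l m))
 (padd (popp (psgn (t && (y (+) z)) (pquad N sc i l j k m)))
       (popp (psgn (y && z) (pquad N sc i k j l m))))))).

Definition all_below (n : nat) (P : nat -> bool) : bool := all P (iota 0 n).

Lemma all_belowP n (P : nat -> bool) : reflect (forall i : 'I_n, P i) (all_below n P).
Proof.
apply: (iffP allP) => [H i|H i]; first by apply: H; rewrite mem_iota ltn_ord.
by rewrite mem_iota => iP; exact: (H (Ordinal iP)).
Qed.

Definition jordan_check (N : nat) (par : nat -> bool) sc : bool :=
  all_below N (fun i => all_below N (fun j => all_below N (fun k =>
    pzero (padd (sc i j k) (popp (psgn (par i && par j) (sc j i k))))
    && all_below N (fun l => all_below N (fun m => pzero (pdefect N par sc i j k l m)))))).

(** Every term of the identity is cubic in the constants, so doubling them multiplies the defect by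
    8. *)
Lemma jordan_checkP (F : numFieldType) (t : F) N par sc :
  jordan_check N par sc ->
  jordan_constants N par (fun i j k => pev t (sc i j k) / 2).
Proof.
move=> H.
have two : (2 : F) != 0 by rewrite pnatr_eq0.
split=> [i j k|i j k l m];
  have /all_belowP/(_ i)/all_belowP/(_ j)/all_belowP/(_ k) := H; case/andP.
  move=> /pev0 => /(_ F t); rewrite pevD pevN pev_sgn => /eqP.
  by rewrite subr_eq0 => /eqP -> _; case: (_ && _) => //=; rewrite mulNr.
move=> _ /all_belowP/(_ l)/all_belowP/(_ m)/pev0 => /(_ F t) E.
have guardE p q : pev t (if nilp p then [::] else pmul p q) = pev t p * pev t q.
  by case: p => [|a p]; rewrite ?mul0r // pevM.
have tripE i' j' k' l' : trip N (fun i j k => pev t (sc i j k) / 2) i' j' k' l' m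
    = pev t (ptrip N sc i' j' k' l' m) / 8.
  rewrite /trip /ptrip pev_sum mulr_suml; apply: eq_bigr => a _.
  rewrite guardE pev_sum mulr_sumr mulr_suml; apply: eq_bigr => b _.
  by rewrite guardE; field.
have quadE i' j' k' l' : quad N (fun i j k => pev t (sc i j k) / 2) i' j' k' l' m
    = pev t (pquad N sc i' j' k' l' m) / 8.
  rewrite /quad /pquad pev_sum mulr_suml; apply: eq_bigr => a _.
  rewrite guardE pev_sum mulr_sumr mulr_suml; apply: eq_bigr => b _.
  by rewrite guardE; field.
rewrite /jordan_defect !tripE !quadE.
transitivity (pev t (pdefect N par sc i j k l m) / 8); last by rewrite E mul0r.
rewrite /pdefect !pevD !pevN !pev_sgn.
have sgnV b (x y : F) : sgn b (x / y) = sgn b x / y by case: b; rewrite //= mulNr.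
by rewrite !sgnV -!mulrDl -!mulNr -!mulrDl !addrA.
Qed.

(** * Symbolic presentations, direct sums and decompositions *)

(* sconst holds the doubled structure constants. *)
Record symb := Symb { sdim : nat; spar : nat -> bool; sconst : nat -> nat -> nat -> pol }.

Definition presents (F : numFieldType) (t : F) (A : superalgebra F) (s : symb) : Prop :=
  presented A (sdim s) (spar s) (fun i j k => pev t (sconst s i j k) / 2).

(* Tabulates sc, so that computations do not scan the multiplication table anew. *)
Definition memo (N : nat) (sc : nat -> nat -> nat -> pol) : nat -> nat -> nat -> pol :=
  let L := mkseq (fun i => mkseq (fun j => mkseq (sc i j) N) N) N in
  fun i j k => nth [::] (nth [::] (nth [::] L i) j) k.

Lemma memoE N sc (i j k : 'I_N) : memo N sc i j k = sc i j k.
Proof. by rewrite /memo !nth_mkseq. Qed.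

Definition symb_table (m n : nat) (T : ctable) : symb :=
  Symb (m + n) (table_par m) (memo (m + n) (table_const m T)).

Lemma table_presents (F : numFieldType) (t : F) m n T (wT : well_graded (interp t T)) :
  presents t (table_alg m n wT) (symb_table m n T).
Proof.
by apply: presented_ext (table_presented m n wT) _ _ => // i j k; rewrite /= memoE.
Qed.

Definition symb_dsum (s s' : symb) : symb :=
  let N := sdim s in
  Symb (N + sdim s')
    (fun i => if (i < N)%N then spar s i else spar s' (i - N)%N)
    (fun i j k =>
       if [&& i < N, j < N & k < N]%N then sconst s i j k
       else if [&& N <= i, N <= j & N <= k]%N then sconst s' (i - N)%N (j - N)%N (k - N)%N
       else [::]).

Lemma presents_dsum (F : numFieldType) (t : F) (A B : superalgebra F) s s' :
  presents t A s -> presents t B s' -> presents t (dsum A B) (symb_dsum s s').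
Proof.
move=> pA pB; apply: presented_ext (presented_dsum pA pB) _ _ => // i j k /=.
by case: ifP => // _; case: ifP => // _; rewrite mul0r.
Qed.

Definition symb_sum (l : seq symb) : symb :=
  if l is s :: l' then foldl symb_dsum s l' else symb_table 0 0 [::].

(** [p] lists the images of the indices; the test on [index] certifies that it is injective and
    supplies the inverse needed by [presented_perm]. *)
Definition same_symb (s s' : symb) (p : seq nat) : bool :=
  let N := sdim s in
  [&& sdim s' == N,
      all_below N (fun i => (nth 0 p i < N)%N && (index (nth 0 p i) p == i)),
      all_below N (fun i => spar s i == spar s' (nth 0 p i))
    & all_below N (fun i => all_below N (fun j => all_below N (fun k =>
        pzero (padd (sconst s i j k)
          (popp (sconst s' (nth 0 p i) (nth 0 p j) (nth 0 p k)))))))].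

Lemma same_symb_isomorphic (F : numFieldType) (t : F) (A B : superalgebra F) s s' p :
  presents t A s -> presents t B s' -> same_symb s s' p -> isomorphic A B.
Proof.
case: s s' => N par sc [N' par' sc']; rewrite /presents /= => pA pB.
rewrite /same_symb /=; case/and4P=> /eqP NN; subst N'.
move=> /all_belowP pP /all_belowP parP /all_belowP scP.
apply: presented_isomorphic pA _.
apply: presented_ext (presented_perm (s := nth 0 p) (s' := index^~ p) pB _) _ _ => /=.
- by move=> i iN; have /andP [? /eqP] := pP (Ordinal iN).
- by move=> i; rewrite (eqP (parP i)).
- move=> i j k; have /all_belowP/(_ j)/all_belowP/(_ k)/pev0 := scP i => /(_ F t).
  by rewrite pevD pevN => /eqP; rewrite subr_eq0 => /eqP ->.
Qed.

Definition indec_symb (s : symb) : bool := local_centroid (sdim s) (spar s) (sconst s).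

Lemma indec_symbP (F : numFieldType) (t : F) (A : superalgebra F) s :
  presents t A s -> indec_symb s -> indecomposable A.
Proof. exact: local_centroid_indecomposable. Qed.

Fixpoint all_presents (F : numFieldType) (t : F) (As : seq (superalgebra F))
    (l : seq symb) : Prop :=
  match As, l with
  | [::], [::] => True
  | A :: As', s :: l' => presents t A s /\ all_presents t As' l'
  | _, _ => False
  end.

Lemma decomposes_Sum (F : numFieldType) (t : F) (A : superalgebra F) s As l p :
  presents t A s -> all_presents t As l -> (0 < size l)%N -> all indec_symb l ->
  same_symb s (symb_sum l) p -> decomposes_as A (Sum As).
Proof.
move=> pA pAs l0 lP sP; split.
  elim: As l pAs lP {l0 sP} => [|B As IH] [|s' l] //= [pB pAs] /andP [sB lP] [|i] //=.
    by move=> _; exact: indec_symbP pB sB.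
  by rewrite ltnS => iP; exact: (IH _ pAs lP).
suff pS : presents t (direct_sum As) (symb_sum l) by exact: same_symb_isomorphic pA pS sP.
case: As l pAs l0 {lP sP} => [|B As] [|s' l] //= [pB pAs] _.
elim: As l B s' pB pAs => [|B' As IH] [|s'' l] B s' pB //= [pB' pAs].
by apply: IH pAs; exact: presents_dsum.
Qed.

(** * The 71 tables and the computations on them *)

Local Notation o g := [:: (C1, g)].
Local Notation h g := [:: (Ch, g)].

Definition listing_table (k : nat) : ctable :=
  match k with
  | 1 => [:: (e1, e1, o e1); (e2, e2, o e2)]
  | 2 => [:: (e1, e1, o e1); (e2, e2, o e2); (e2, f2, o f2)]
  | 3 => [:: (e1, e1, o e1); (e2, e2, o e2); (e2, f2, h f2)]
  | 4 => [:: (e1, e1, o e1); (e2, e2, o e2); (e2, f1, o f1); (e2, f2, o f2)]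
  | 5 => [:: (e1, e1, o e1); (e2, e2, o e2); (e2, f1, o f1); (e2, f2, h f2)]
  | 6 => [:: (e1, e1, o e1); (e2, e2, o e2); (e2, f1, o f1); (e2, f2, o f2);
             (f1, f2, o e2)]
  | 7 => [:: (e1, e1, o e1); (e2, e2, o e2); (e2, f1, h f1); (e2, f2, h f2)]
  | 8 => [:: (e1, e1, o e1); (e2, e2, o e2); (e2, f1, h f1); (e2, f2, h f2);
             (f1, f2, o e2)]
  | 9 => [:: (e1, e1, o e1); (e2, e2, o e2); (e1, f2, h f2); (e2, f2, h f2)]
  | 10 => [:: (e1, e1, o e1); (e2, e2, o e2); (e1, f2, h f2); (e2, f1, o f1)]
  | 11 => [:: (e1, e1, o e1); (e2, e2, o e2); (e1, f2, h f2); (e2, f1, o f1);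
              (e2, f2, h f2)]
  | 12 => [:: (e1, e1, o e1); (e2, e2, o e2); (e1, f2, h f2); (e2, f1, h f1)]
  | 13 => [:: (e1, e1, o e1); (e2, e2, o e2); (e1, f2, h f2); (e2, f1, h f1);
              (e2, f2, h f2)]
  | 14 => [:: (e1, e1, o e1); (e2, e2, o e2); (e1, f2, o f2); (e2, f1, o f1)]
  | 15 => [:: (e1, e1, o e1); (e2, e2, o e2); (e1, f1, h f1); (e1, f2, h f2);
              (e2, f1, h f1); (e2, f2, h f2)]
  | 16 => [:: (e1, e1, o e1); (e2, e2, o e2); (e1, f1, h f1); (e1, f2, h f2);
              (e2, f1, h f1); (e2, f2, h f2); (f1, f2, [:: (C1, e1); (Ct, e2)])]
  | 17 => [:: (f1, f2, o e1)]
  | 18 => [:: (e2, f1, o f2)]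
  | 19 => [:: (e2, f1, o f2); (f1, f2, o e1)]
  | 20 => [:: (e2, f1, o f2); (f1, f2, o e2)]
  | 21 => [:: (e1, e1, o e1)]
  | 22 => [:: (e1, e1, o e1); (f1, f2, o e2)]
  | 23 => [:: (e1, e1, o e1); (e2, f1, o f2)]
  | 24 => [:: (e1, e1, o e1); (e2, f1, o f2); (f1, f2, o e2)]
  | 25 => [:: (e1, e1, o e1); (e1, f2, h f2)]
  | 26 => [:: (e1, e1, o e1); (e1, f2, o f2)]
  | 27 => [:: (e1, e1, o e1); (e1, f1, h f1); (e1, f2, h f2)]
  | 28 => [:: (e1, e1, o e1); (e1, f1, h f1); (e1, f2, h f2); (f1, f2, o e2)]
  | 29 => [:: (e1, e1, o e1); (e1, f1, h f1); (e1, f2, h f2); (f1, f2, o e1)]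
  | 30 => [:: (e1, e1, o e1); (e1, f1, h f1); (e1, f2, h f2);
              (f1, f2, [:: (C1, e1); (C1, e2)])]
  | 31 => [:: (e1, e1, o e1); (e1, f1, h f1); (e1, f2, h f2); (e2, f1, o f2)]
  | 32 => [:: (e1, e1, o e1); (e1, f1, h f1); (e1, f2, h f2); (e2, f1, o f2);
              (f1, f2, o e2)]
  | 33 => [:: (e1, e1, o e1); (e1, f1, h f1); (e1, f2, o f2)]
  | 34 => [:: (e1, e1, o e1); (e1, f1, o f1); (e1, f2, o f2)]
  | 35 => [:: (e1, e1, o e1); (e1, f1, o f1); (e1, f2, o f2); (f1, f2, o e1)]
  | 36 => [:: (e1, e1, o e1); (e1, e2, o e2)]
  | 37 => [:: (e1, e1, o e1); (e1, e2, o e2); (e1, f2, h f2)]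
  | 38 => [:: (e1, e1, o e1); (e1, e2, o e2); (e1, f2, o f2)]
  | 39 => [:: (e1, e1, o e1); (e1, e2, o e2); (e1, f1, h f1); (e1, f2, h f2)]
  | 40 => [:: (e1, e1, o e1); (e1, e2, o e2); (e1, f1, h f1); (e1, f2, h f2);
              (f1, f2, o e2)]
  | 41 => [:: (e1, e1, o e1); (e1, e2, o e2); (e1, f1, h f1); (e1, f2, h f2);
              (e2, f1, o f2)]
  | 42 => [:: (e1, e1, o e1); (e1, e2, o e2); (e1, f1, h f1); (e1, f2, h f2);
              (e2, f1, o f2); (f1, f2, o e2)]
  | 43 => [:: (e1, e1, o e1); (e1, e2, o e2); (e1, f1, h f1); (e1, f2, o f2)]
  | 44 => [:: (e1, e1, o e1); (e1, e2, o e2); (e1, f1, o f1); (e1, f2, o f2)]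
  | 45 => [:: (e1, e1, o e1); (e1, e2, o e2); (e1, f1, o f1); (e1, f2, o f2);
              (f1, f2, o e2)]
  | 46 => [:: (e1, e1, o e1); (e1, e2, o e2); (e1, f1, o f1); (e1, f2, o f2);
              (f1, f2, o e1)]
  | 47 => [:: (e1, e1, o e1); (e1, e2, o e2); (e1, f1, o f1); (e1, f2, o f2);
              (f1, f2, [:: (C1, e1); (C1, e2)])]
  | 48 => [:: (e1, e1, o e1); (e1, e2, o e2); (e1, f1, o f1); (e1, f2, o f2);
              (e2, f1, o f2)]
  | 49 => [:: (e1, e1, o e1); (e1, e2, o e2); (e1, f1, o f1); (e1, f2, o f2);
              (e2, f1, o f2); (f1, f2, o e2)]
  | 50 => [:: (e1, e1, o e1); (e1, e2, h e2)]
  | 51 => [:: (e1, e1, o e1); (e1, e2, h e2); (e1, f2, h f2)]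
  | 52 => [:: (e1, e1, o e1); (e1, e2, h e2); (e1, f2, h f2); (f1, f2, o e2)]
  | 53 => [:: (e1, e1, o e1); (e1, e2, h e2); (e1, f2, h f2); (e2, f2, o f1)]
  | 54 => [:: (e1, e1, o e1); (e1, e2, h e2); (e1, f2, h f2); (e2, f2, o f1);
              (f1, f2, o e2)]
  | 55 => [:: (e1, e1, o e1); (e1, e2, h e2); (e1, f2, h f2); (e2, f1, o f2)]
  | 56 => [:: (e1, e1, o e1); (e1, e2, h e2); (e1, f2, h f2); (e2, f1, o f2);
              (f1, f2, o e2)]
  | 57 => [:: (e1, e1, o e1); (e1, e2, h e2); (e1, f2, o f2)]
  | 58 => [:: (e1, e1, o e1); (e1, e2, h e2); (e1, f1, h f1); (e1, f2, h f2)]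
  | 59 => [:: (e1, e1, o e1); (e1, e2, h e2); (e1, f1, h f1); (e1, f2, o f2)]
  | 60 => [:: (e1, e1, o e1); (e1, e2, h e2); (e1, f1, h f1); (e1, f2, o f2);
              (f1, f2, o e2)]
  | 61 => [:: (e1, e1, o e1); (e1, e2, h e2); (e1, f1, h f1); (e1, f2, o f2);
              (e2, f2, o f1)]
  | 62 => [:: (e1, e1, o e1); (e1, e2, h e2); (e1, f1, h f1); (e1, f2, o f2);
              (e2, f2, o f1); (f1, f2, o e2)]
  | 63 => [:: (e1, e1, o e1); (e1, e2, h e2); (e1, f1, h f1); (e1, f2, o f2);
              (e2, f1, o f2)]
  | 64 => [:: (e1, e1, o e1); (e1, e2, h e2); (e1, f1, h f1); (e1, f2, o f2);
              (e2, f1, o f2); (f1, f2, o e2)]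
  | 65 => [:: (e1, e1, o e1); (e1, e2, h e2); (e1, f1, o f1); (e1, f2, o f2)]
  | 66 => [:: (e1, e1, o e2)]
  | 67 => [:: (e1, e1, o e2); (f1, f2, o e2)]
  | 68 => [:: (e1, e1, o e2); (f1, f2, o e1)]
  | 69 => [:: (e1, e1, o e2); (e2, f1, o f2)]
  | 70 => [:: (e1, e1, o e2); (e1, f1, o f2)]
  | 71 => [:: (e1, e1, o e2); (e1, f1, o f2); (f1, f2, o e2)]
  | _ => [::]
  end%N.

Definition listing_symb (k : nat) : symb := symb_table 2 2 (listing_table k).

Definition triple (al be ga : int) : Z * Z * Z :=
  (Z_of_int al, Z_of_int be, Z_of_int ga).

Definition parity_weight (p00 p01 p10 p11 : Z * Z * Z) : weight := fun _ i j =>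
  if i then (if j then p11 else p10) else (if j then p01 else p00).

(* Found by a computer search: jointly, the dimensions for these weights separate the
   71 entries, and for entry 16 they do not depend on t. *)
Definition separating_weights : seq weight :=
  [:: der_weight;
      fun _ _ _ => triple 2 1 1;
      parity_weight (triple 0 1 (-1)) (triple 1 1 1) (triple 1 1 2) (triple 1 0 2);
      parity_weight (triple (-2) (-2) 1) (triple (-2) 0 (-2)) (triple (-2) (-2) 2)
        (triple (-1) 2 2);
      parity_weight (triple 2 1 1) (triple 0 (-1) (-1)) (triple 0 (-2) 0)
        (triple 2 1 1)].

Definition invariants (s : symb) : seq (option nat) :=
  let N := sdim s in
  map (fun w => nullity (N * N) (weighted_rows N (spar s) (sconst s) w))
    separating_weights.

Definition summands (F : fieldType) : seq (superalgebra F) :=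
  [:: U1 F; U2 F; S1_1 F; B1 F; B2 F; B3 F; S1_2 F; S2_2 F; S1_3 F; S2_3 F; S3_3 F; S4_3
      F; S5_3 F; S6_3 F; S7_3 F; S8_3 F; S9_3 F; S10_3 F; S11_3 F; S12_3 F; S13_3 F].

Definition summand_symbs : seq symb :=
  [:: symb_table 1 0 [:: (e1, e1, o e1)];
      symb_table 1 0 [::];
      symb_table 0 1 [::];
      symb_table 2 0 [:: (e1, e1, o e1); (e1, e2, o e2)];
      symb_table 2 0 [:: (e1, e1, o e1); (e1, e2, h e2)];
      symb_table 2 0 [:: (e1, e1, o e2)];
      symb_table 1 1 [:: (e1, e1, o e1); (e1, f1, h f1)];
      symb_table 1 1 [:: (e1, e1, o e1); (e1, f1, o f1)];
      symb_table 1 2 [:: (e1, f1, o f2); (f1, f2, o e1)];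
      symb_table 1 2 [:: (f1, f2, o e1)];
      symb_table 1 2 [:: (e1, f1, o f2)];
      symb_table 1 2 [:: (e1, e1, o e1); (e1, f1, o f1); (e1, f2, h f2)];
      symb_table 1 2 [:: (e1, e1, o e1); (e1, f1, h f1); (e1, f2, h f2)];
      symb_table 1 2 [:: (e1, e1, o e1); (e1, f1, o f1); (e1, f2, o f2)];
      symb_table 1 2 [:: (e1, e1, o e1); (e1, f1, h f1); (e1, f2, h f2); (f1, f2, o e1)];
      symb_table 1 2 [:: (e1, e1, o e1); (e1, f1, o f1); (e1, f2, o f2); (f1, f2, o e1)];
      symb_table 2 1 [:: (e1, e1, o e1); (e1, e2, o e2); (e1, f1, h f1)];
      symb_table 2 1 [:: (e1, e1, o e1); (e1, e2, o e2); (e1, f1, o f1)];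
      symb_table 2 1 [:: (e1, e1, o e1); (e1, e2, h e2); (e1, f1, h f1)];
      symb_table 2 1 [:: (e1, e1, o e1); (e1, e2, h e2); (e1, f1, o f1)];
      symb_table 2 1 [:: (e1, e1, o e1); (e2, e2, o e2); (e1, f1, h f1); (e2, f1, h f1)]].

(* Indices, in the list of summands, of the terms of the decomposition of entry k;
   empty when entry k is indecomposable. *)
Definition sum_index (k : nat) : seq nat :=
  match k with
  | 1 => [:: 0; 0; 2; 2] | 2 => [:: 0; 7; 2] | 3 => [:: 0; 6; 2] | 4 => [:: 0; 13]
  | 5 => [:: 0; 11] | 6 => [:: 0; 15] | 7 => [:: 0; 12] | 8 => [:: 0; 14]
  | 9 => [:: 20; 2] | 10 => [:: 6; 7] | 12 => [:: 6; 6] | 14 => [:: 7; 7]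
  | 17 => [:: 1; 9] | 18 => [:: 1; 10] | 20 => [:: 1; 8] | 21 => [:: 0; 1; 2; 2]
  | 22 => [:: 0; 9] | 23 => [:: 0; 10] | 24 => [:: 0; 8] | 25 => [:: 1; 6; 2]
  | 26 => [:: 1; 7; 2] | 27 => [:: 1; 12] | 29 => [:: 1; 14] | 33 => [:: 1; 11]
  | 34 => [:: 1; 13] | 35 => [:: 1; 15] | 36 => [:: 3; 2; 2] | 37 => [:: 16; 2]
  | 38 => [:: 17; 2] | 50 => [:: 4; 2; 2] | 51 => [:: 18; 2] | 57 => [:: 19; 2]
  | 66 => [:: 5; 2; 2]
  | _ => [::]
  end%N.

(** The leading 0 fills position 0, so that entry k sits at position k. This copy makes no mention
    of the field and can be used under [vm_compute]. *)
Definition listed_dims : seq nat :=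
  [:: 0; 12; 13; 13; 12; 13; 13; 10; 11; 13; 12; 13; 12; 12; 12; 10; 12; 6; 7; 9; 10; 7;
  10; 11; 12; 10; 10; 9; 10; 10; 11; 11; 12; 12; 11; 12; 11; 12; 11; 9; 10; 11; 12; 10;
  7; 8; 10; 11; 10; 11; 10; 9; 11; 11; 12; 11; 12; 12; 4; 9; 10; 10; 11; 11; 12; 10; 6;
  7; 10; 11; 8; 10]%N.

Lemma uniq_map_inj (T U : eqType) (f : T -> U) s :
  uniq (map f s) -> forall x y, x \in s -> y \in s -> f x = f y -> x = y.
Proof.
elim: s => //= x s IH /andP [xs us] y z; rewrite !inE.
case/predU1P=> [->|ys] /predU1P [->|zs] //= E; last exact: (IH us).
  by case/negP: xs; rewrite E map_f.
by case/negP: xs; rewrite -E map_f.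
Qed.

Section Listing.
Variables (F : numFieldType).

Lemma listing_table_alg (t : F) k : (1 <= k <= 71)%N ->
  exists wT : well_graded (interp t (listing_table k)),
    listed_alg (listing t k) = table_alg 2 2 wT.
Proof.
do 72 (case: k => [|k]; [by [] || (by move=> _; exists isT) |]); by [].
Qed.

Lemma listed_dimE (t : F) k : (1 <= k <= 71)%N ->
  listed_dim (listing t k) = nth 0 listed_dims k.
Proof. do 72 (case: k => [|k]; [by [] |]); by []. Qed.

Lemma listed_decompositionE (t : F) k : (1 <= k <= 71)%N ->
  listed_decomposition (listing t k)
  = if sum_index k is [::] then Indec
    else Sum (map (nth (direct_sum [::]) (summands F)) (sum_index k)).
Proof. do 72 (case: k => [|k]; [by [] |]); by []. Qed.

Lemma listing_presents (t : F) k : (1 <= k <= 71)%N ->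
  presents t (listed_alg (listing t k)) (listing_symb k).
Proof. by case/(listing_table_alg t) => wT ->; exact: table_presents. Qed.

Lemma listing_of_type (t : F) k : (1 <= k <= 71)%N ->
  of_type (listed_alg (listing t k)) 2 2.
Proof. by case/(listing_table_alg t) => wT ->; exact: table_of_type. Qed.

Lemma summands_present (t : F) : all_presents t (summands F) summand_symbs.
Proof.
do 21 (split; first by
  lazymatch goal with |- presents _ _ (symb_table ?m ?n ?T) =>
    exact: (@table_presents _ t m n T isT) end).
by [].
Qed.

Lemma all_presents_nth (t : F) As l js :
  all_presents t As l -> all (fun i => i < size l)%N js ->
  all_presents t (map (nth (direct_sum [::]) As) js)
                 (map (nth (symb_table 0 0 [::]) l) js).
Proof.
move=> pAs; elim: js => //= i js IH /andP [il /IH pjs]; split=> //.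
elim: As l pAs i il {js IH pjs} => [|A As IH] [|s l] //= [pA pAs] [|i] //=.
by rewrite ltnS; exact: IH.
Qed.

Lemma listing_jordan (t : F) k : (1 <= k <= 71)%N -> jordan (listed_alg (listing t k)).
Proof.
move=> kP; case: (listing_presents t kP) => phi [psi co].
apply/(coord_jordan co)/jordan_checkP.
have /allP H : all (fun k => let s := listing_symb k in
    jordan_check (sdim s) (spar s) (sconst s)) (iota 1 71) by vm_compute.
by apply: H; rewrite mem_iota.
Qed.

(** Some structure constant is required to be a nonzero integer polynomial of degree 0, so that it
    cannot vanish at a special value of [t]. *)
Lemma listing_nonzero (t : F) k : (1 <= k <= 71)%N ->
  has_nonzero_product (listed_alg (listing t k)).
Proof.
move=> kP; case: (listing_presents t kP) => phi [psi [phiK _ _ mP]].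
have /allP/(_ k) : all (fun k => let s := listing_symb k in
    has (fun i => has (fun j => has (fun k => punit (sconst s i j k))
      (iota 0 4)) (iota 0 4)) (iota 0 4)) (iota 1 71) by vm_compute.
rewrite mem_iota => /(_ kP) /hasP [i iN /hasP [j jN /hasP [l lN u]]].
move: iN jN lN; rewrite !mem_iota /= => iN jN lN.
exists (phi (delta_mx 0 (Ordinal iN))), (phi (delta_mx 0 (Ordinal jN))).
apply: contraTneq u => /eqP.
rewrite mP -(linear0 phi) (inj_eq (can_inj phiK)) => /eqP /rowP /(_ (Ordinal lN)).
rewrite !mxE => /eqP; rewrite mulf_eq0 invr_eq0 pnatr_eq0 orbF => z.
by apply/negP => /(@pev_unit F t); rewrite z.
Qed.

Lemma presents_nullity (t : F) A s w d : presents t A s ->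
  nullity (sdim s * sdim s) (weighted_rows (sdim s) (spar s) (sconst s) w) = Some d ->
  \dim (weighted_Der A w) = d.
Proof. by case=> phi [psi co]; exact: (coord_weighted_dim co). Qed.

Lemma listing_orbit_dim (t : F) k : (1 <= k <= 71)%N ->
  (orbit_dim (listed_alg (listing t k)) + nparams k)%N = listed_dim (listing t k).
Proof.
move=> kP; have pA := listing_presents t kP.
have /allP/(_ k) : all (fun k => let s := listing_symb k in
    if nullity (sdim s * sdim s) (weighted_rows (sdim s) (spar s) (sconst s) der_weight)
      is Some d then (16 - d + nparams k == nth 0 listed_dims k)%N else false)
    (iota 1 71) by vm_compute.
rewrite mem_iota listed_dimE // => /(_ kP); cbv beta zeta.
case E: (nullity _ _) => [d|] // /eqP <-.
rewrite /orbit_dim Der_weighted (presents_nullity pA E).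
by case: pA => phi [psi co]; rewrite (coord_dim co).
Qed.

(** The parameters may differ: a successful nullity equals the dimension of the same space on [A],
    whatever the value of the indeterminate. *)
Lemma presents_invariants (t u : F) A s s' :
  presents t A s -> presents u A s' ->
  all isSome (invariants s) -> all isSome (invariants s') ->
  invariants s = invariants s'.
Proof.
move=> pA pA'; rewrite /invariants.
elim: separating_weights => //= w ws IH /andP [].
case E: (nullity _ _) => [d|] // _ ds /andP [].
case E': (nullity _ _) => [d'|] // _ ds'; rewrite (IH ds ds').
by rewrite -(presents_nullity pA E) -(presents_nullity pA' E').
Qed.

Lemma listing_inj (s t : F) k l : (1 <= k <= 71)%N -> (1 <= l <= 71)%N ->
  isomorphic (listed_alg (listing s k)) (listed_alg (listing t l)) -> k = l.
Proof.
move=> kP lP iso.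
have pk := listing_presents s kP.
have pl : presents t (listed_alg (listing s k)) (listing_symb l).
  exact: isomorphic_presented iso (listing_presents t lP).
have kM : k \in iota 1 71 by rewrite mem_iota.
have lM : l \in iota 1 71 by rewrite mem_iota.
have /andP [] : let L := map (fun k => invariants (listing_symb k)) (iota 1 71) in
    all (all isSome) L && uniq L by vm_compute.
rewrite all_map => /allP som uinv.
have E := presents_invariants pk pl (som k kM) (som l lM).
exact (uniq_map_inj uinv kM lM E).
Qed.

(** The matching between the basis of the entry and the concatenated bases of its summands is found
    by trying all 24 permutations. *)
Lemma listing_decomposition (t : F) k : (1 <= k <= 71)%N ->
  decomposes_as (listed_alg (listing t k)) (listed_decomposition (listing t k)).
Proof.
move=> kP; have pA := listing_presents t kP.
have /allP/(_ k) : all (fun k => let s := listing_symb k in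
    let js := sum_index k in
    let l := map (nth (symb_table 0 0 [::]) summand_symbs) js in
    if js is [::] then indec_symb s
    else [&& all (fun i => i < size summand_symbs)%N (sum_index k), all indec_symb l
           & has (same_symb s (symb_sum l)) (permutations (iota 0 4))])
    (iota 1 71) by vm_compute.
rewrite mem_iota listed_decompositionE // => /(_ kP).
case: (sum_index k) => [|i js]; first exact: indec_symbP pA.
cbv beta zeta; case/and3P=> iP lP /hasP [p _ sP].
exact: decomposes_Sum pA (all_presents_nth (summands_present t) iP) _ lP sP.
Qed.

End Listing.

(** * General algebras of type (2,2) and changes of basis *)

Section Tab.
Variable F : numClosedFieldType.
Implicit Types a b c p q k x y u v : F * F.

Definition at_even x (l : nat) : F :=
  match l with 0%N => x.1 | 1%N => x.2 | _ => 0 end.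
Definition at_odd x (l : nat) : F :=
  match l with 2%N => x.1 | 3%N => x.2 | _ => 0 end.

(* a, b, c are the coordinates of e1e1, e1e2, e2e2; p1, p2 those of e1f1, e1f2;
   q1, q2 those of e2f1, e2f2; and k those of f1f2. *)
Definition tab a b c p1 p2 q1 q2 k (i j l : nat) : F :=
  match i, j with
  | 0%N, 0%N => at_even a l
  | 0%N, 1%N | 1%N, 0%N => at_even b l
  | 1%N, 1%N => at_even c l
  | 0%N, 2%N | 2%N, 0%N => at_odd p1 l
  | 0%N, 3%N | 3%N, 0%N => at_odd p2 l
  | 1%N, 2%N | 2%N, 1%N => at_odd q1 l
  | 1%N, 3%N | 3%N, 1%N => at_odd q2 l
  | 2%N, 3%N => at_even k l
  | 3%N, 2%N => - at_even k l
  | _, _ => 0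
  end.

Definition par4 (i : nat) : bool := if i is (0 | 1)%N then false else true.
Definition sum4 (f : nat -> F) : F := f 0 + f 1%N + f 2%N + f 3%N.

Lemma sum4E (f : nat -> F) : \sum_(i < 4) f i = sum4 f.
Proof. by rewrite !big_ord_recr big_ord0 /= add0r. Qed.

(** A form of [jordan_defect] with expanded four-term sums: at numeral indices it reduces to a
    polynomial expression that [field] can treat. *)
Definition jd (c : nat -> nat -> nat -> F) (i j k l m : nat) : F :=
  let T (i j k l : nat) := sum4 (fun r : nat => sum4 (fun s : nat => c i j r * c r k s * c s l m)) in
  let Q (i j k l : nat) := sum4 (fun r : nat => sum4 (fun s : nat => c i j r * c k l s * c r s m)) in
  let: (bi, bj, bk, bl) := (par4 i, par4 j, par4 k, par4 l) in
  T i j k l + sgn ((bj && bk) (+) (bj && bl) (+) (bk && bl)) (T i l k j)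
  + sgn ((bi && bj) (+) (bi && bk) (+) (bi && bl) (+) (bk && bl)) (T j l k i)
  - Q i j k l - sgn (bl && (bj (+) bk)) (Q i l j k) - sgn (bj && bk) (Q i k j l).

Variables (A : superalgebra F).
Hypothesis jA : jordan A.

Definition pres a b c p1 p2 q1 q2 k : Prop :=
  presented A 4 (table_par 2) (tab a b c p1 p2 q1 q2 k).

Lemma pres_cast a b c p1 p2 q1 q2 k a' b' c' p1' p2' q1' q2' k' :
  pres a b c p1 p2 q1 q2 k -> a = a' -> b = b' -> c = c' -> p1 = p1' -> p2 = p2' ->
  q1 = q1' -> q2 = q2' -> k = k' -> pres a' b' c' p1' p2' q1' q2' k'.
Proof. by move=> H <- <- <- <- <- <- <- <-. Qed.

Lemma table_par4 (i : 'I_4) : table_par 2 i = par4 i.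
Proof. by case: i => [[|[|[|[|]]]]]. Qed.

Lemma pres_jd a b c p1 p2 q1 q2 k : pres a b c p1 p2 q1 q2 k ->
  forall i j l m n, (i < 4)%N -> (j < 4)%N -> (l < 4)%N -> (m < 4)%N -> (n < 4)%N ->
  jd (tab a b c p1 p2 q1 q2 k) i j l m n = 0.
Proof.
case=> phi [psi co] i j l m n i4 j4 l4 m4 n4.
have [_ H] := (proj1 (coord_jordan co) jA).
have := H (Ordinal i4) (Ordinal j4) (Ordinal l4) (Ordinal m4) (Ordinal n4).
rewrite /jordan_defect !table_par4 /=.
set cc := tab _ _ _ _ _ _ _ _.
have TE (i' j' k' l' m' : nat) : trip 4 cc i' j' k' l' m'
    = sum4 (fun r : nat => sum4 (fun s : nat => cc i' j' r * cc r k' s * cc s l' m')).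
  by rewrite -sum4E; apply: eq_bigr => x _; rewrite -sum4E.
have QE (i' j' k' l' m' : nat) : quad 4 cc i' j' k' l' m'
    = sum4 (fun r : nat => sum4 (fun s : nat => cc i' j' r * cc k' l' s * cc r s m')).
  by rewrite -sum4E; apply: eq_bigr => x _; rewrite -sum4E.
by rewrite !TE !QE.
Qed.

Lemma scaled_zero (s e x : F) : e = 0 -> x = s * e -> x = 0.
Proof. by move=> -> ->; rewrite mulr0. Qed.

Lemma of_type_pres : of_type A 2 2 ->
  exists a b c p1 p2 q1 q2 k, pres a b c p1 p2 q1 q2 k.
Proof.
move=> /of_type_presented [s [phi [psi co]]].
have [sc _] := (proj1 (coord_jordan co) jA).
have gr := coord_graded co.
exists (s 0 0 0, s 0 0 1)%N, (s 0 1 0, s 0 1 1)%N, (s 1 1 0, s 1 1 1)%N.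
exists (s 0 2 2, s 0 2 3)%N, (s 0 3 2, s 0 3 3)%N.
exists (s 1 2 2, s 1 2 3)%N, (s 1 3 2, s 1 3 3)%N, (s 2 3 0, s 2 3 1)%N.
(* Supercommutativity makes the square of an odd vector its own opposite, hence zero in
   characteristic 0. *)
have odd0 (i l : 'I_4) : table_par 2 i -> s i i l = 0.
  rewrite /table_par => io; have := sc i i l; rewrite io /= => /eqP.
  by rewrite -addr_eq0 -mulr2n mulrn_eq0 => /eqP.
apply: (@presented_ext _ _ _ (table_par 2) _ s); first by exists phi, psi.
- by case=> [[|[|[|[|]]]]].
- move=> i j l; have := gr i j l; have := sc i j l; have := odd0 i l.
  case: i => [[|[|[|[|//]]]] ?]; case: j => [[|[|[|[|//]]]] ?];
    case: l => [[|[|[|[|//]]]] ?] /= H1 H2 H3;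
    first [ exact: H3 | exact: H1 | exact: H2 | by [] | idtac ].
all: by rewrite oppr0; exact: H3.
Qed.

Definition m00 a b c x y : F * F :=
  (x.1 * y.1 * a.1 + (x.1 * y.2 + x.2 * y.1) * b.1 + x.2 * y.2 * c.1,
   x.1 * y.1 * a.2 + (x.1 * y.2 + x.2 * y.1) * b.2 + x.2 * y.2 * c.2).
Definition m01 p1 p2 q1 q2 x u : F * F :=
  (x.1 * u.1 * p1.1 + x.1 * u.2 * p2.1 + x.2 * u.1 * q1.1 + x.2 * u.2 * q2.1,
   x.1 * u.1 * p1.2 + x.1 * u.2 * p2.2 + x.2 * u.1 * q1.2 + x.2 * u.2 * q2.2).
Definition m11 k u v : F * F :=
  ((u.1 * v.2 - u.2 * v.1) * k.1, (u.1 * v.2 - u.2 * v.1) * k.2).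
Definition lin z x y : F * F := (z.1 * x.1 + z.2 * y.1, z.1 * x.2 + z.2 * y.2).

(* The new basis is e1' = x1 e1 + x2 e2, e2' = y1 e1 + y2 e2,
   f1' = u1 f1 + u2 f2, f2' = v1 f1 + v2 f2. *)
Lemma change x y u v a b c p1 p2 q1 q2 k a' b' c' p1' p2' q1' q2' k' :
  pres a b c p1 p2 q1 q2 k ->
  x.1 * y.2 - x.2 * y.1 != 0 -> u.1 * v.2 - u.2 * v.1 != 0 ->
  lin a' x y = m00 a b c x x -> lin b' x y = m00 a b c x y -> lin c' x y = m00 a b c y y ->
  lin p1' u v = m01 p1 p2 q1 q2 x u -> lin p2' u v = m01 p1 p2 q1 q2 x v ->
  lin q1' u v = m01 p1 p2 q1 q2 y u -> lin q2' u v = m01 p1 p2 q1 q2 y v ->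
  lin k' x y = m11 k u v ->
  pres a' b' c' p1' p2' q1' q2' k'.
Proof.
move=> H d0 d1 [a1E a2E] [b1E b2E] [c1E c2E] [p1E p2E] [p3E p4E].
move=> [q1E q2E] [q3E q4E] [k1E k2E].
set D0 := _ - _ in d0; set D1 := _ - _ in d1.
pose g (i j : nat) : F := match i, j with
  | 0%N, 0%N => x.1 | 0%N, 1%N => x.2 | 1%N, 0%N => y.1 | 1%N, 1%N => y.2
  | 2%N, 2%N => u.1 | 2%N, 3%N => u.2 | 3%N, 2%N => v.1 | 3%N, 3%N => v.2
  | _, _ => 0 end.
(* The inverse of the block-diagonal matrix [g], block by block from the 2 by 2 adjugates. *)
pose g' (i j : nat) : F := match i, j with
  | 0%N, 0%N => y.2 / D0 | 0%N, 1%N => - x.2 / D0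
  | 1%N, 0%N => - y.1 / D0 | 1%N, 1%N => x.1 / D0
  | 2%N, 2%N => v.2 / D1 | 2%N, 3%N => - u.2 / D1
  | 3%N, 2%N => - v.1 / D1 | 3%N, 3%N => u.1 / D1
  | _, _ => 0 end.
apply: (base_change (G := \matrix_(i, j) g i j) (G' := \matrix_(i, j) g' i j) H).
- apply/matrixP => i j; rewrite !mxE.
  under eq_bigr => l _ do rewrite !mxE.
  rewrite (sum4E (fun l => g i l * g' l j)) /sum4.
  by case: i => [[|[|[|[|//]]]] ?]; case: j => [[|[|[|[|//]]]] ?];
    rewrite /= ?(mul0r, mulr0, add0r, addr0) // /D0 /D1; field.
- by move=> i j; rewrite mxE; case: i => [[|[|[|[|//]]]] ?]; case: j => [[|[|[|[|//]]]] ?].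
- move=> i j l.
  under eq_bigr => r _ do under eq_bigr => s _ do rewrite !mxE.
  under [RHS]eq_bigr => r _ do rewrite !mxE.
  set cc := tab a _ _ _ _ _ _ _; set cc' := tab a' _ _ _ _ _ _ _.
  rewrite (sum4E (fun r => cc' i j r * g r l)).
  under eq_bigr => r _ do rewrite (sum4E (fun s => g i r * g j s * cc r s l)).
  rewrite (sum4E (fun r => sum4 (fun s => g i r * g j s * cc r s l))) /sum4.
  by case: i => [[|[|[|[|//]]]] ?]; case: j => [[|[|[|[|//]]]] ?];
    case: l => [[|[|[|[|//]]]] ?]; rewrite /=; set z := LHS;
    rewrite ?(mul0r, add0r, addr0) ?mulNr -?opprD
      ?(a1E, a2E, b1E, b2E, c1E, c2E, p1E, p2E, p3E, p4E, q1E, q2E, q3E, q4E, k1E, k2E)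
      {}/z; ring.
Qed.
End Tab.

(* Proves x = 0, where x is s times the component m of the Jordan identity at the
   basis vectors i, j, k, l (numbered e1, e2, f1, f2), in the presentation H. *)
Ltac jac H i j k l m s :=
  match goal with jA : jordan _ |- _ =>
    refine (@scaled_zero _ s _ _ (@pres_jd _ _ jA _ _ _ _ _ _ _ _ H i j k l m
      isT isT isT isT isT) _) end;
  by rewrite /jd /sum4 /=; field.

Ltac even_eqs := rewrite /lin /m00 /=; congr (_, _); by field.

(** * Triangular and diagonal forms of the actions *)

Section Normal.
Variable F : numClosedFieldType.
Variables (A : superalgebra F).
Hypothesis jA : jordan A.
Local Notation pres := (pres A).

Lemma quadratic_root (r1 r2 r3 : F) : r1 != 0 ->
  exists s, r1 * s ^+ 2 + r2 * s + r3 = 0.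
Proof.
move=> r0; pose d := sqrtC (r2 ^+ 2 - 4 * r1 * r3).
have dK : d ^+ 2 = r2 ^+ 2 - 4 * r1 * r3 by exact: sqrtCK.
exists ((d - r2) / (2 * r1)).
transitivity ((d ^+ 2 - (r2 ^+ 2 - 4 * r1 * r3)) / (4 * r1)); first by field.
by rewrite dK subrr mul0r.
Qed.

(** The Peirce polynomial, which factors as x (1 - 2x) (1 - x). *)
Lemma idempotent_root (x : F) : x - 3 * x ^+ 2 + 2 * x ^+ 3 = 0 ->
  [\/ x = 0, x = 2^-1 | x = 1].
Proof.
move=> E; have /eqP : x * ((1 - 2 * x) * (1 - x)) = 0 by rewrite -[RHS]E; ring.
rewrite !mulf_eq0 !subr_eq0 => /or3P [/eqP|/eqP x2|/eqP].
- by constructor 1.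
- by constructor 2; apply: (@mulfI _ 2); rewrite ?mulfV ?pnatr_eq0.
- by constructor 3.
Qed.

Lemma swap_odd a b c p11 p12 p21 p22 q11 q12 q21 q22 k1 k2 :
  pres a b c (p11, p12) (p21, p22) (q11, q12) (q21, q22) (k1, k2) ->
  pres a b c (p22, p21) (p12, p11) (q22, q21) (q12, q11) (- k1, - k2).
Proof.
move=> H; apply: (change (x := (1, 0)) (y := (0, 1)) (u := (0, 1)) (v := (1, 0)) H);
  rewrite /lin /m00 /m01 /m11 /=;
  rewrite ?(mul0r, mulr0, mul1r, mulr1, add0r, addr0, subr0, sub0r, mulN1r);
  rewrite ?oppr_eq0 ?oner_eq0 //;
  by rewrite -?surjective_pairing.
Qed.

Lemma swap_even a1 a2 b1 b2 c1 c2 p1 p2 q1 q2 k1 k2 :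
  pres (a1, a2) (b1, b2) (c1, c2) p1 p2 q1 q2 (k1, k2) ->
  pres (c2, c1) (b2, b1) (a2, a1) q1 q2 p1 p2 (k2, k1).
Proof.
move=> H; apply: (change (x := (0, 1)) (y := (1, 0)) (u := (1, 0)) (v := (0, 1)) H);
  rewrite /lin /m00 /m01 /m11 /=;
  rewrite ?(mul0r, mulr0, mul1r, mulr1, add0r, addr0, subr0, sub0r, mulN1r);
  rewrite ?oppr_eq0 ?oner_eq0 //.
Qed.

Lemma scale_basis (x y u v : F) a1 a2 b1 b2 c1 c2 p11 p12 p21 p22 q11 q12 q21 q22 k1 k2 :
  x != 0 -> y != 0 -> u != 0 -> v != 0 ->
  pres (a1, a2) (b1, b2) (c1, c2) (p11, p12) (p21, p22) (q11, q12) (q21, q22) (k1, k2) ->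
  pres (x * a1, x ^+ 2 * a2 / y) (y * b1, x * b2) (y ^+ 2 * c1 / x, y * c2)
    (x * p11, x * u * p12 / v) (x * v * p21 / u, x * p22)
    (y * q11, y * u * q12 / v) (y * v * q21 / u, y * q22)
    (u * v * k1 / x, u * v * k2 / y).
Proof.
move=> x0 y0 u0 v0 H.
apply: (change (x := (x, 0)) (y := (0, y)) (u := (u, 0)) (v := (0, v)) H);
  rewrite /lin /m00 /m01 /m11 /= ?mul0r ?subr0 ?mulf_neq0 //;
  (congr (_, _); field; by rewrite ?x0 ?y0 ?u0 ?v0).
Qed.

(* The new f2 is an eigenvector of the multiplication by e1. *)
Lemma odd_triangular a b c p1 p2 q1 q2 k : pres a b c p1 p2 q1 q2 k ->
  exists p1' p22 q1' q2' k', pres a b c p1' (0, p22) q1' q2' k' /\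
    (forall s, q1 = (s, 0) -> q2 = (0, s) -> q1' = (s, 0) /\ q2' = (0, s)).
Proof.
case: p1 p2 q1 q2 k => p11 p12 [p21 p22] [q11 q12] [q21 q22] [k1 k2] H.
have [E|p0] := eqVneq p21 0.
  by exists (p11, p12), p22, (q11, q12), (q21, q22), (k1, k2); rewrite E in H.
(* The vector [f1] + s [f2] is an eigenvector of [e1] exactly when p21 s^2 + (p11 - p22) s - p12 =
   0; it becomes the new [f2], and the old [f2] the new [f1]. *)
have [s sE] := quadratic_root (p11 - p22) (- p12) p0.
exists (p22 - s * p21, p21), (p11 + s * p21), (q22 - s * q21, q21).
exists (q12 + s * q22 - s * (q11 + s * q21), q11 + s * q21), (- k1, - k2).
split; last first.
  by move=> r [-> ->] [-> ->]; split; congr (_, _); ring.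
apply: (change (x := (1, 0)) (y := (0, 1)) (u := (0, 1)) (v := (1, s)) H);
  rewrite /lin /m00 /m01 /m11 /=.
- by rewrite mulr0 subr0 mulr1 oner_eq0.
- by rewrite mul0r sub0r mulr1 oppr_eq0 oner_eq0.
- by congr (_, _); ring.
- by congr (_, _); ring.
- by congr (_, _); ring.
- by congr (_, _); ring.
- congr (_, _); first by ring.
  by apply: subr0_eq; rewrite -[RHS]sE; ring.
- by congr (_, _); ring.
- by congr (_, _); ring.
- by congr (_, _); ring.
Qed.

Definition eigenpairs : seq (F * F) :=
  [:: (0, 0); (0, 2^-1); (0, 1); (2^-1, 2^-1); (2^-1, 1); (1, 1)].

(** After triangularization both eigenvalues are roots of the Peirce polynomial, and its roots being
    simple makes the action diagonalizable. The clause on [s] keeps track of an action of [e2] that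
    is already scalar. *)
Lemma odd_diagonal b c p1 p2 q1 q2 k : pres (1, 0) b c p1 p2 q1 q2 k ->
  exists l m q1' q2' k', [/\ (l, m) \in eigenpairs,
    pres (1, 0) b c (l, 0) (0, m) q1' q2' k'
  & forall s, q1 = (s, 0) -> q2 = (0, s) -> q1' = (s, 0) /\ q2' = (0, s)].
Proof.
move=> /odd_triangular [[p11 p12] [p22 [[q11 q12] [[q21 q22] [[k1 k2] [H Hs]]]]]].
have r1 : [\/ p11 = 0, p11 = 2^-1 | p11 = 1].
  by apply: idempotent_root; jac H 0%N 0%N 0%N 2%N 2%N (1 : F).
have r2 : [\/ p22 = 0, p22 = 2^-1 | p22 = 1].
  by apply: idempotent_root; jac H 0%N 0%N 0%N 3%N 3%N (1 : F).
have [q1' [q2' [k' [H' Hs']]]] : exists q1' q2' k',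
    pres (1, 0) b c (p11, 0) (0, p22) q1' q2' k' /\
    forall s, q1 = (s, 0) -> q2 = (0, s) -> q1' = (s, 0) /\ q2' = (0, s).
  have [pE|pd] := eqVneq p11 p22.
    suff p120 : p12 = 0.
      by rewrite p120 in H; exists (q11, q12), (q21, q22), (k1, k2).
    (* For equal eigenvalues the off-diagonal coordinate of the Peirce polynomial of the action is
       p12 times the derivative 1 - 6x + 6x^2, which is 1, -1/2, 1 at 0, 1/2, 1; the factors 1, -2,
       1 are its inverses. *)
    subst p22; case: r1 H => -> {}H {Hs r2}.
    - by jac H 0%N 0%N 0%N 2%N 3%N (1 : F).
    - by jac H 0%N 0%N 0%N 2%N 3%N (- 2 : F).
    - by jac H 0%N 0%N 0%N 2%N 3%N (1 : F).
  have d0 : p11 - p22 != 0 by rewrite subr_eq0.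
  (* With this value [f1] + s [f2] is an eigenvector for p11. *)
  pose s := p12 / (p11 - p22).
  exists (q11 + s * q21, q12 + s * q22 - s * (q11 + s * q21)), (q21, q22 - s * q21), (k1, k2).
  split; last first.
    by move=> r Eq1 Eq2; have [[-> ->] [-> ->]] := Hs r Eq1 Eq2; split; congr (_, _); ring.
  apply: (change (x := (1, 0)) (y := (0, 1)) (u := (1, s)) (v := (0, 1)) H);
    rewrite /lin /m00 /m01 /m11 /=;
    rewrite ?mulr0 ?mulr1 ?subr0 ?oner_eq0 //; congr (_, _); rewrite /s; by field.
have : [\/ (p11, p22) \in eigenpairs | (p22, p11) \in eigenpairs].
  by case: r1 => ->; case: r2 => ->; rewrite !inE !eqxx ?orbT; auto.
case=> mem; first by exists p11, p22, q1', q2', k'.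
case: q1' q2' k' H' Hs' => q11' q12' [q21' q22'] [k1' k2'] /swap_odd H' Hs'.
exists p22, p11, (q22', q21'), (q12', q11'), (- k1', - k2'); split=> // s Eq1 Eq2.
by have [[-> ->] [-> ->]] := Hs' s Eq1 Eq2.
Qed.

(** The odd coordinates are left existential: a change of even basis alters them, but normalizing
    the even part only needs the whole algebra to remain presented, so that the Jordan identity
    stays available. *)
Definition evens a b c : Prop := exists p1 p2 q1 q2 k, pres a b c p1 p2 q1 q2 k.

Lemma even_change x y a b c a' b' c' : evens a b c ->
  x.1 * y.2 - x.2 * y.1 != 0 ->
  lin a' x y = m00 a b c x x -> lin b' x y = m00 a b c x y -> lin c' x y = m00 a b c y y ->
  evens a' b' c'.
Proof.
case=> p1 [p2 [q1 [q2 [k H]]]] d0 aE bE cE.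
set D := _ - _ in d0.
exists (x.1 * p1.1 + x.2 * q1.1, x.1 * p1.2 + x.2 * q1.2).
exists (x.1 * p2.1 + x.2 * q2.1, x.1 * p2.2 + x.2 * q2.2).
exists (y.1 * p1.1 + y.2 * q1.1, y.1 * p1.2 + y.2 * q1.2).
exists (y.1 * p2.1 + y.2 * q2.1, y.1 * p2.2 + y.2 * q2.2).
exists ((y.2 * k.1 - y.1 * k.2) / D, (x.1 * k.2 - x.2 * k.1) / D).
apply: (change (u := (1, 0)) (v := (0, 1)) H d0 _ aE bE cE);
  rewrite /lin /m01 /m11 /=; rewrite ?mulr0 ?mulr1 ?subr0 ?oner_eq0 //;
  congr (_, _); rewrite /D; by field.
Qed.

(* The cube of e1 being determined by power-associativity, the polynomial satisfied
   by e1 is quadratic up to a factor e1, so that only square roots are needed. *)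
Lemma even_square a b c : evens a b c ->
  (exists l b' c', evens (l, 0) b' c') \/ evens (0, 1) (0, 0) (0, 0).
Proof.
case: a => a1 a2 Ev; have [a20|a20] := eqVneq a2 0.
  by rewrite a20 in Ev; left; exists a1, b, c.
have {Ev} [b1 [b2 [c1 [c2 Ev]]]] : exists b1 b2 c1 c2, evens (0, 1) (b1, b2) (c1, c2).
  case: b c Ev => b1 b2 [c1 c2] Ev.
  (* The new [e2] is the square of [e1]; w and z are the old coordinates of its products with [e1]
     and with itself. *)
  pose w1 := a1 * a1 + a2 * b1; pose w2 := a1 * a2 + a2 * b2.
  pose z1 := a1 * a1 * a1 + 2 * a1 * a2 * b1 + a2 * a2 * c1.
  pose z2 := a1 * a1 * a2 + 2 * a1 * a2 * b2 + a2 * a2 * c2.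
  exists (w1 - a1 / a2 * w2), (w2 / a2), (z1 - a1 / a2 * z2), (z2 / a2).
  apply: (even_change (x := (1, 0)) (y := (a1, a2)) Ev); rewrite /=.
  - by rewrite mul0r subr0 mul1r.
  - even_eqs.
  - by rewrite /lin /m00 /w1 /w2 /=; congr (_, _); field.
  - by rewrite /lin /m00 /z1 /z2 /=; congr (_, _); field.
(* Power-associativity: with [e2] = e1^2 and e1^3 = b1 e1 + b2 e1^2, the product of e1^2 with itself
   is e1 times e1^3. *)
have [[c1E c2E]] : c1 = b1 * b2 /\ c2 = b1 + b2 ^+ 2.
  case: Ev => p1 [p2 [q1 [q2 [k H]]]]; split; apply: subr0_eq.
    by jac H 0%N 0%N 0%N 0%N 0%N (- 3^-1 : F).
  by jac H 0%N 0%N 0%N 0%N 1%N (- 3^-1 : F).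
subst c1 c2; have [b10|b10] := eqVneq b1 0.
  subst b1; have [b20|b20] := eqVneq b2 0.
    by right; subst b2; move: Ev; rewrite mul0r expr0n addr0.
  left; exists (b2 ^+ 2), (b2, 0), (1, 0).
  apply: (even_change (x := (0, 1)) (y := (1, 0)) Ev); rewrite /=.
  - by rewrite mul0r mul1r sub0r oppr_eq0 oner_eq0.
  - even_eqs.
  - even_eqs.
  - even_eqs.
(* For a root r of r^2 - b2 r - b1, the vector e1^2 + (r - b2) e1 is an eigenvector of [e1] with
   eigenvalue r, so its square is r (2r - b2) times itself. *)
have [r rE] := quadratic_root (- b2) (- b1) (oner_neq0 F).
have b1E : b1 = r ^+ 2 - b2 * r by apply: subr0_eq; rewrite -[RHS]oppr0 -rE; ring.
left; exists (r * (2 * r - b2)), (r, 0), (1, b2 - r).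
apply: (even_change (x := (r - b2, 1)) (y := (1, 0)) Ev); rewrite /=.
- by rewrite mulr0 mul1r sub0r oppr_eq0 oner_eq0.
- by rewrite /lin /m00 /= b1E; congr (_, _); ring.
- by rewrite /lin /m00 /= b1E; congr (_, _); ring.
- by rewrite /lin /m00 /= b1E; congr (_, _); ring.
Qed.
End Normal.

(** * Classification of the even part *)

Section EvenForms.
Variable F : numClosedFieldType.
Variables (A : superalgebra F).
Hypothesis jA : jordan A.
Local Notation pres := (pres A).
Local Notation evens := (evens A).

Definition idempotent_forms : Prop :=
  [\/ evens (1, 0) (0, 0) (0, 1), evens (1, 0) (0, 0) (0, 0),
      evens (1, 0) (0, 1) (0, 0) | evens (1, 0) (0, 2^-1) (0, 0)].

(** b2 is the eigenvalue of [e1] on the even part modulo [e1], hence a Peirce eigenvalue; each of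
    its three values is then normalized by hand. *)
Lemma even_idempotent b c : evens (1, 0) b c -> idempotent_forms.
Proof.
case: b c => b1 b2 [c1 c2] Ev.
have r : [\/ b2 = 0, b2 = 2^-1 | b2 = 1].
  case: Ev => p1 [p2 [q1 [q2 [k H]]]].
  by apply: idempotent_root; jac H 0%N 0%N 0%N 1%N 1%N (1 : F).
have {c1 c2 Ev} [c1 [c2 Ev]] : exists c1 c2, evens (1, 0) (0, b2) (c1, c2).
  have [b21|b21] := eqVneq b2 1.
    have b10 : b1 = 0.
      rewrite b21 in Ev; case: Ev => p1 [p2 [q1 [q2 [k H]]]].
      by jac H 0%N 0%N 0%N 1%N 0%N (1 : F).
    by rewrite b10 in Ev; exists c1, c2.
  have d0 : b2 - 1 != 0 by rewrite subr_eq0.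
  (* Makes s [e1] + [e2] an eigenvector of [e1] for b2. At b2 = 1 the shift is impossible, but there
     simplicity of the root 1 already gives b1 = 0. *)
  pose s := b1 / (b2 - 1).
  exists (s ^+ 2 + 2 * s * b1 + c1 - s * (2 * s * b2 + c2)), (2 * s * b2 + c2).
  apply: (even_change (x := (1, 0)) (y := (s, 1)) Ev); rewrite /=.
  - by rewrite mul0r subr0 mul1r oner_eq0.
  - even_eqs.
  - by rewrite /lin /m00 /s /=; congr (_, _); field.
  - by rewrite /lin /m00 /=; congr (_, _); ring.
case: r Ev => -> Ev.
- have c10 : c1 = 0.
    by case: Ev => p1 [p2 [q1 [q2 [k H]]]]; jac H 0%N 0%N 1%N 1%N 0%N (- 1 : F).
  have [c20|c20] := eqVneq c2 0; first by rewrite c10 c20 in Ev; constructor 2.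
  constructor 1; rewrite c10 in Ev.
  apply: (even_change (x := (1, 0)) (y := (0, c2^-1)) Ev); rewrite /=.
  + by rewrite mul0r subr0 mul1r invr_eq0.
  + even_eqs.
  + even_eqs.
  + even_eqs.
- have c20 : c2 = 0.
    by case: Ev => p1 [p2 [q1 [q2 [k H]]]]; jac H 0%N 1%N 0%N 1%N 1%N (- 4 : F).
  have c10 : c1 = 0.
    by case: Ev => p1 [p2 [q1 [q2 [k H]]]]; jac H 1%N 1%N 0%N 1%N 1%N (4 / 3 : F).
  by constructor 4; rewrite c10 c20 in Ev.
(* Completing the square: [e1] is a unit, so subtracting c2/2 times it from [e2] leaves a multiple
   of [e1] as the square. *)
- have {Ev} Ev : evens (1, 0) (0, 1) (c1 + c2 ^+ 2 / 4, 0).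
    apply: (even_change (x := (1, 0)) (y := (- c2 / 2, 1)) Ev); rewrite /=.
    + by rewrite mul0r subr0 mul1r oner_eq0.
    + even_eqs.
    + even_eqs.
    + even_eqs.
  move: (c1 + _) Ev => g Ev.
  have [g0|g0] := eqVneq g 0; first by constructor 3; rewrite g0 in Ev.
  constructor 1; pose r := sqrtC g; have rg : r ^+ 2 = g by exact: sqrtCK.
  have r0 : r != 0 by rewrite -sqrf_eq0 rg.
  rewrite -rg in Ev.
  (* When [e2] squares to r^2 times the unit, ([e1] + [e2] / r) / 2 and ([e1] - [e2] / r) / 2 are
     orthogonal idempotents, and the form with two idempotents is reached. *)
  apply: (even_change (x := (2^-1, (2 * r)^-1)) (y := (2^-1, - (2 * r)^-1)) Ev); rewrite /=.
  + have -> : 2^-1 * - (2 * r)^-1 - (2 * r)^-1 * 2^-1 = - (2 * r)^-1 by field.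
    by rewrite oppr_eq0 invr_eq0 mulf_neq0 // pnatr_eq0.
  + even_eqs.
  + even_eqs.
  + even_eqs.
Qed.

Lemma even_forms a b c : evens a b c ->
  [\/ idempotent_forms, evens (0, 1) (0, 0) (0, 0) | evens (0, 0) (0, 0) (0, 0)].
Proof.
case/(even_square jA) => [[l [[b1 b2] [[c1 c2] Ev]]]|Ev]; last by constructor 2.
have [l0|l0] := eqVneq l 0; last first.
  constructor 1; apply: (even_idempotent (b := (b1, b2 / l)) (c := (c1 * l, c2))).
  apply: (even_change (x := (l^-1, 0)) (y := (0, 1)) Ev); rewrite /=.
  - by rewrite mul0r subr0 mulr1 invr_eq0.
  - even_eqs.
  - even_eqs.
  - even_eqs.
rewrite l0 in Ev; have b20 : b2 = 0.
  suff /eqP : b2 ^+ 3 = 0 by rewrite expf_eq0 => /eqP.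
  by case: Ev => p1 [p2 [q1 [q2 [k H]]]]; jac H 0%N 0%N 0%N 1%N 1%N (2^-1 : F).
(* The Peirce polynomial in b1 / c2 with denominators cleared; for c2 = 0 it reduces to 2 b1^3 =
   0. *)
rewrite b20 in Ev; have bE : b1 * c2 ^+ 2 - 3 * b1 ^+ 2 * c2 + 2 * b1 ^+ 3 = 0.
  by case: Ev => p1 [p2 [q1 [q2 [k H]]]]; jac H 0%N 1%N 1%N 1%N 0%N (1 : F).
have [c20|c20] := eqVneq c2 0.
  have b10 : b1 = 0.
    suff /eqP : b1 ^+ 3 = 0 by rewrite expf_eq0 => /eqP.
    apply: (@mulfI _ 2); rewrite ?pnatr_eq0 // mulr0 -[RHS]bE c20; ring.
  rewrite b10 c20 in Ev; have [c10|c10] := eqVneq c1 0.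
    by constructor 3; rewrite c10 in Ev.
  constructor 2; apply: (even_change (x := (0, 1)) (y := (c1, 0)) Ev); rewrite /=.
  - by rewrite mul0r mul1r sub0r oppr_eq0.
  - even_eqs.
  - even_eqs.
  - even_eqs.
(* The condition for the square of [e2] + s [e1] to be c2 times itself; dividing that vector by c2
   gives an idempotent. When c2 = 2 b1 the equation is solvable because the Jordan identity yields
   c1 = 0. *)
have [s sE] : exists s, c1 + 2 * s * b1 = c2 * s.
  have [cE|d0] := eqVneq c2 (2 * b1); last first.
    have {}d0 : c2 - 2 * b1 != 0 by rewrite subr_eq0.
    by exists (c1 / (c2 - 2 * b1)); field.
  exists 0; rewrite !mulr0 mul0r addr0.
  have /eqP : b1 ^+ 2 * c1 = 0.
    rewrite cE in Ev; case: Ev => p1 [p2 [q1 [q2 [k H]]]].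
    by jac H 1%N 1%N 1%N 1%N 0%N (- 3^-1 : F).
  rewrite mulf_eq0 sqrf_eq0 => /orP [|] /eqP // b10.
  by rewrite cE b10 mulr0 eqxx in c20.
constructor 1; apply: (even_idempotent (b := (0, b1 / c2)) (c := (0, 0))).
have c1E : c1 = c2 * s - 2 * s * b1 by rewrite -sE; ring.
apply: (even_change (x := (s / c2, c2^-1)) (y := (1, 0)) Ev); rewrite /= ?c1E.
- by rewrite mulr0 sub0r mulr1 oppr_eq0 invr_eq0.
- even_eqs.
- even_eqs.
- even_eqs.
Qed.
End EvenForms.

(** * Recognizing a listed entry from its coordinates *)

Definition pol_tab (L : seq pol) (i j l : nat) : pol :=
  let even n := match l with 0%N => nth [::] L n | 1%N => nth [::] L n.+1 | _ => [::] end in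
  let odd n := match l with 2%N => nth [::] L n | 3%N => nth [::] L n.+1 | _ => [::] end in
  match i, j with
  | 0%N, 0%N => even 0%N
  | 0%N, 1%N | 1%N, 0%N => even 2%N
  | 1%N, 1%N => even 4%N
  | 0%N, 2%N | 2%N, 0%N => odd 6%N
  | 0%N, 3%N | 3%N, 0%N => odd 8%N
  | 1%N, 2%N | 2%N, 1%N => odd 10%N
  | 1%N, 3%N | 3%N, 1%N => odd 12%N
  | 2%N, 3%N => even 14%N
  | 3%N, 2%N => popp (even 14%N)
  | _, _ => [::]
  end.

Definition listing_pols (k : nat) : seq pol :=
  let s := sconst (listing_symb k) in
  [:: s 0 0 0; s 0 0 1; s 0 1 0; s 0 1 1; s 1 1 0; s 1 1 1; s 0 2 2; s 0 2 3;
      s 0 3 2; s 0 3 3; s 1 2 2; s 1 2 3; s 1 3 2; s 1 3 3; s 2 3 0; s 2 3 1]%N.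

(** Turns the doubled polynomials into the literals 0, 1/2, 1 and [t], so that normalized
    presentations match entries without unfolding [pev]. *)
Definition pvalue (F : numFieldType) (t : F) (p : pol) : F :=
  match p with
  | [::] => 0
  | [:: Zpos xH] => 2^-1
  | [:: Zpos (xO xH)] => 1
  | _ => t
  end.

Definition simple_pol (p : pol) : bool :=
  p \in [:: [::]; [:: Zpos xH]; [:: Zpos (xO xH)]; [:: Z0; Zpos (xO xH)]].

Lemma pvalueE (F : numFieldType) (t : F) p : simple_pol p -> pvalue t p = pev t p / 2.
Proof.
rewrite /simple_pol !inE => /or4P [] /eqP ->.
- by rewrite /= mul0r.
- exact: (cevE t Ch).
- exact: (cevE t C1).
- exact: (cevE t Ct).
Qed.

Section Classification.
Variable F : numClosedFieldType.
Variables (A : superalgebra F).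
Hypothesis jA : jordan A.
Local Notation pres := (pres A).
Local Notation evens := (evens A).

Definition classified : Prop :=
  exists (k : nat) (t : F), (1 <= k <= 71)%N /\ isomorphic A (listed_alg (listing t k)).

Lemma entry_of_pres k t (v := fun n => pvalue t (nth [::] (listing_pols k) n)) :
  (1 <= k <= 71)%N ->
  pres (v 0, v 1) (v 2, v 3) (v 4, v 5) (v 6, v 7) (v 8, v 9) (v 10, v 11)
       (v 12, v 13) (v 14, v 15)%N -> classified.
Proof.
move=> kP H; exists k, t; split=> //.
apply: presented_isomorphic (listing_presents t kP).
apply: presented_ext H _ _ => // i j l.
have /allP/(_ k) : all (fun k =>
    let L := listing_pols k in let sc := sconst (listing_symb k) in
    all simple_pol L && all_below 4 (fun i => all_below 4 (fun j => all_below 4 (fun l =>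
      sc i j l == pol_tab L i j l)))) (iota 1 71) by vm_compute.
rewrite mem_iota => /(_ kP); cbv beta zeta; case/andP=> /allP sim.
move=> /all_belowP/(_ i)/all_belowP/(_ j)/all_belowP/(_ l)/eqP ->.
have vE n : (n < 16)%N -> v n = pev t (nth [::] (listing_pols k) n) / 2.
  by move=> n16; apply: pvalueE; apply: sim; apply: mem_nth.
have N0 : pev t [::] / 2 = 0 by rewrite mul0r.
move: {sim kP} (listing_pols k) @v vE => L v vE.
by case: i => [[|[|[|[|//]]]] ?]; case: j => [[|[|[|[|//]]]] ?];
  case: l => [[|[|[|[|//]]]] ?]; rewrite /= ?pevN ?mulNr -?vE ?N0 ?oppr0.
Qed.

End Classification.

Ltac entry k t H :=
  match goal with jA : jordan _ |- _ => idtac end;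
  apply: (@entry_of_pres _ _ k t isT);
  let L := fresh "L" in set L := listing_pols _; vm_compute in L;
  rewrite /L /=; apply: (pres_cast H);
  (congr (_, _); by field).

Lemma expf0 (F : fieldType) n (x : F) : x ^+ n = 0 -> x = 0.
Proof. by move/eqP; rewrite expf_eq0 => /andP [_ /eqP]. Qed.

Ltac kill H x i j k l m s :=
  let E := fresh "E" in assert (E : x = 0) by (jac H i j k l m s); subst x.

Ltac kill_pow H x n i j k l m s :=
  let E := fresh "E" in
  assert (E : x = 0) by (apply: (@expf0 _ n); jac H i j k l m s); subst x.

(** * Even part spanned by two orthogonal idempotents *)

Section Split.
Variable F : numClosedFieldType.
Variables (A : superalgebra F).
Hypothesis jA : jordan A.
Local Notation pres := (pres A).
Local Notation classified := (classified A).

Variant eigen_spec : F -> F -> Prop :=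
  | Eigen00 : eigen_spec 0 0
  | Eigen0h : eigen_spec 0 2^-1
  | Eigen01 : eigen_spec 0 1
  | Eigenhh : eigen_spec 2^-1 2^-1
  | Eigenh1 : eigen_spec 2^-1 1
  | Eigen11 : eigen_spec 1 1.

Lemma eigenpairsP l m : (l, m) \in eigenpairs F -> eigen_spec l m.
Proof.
rewrite !inE !xpair_eqE.
by do ?[case/orP]; move=> /andP [/eqP -> /eqP ->]; constructor.
Qed.

Local Notation split_pres := (pres (1, 0) (0, 0) (0, 1)).

Lemma absurd_one (P : Prop) : (1 : F) = 0 -> P.
Proof. by move/eqP; rewrite oner_eq0. Qed.

(** The cases run over m = 0, 1/2, 1 and, for each, over the eigenvalue pairs of [e1]. A vector with
    eigenvalue 1 for one idempotent and a nonzero eigenvalue for the other contradicts the identity,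
    which then reads 1 = 0. *)
Lemma split_scalar l l' m k1 k2 : (l, l') \in eigenpairs F -> m \in [:: 0; 2^-1; 1] ->
  split_pres (l, 0) (0, l') (m, 0) (0, m) (k1, k2) -> classified.
Proof.
move=> /eigenpairsP Ell; rewrite !inE => /or3P [] /eqP ->; case: Ell => H.
- kill H k1 0%N 0%N 2%N 3%N 0%N (- 1 : F). kill H k2 1%N 1%N 2%N 3%N 1%N (- 1 : F).
  entry 1%N (0 : F) H.
- kill H k1 0%N 0%N 3%N 2%N 0%N (2 : F). kill H k2 0%N 0%N 3%N 2%N 1%N (- 2 : F).
  move/swap_even in H; entry 3%N (0 : F) H.
- kill H k1 0%N 0%N 2%N 3%N 0%N (1 : F). kill H k2 0%N 0%N 3%N 2%N 1%N (- 1 : F).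
  move/swap_even in H; entry 2%N (0 : F) H.
- kill H k2 0%N 1%N 2%N 3%N 1%N (2 : F).
  move/swap_even in H; have [k0|k0] := eqVneq k1 0; first by rewrite k0 in H; entry 7%N (0 : F) H.
  have {}H := scale_basis (oner_neq0 F) (oner_neq0 F) (invr_neq0 k0) (oner_neq0 F) H.
  entry 8%N (0 : F) H.
- kill H k1 0%N 0%N 2%N 3%N 0%N (2 : F). kill H k2 0%N 0%N 2%N 3%N 1%N (- 2 : F).
  move/swap_even/swap_odd in H; entry 5%N (0 : F) H.
- kill H k2 0%N 0%N 2%N 3%N 1%N (- 1 : F).
  move/swap_even in H; have [k0|k0] := eqVneq k1 0; first by rewrite k0 in H; entry 4%N (0 : F) H.
  have {}H := scale_basis (oner_neq0 F) (oner_neq0 F) (invr_neq0 k0) (oner_neq0 F) H.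
  entry 6%N (0 : F) H.
- kill H k1 0%N 0%N 2%N 3%N 0%N (- 1 : F).
  have [k0|k0] := eqVneq k2 0; first by rewrite k0 in H; entry 7%N (0 : F) H.
  have {}H := scale_basis (oner_neq0 F) (oner_neq0 F) (invr_neq0 k0) (oner_neq0 F) H.
  entry 8%N (0 : F) H.
- kill H k1 0%N 0%N 3%N 2%N 0%N (2 : F). kill H k2 0%N 0%N 3%N 2%N 1%N (- 2 : F).
  entry 13%N (0 : F) H.
- by apply: absurd_one; jac H 0%N 0%N 1%N 3%N 3%N (2 : F).
(* The origin of the one-parameter family: rescaling [f1] makes the first coordinate of the odd
   product 1, and t = k2 / k1 remains. If k1 = 0, exchanging the idempotents leads to t = 0. *)
- have [k0|k0] := eqVneq k1 0; last first.
    have {}H := scale_basis (oner_neq0 F) (oner_neq0 F) (invr_neq0 k0) (oner_neq0 F) H.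
    entry 16%N (k2 / k1) H.
  rewrite k0 in H; have [k20|k20] := eqVneq k2 0.
    by rewrite k20 in H; entry 15%N (0 : F) H.
  move/swap_even in H.
  have {}H := scale_basis (oner_neq0 F) (oner_neq0 F) (invr_neq0 k20) (oner_neq0 F) H.
  entry 16%N (0 : F) H.
- by apply: absurd_one; jac H 0%N 0%N 1%N 3%N 3%N (2 : F).
- by apply: absurd_one; jac H 0%N 0%N 1%N 2%N 2%N (2 : F).
- kill H k1 0%N 0%N 2%N 3%N 0%N (- 1 : F).
  have [k0|k0] := eqVneq k2 0; first by rewrite k0 in H; entry 4%N (0 : F) H.
  have {}H := scale_basis (oner_neq0 F) (oner_neq0 F) (invr_neq0 k0) (oner_neq0 F) H.
  entry 6%N (0 : F) H.
- by apply: absurd_one; jac H 1%N 1%N 0%N 3%N 3%N (2 : F).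
- by apply: absurd_one; jac H 0%N 0%N 1%N 3%N 3%N (1 : F).
- by apply: absurd_one; jac H 0%N 1%N 1%N 2%N 2%N (2 : F).
- by apply: absurd_one; jac H 0%N 0%N 1%N 3%N 3%N (1 : F).
- by apply: absurd_one; jac H 0%N 0%N 1%N 2%N 2%N (1 : F).
Qed.

(** Where one idempotent has eigenvalue 1/2, an orthogonal one cannot have eigenvalue 1. *)
Lemma quadratic_half (x : F) : x - 2 * x ^+ 2 = 0 -> x = 0 \/ x = 2^-1.
Proof.
move=> E; have /eqP : x * (1 - 2 * x) = 0 by rewrite -[RHS]E; ring.
rewrite mulf_eq0 subr_eq0 => /orP [/eqP|/eqP x2]; first by left.
by right; apply: (@mulfI _ 2); rewrite ?mulfV ?pnatr_eq0.
Qed.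

Lemma split_classified : evens A (1, 0) (0, 0) (0, 1) -> classified.
Proof.
case=> p1 [p2 [q1 [q2 [k /(odd_diagonal jA)]]]].
case=> l [m [[q11 q12] [[q21 q22] [[k1 k2] [/eigenpairsP Elm H _]]]]].
(* If [e1] acts as a scalar, the idempotents are exchanged and the other one is diagonalized, the
   scalar action surviving. For distinct eigenvalues the identity itself makes the second action
   diagonal. *)
have scalar r : r \in [:: 0; 2^-1; 1] ->
    split_pres (r, 0) (0, r) (q11, q12) (q21, q22) (k1, k2) -> classified.
  move=> rP /swap_even /(odd_diagonal jA).
  case=> l' [m' [q1' [q2' [[k1' k2'] [lm H' Hs]]]]].
  by have [E1 E2] := Hs r erefl erefl; subst; exact: split_scalar lm rP H'.
case: Elm H => H.
- by apply: (scalar 0); rewrite ?inE ?eqxx.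
- kill H q12 0%N 0%N 1%N 2%N 3%N (- 2 : F). kill H q21 0%N 0%N 3%N 1%N 2%N (2 : F).
  kill H k1 0%N 0%N 3%N 2%N 0%N (2 : F). kill H k2 0%N 0%N 3%N 2%N 1%N (- 2 : F).
  have [E|E] : q22 = 0 \/ q22 = 2^-1.
  + by apply: quadratic_half; jac H 1%N 1%N 0%N 3%N 3%N (- 2 : F).
  + have [E1|E1|E1] : [\/ q11 = 0, q11 = 2^-1 | q11 = 1].
    * by apply: idempotent_root; jac H 1%N 1%N 1%N 2%N 2%N (1 : F).
    * by subst; move/swap_even in H; entry 3%N (0 : F) H.
    * by subst; entry 12%N (0 : F) H.
    * by subst; entry 10%N (0 : F) H.
  + have [E1|E1|E1] : [\/ q11 = 0, q11 = 2^-1 | q11 = 1].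
    * by apply: idempotent_root; jac H 1%N 1%N 1%N 2%N 2%N (1 : F).
    * by subst; entry 9%N (0 : F) H.
    * by subst; entry 13%N (0 : F) H.
    * by subst; entry 11%N (0 : F) H.
- kill H q12 0%N 0%N 1%N 2%N 3%N (- 1 : F). kill H q21 0%N 0%N 3%N 1%N 2%N (1 : F).
  kill H q22 0%N 0%N 1%N 3%N 3%N (1 : F).
  kill H k1 0%N 0%N 2%N 3%N 0%N (1 : F). kill H k2 0%N 0%N 3%N 2%N 1%N (- 1 : F).
  have [E1|E1|E1] : [\/ q11 = 0, q11 = 2^-1 | q11 = 1].
  + by apply: idempotent_root; jac H 1%N 1%N 1%N 2%N 2%N (1 : F).
  + by subst; move/swap_even in H; entry 2%N (0 : F) H.
  + by subst; move/swap_even/swap_odd in H; entry 10%N (0 : F) H.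
  + by subst; entry 14%N (0 : F) H.
- by apply: (scalar 2^-1); rewrite ?inE ?eqxx ?orbT.
- kill H q21 0%N 0%N 1%N 3%N 2%N (2 : F). kill H q22 0%N 0%N 1%N 3%N 3%N (1 : F).
  kill H q12 0%N 0%N 2%N 1%N 3%N (- 2 : F).
  kill H k1 0%N 0%N 2%N 3%N 0%N (2 : F). kill H k2 0%N 0%N 2%N 3%N 1%N (- 2 : F).
  have [E|E] : q11 = 0 \/ q11 = 2^-1.
  + by apply: quadratic_half; jac H 0%N 1%N 1%N 2%N 2%N (- 2 : F).
  + by subst; move/swap_even/swap_odd in H; entry 5%N (0 : F) H.
  + by subst; move/swap_even/swap_odd in H; entry 11%N (0 : F) H.
- by apply: (scalar 1); rewrite ?inE ?eqxx ?orbT.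
Qed.
End Split.

(** * Even part with one idempotent and a second vector of square zero *)

Section Idempotent.
Variable F : numClosedFieldType.
Variables (A : superalgebra F).
Hypothesis jA : jordan A.
Local Notation pres := (pres A).
Local Notation classified := (classified A).

(** Since [e1] acts as a scalar, the odd basis can be chosen for [e2] alone. *)
Lemma second_triangular a b c l q1 q2 k : pres a b c (l, 0) (0, l) q1 q2 k ->
  exists q11 q12 q22 k1 k2, pres a b c (l, 0) (0, l) (q11, q12) (0, q22) (k1, k2).
Proof.
case: a b c k => a1 a2 [b1 b2] [c1 c2] [k1 k2].
move/swap_even/odd_triangular => [[q11 q12] [q22 [p1 [p2 [[k1' k2'] [H Hs]]]]]].
have [E1 E2] := Hs l erefl erefl; subst; move/swap_even in H.
by exists q11, q12, q22, k2', k1'.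
Qed.

(** Scaling [f1] by 1/r and [f2] by q12/r makes q12 equal to 1 and turns k2 into q12 k2 / r^2,
    whence the choice of r. The value -1 of [eps] is for use between two applications of [swap_odd],
    which reverses the sign of the odd product. *)
Lemma scale_nilpotent (eps : F) b l m q12 k2 : eps != 0 -> q12 != 0 ->
  pres (1, 0) (0, b) (0, 0) (l, 0) (0, m) (0, q12) (0, 0) (0, k2) ->
  pres (1, 0) (0, b) (0, 0) (l, 0) (0, m) (0, 1) (0, 0) (0, 0) \/
  pres (1, 0) (0, b) (0, 0) (l, 0) (0, m) (0, 1) (0, 0) (0, eps).
Proof.
move=> e0 q0 H; have n1 := oner_neq0 F; have [k0|k0] := eqVneq k2 0.
  rewrite k0 in H; left; have {}H := scale_basis n1 n1 n1 q0 H.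
  by apply: (pres_cast H); congr (_, _); field.
right; pose r := sqrtC (q12 * k2 / eps).
have rE : r ^+ 2 = q12 * k2 / eps by exact: sqrtCK.
have r0 : r != 0 by rewrite -sqrf_eq0 rE !mulf_neq0 // invr_eq0.
have k2E : k2 = r ^+ 2 * eps / q12 by rewrite rE; field; rewrite q0.
rewrite k2E in H.
have {}H := scale_basis n1 n1 (invr_neq0 r0) (mulf_neq0 q0 (invr_neq0 r0)) H.
by apply: (pres_cast H); congr (_, _); field; rewrite ?q0 ?r0.
Qed.

(* Scaling f1 and e2 turns the nonzero coordinates of f1f2 into 1. *)
Lemma product_classified b l m k1 k2 :
  pres (1, 0) (0, b) (0, 0) (l, 0) (0, m) (0, 0) (0, 0) (k1, k2) ->
  (pres (1, 0) (0, b) (0, 0) (l, 0) (0, m) (0, 0) (0, 0) (0, 0) -> classified) ->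
  (k2 != 0 -> pres (1, 0) (0, b) (0, 0) (l, 0) (0, m) (0, 0) (0, 0) (0, 1) -> classified) ->
  (k1 != 0 -> pres (1, 0) (0, b) (0, 0) (l, 0) (0, m) (0, 0) (0, 0) (1, 0) -> classified) ->
  (k1 != 0 -> pres (1, 0) (0, b) (0, 0) (l, 0) (0, m) (0, 0) (0, 0) (1, 1) -> classified) ->
  classified.
Proof.
move=> H H00 H01 H10 H11; have n1 := oner_neq0 F.
have [k10|k10] := eqVneq k1 0; have [k20|k20] := eqVneq k2 0.
- by apply: H00; rewrite k10 k20 in H.
- rewrite k10 in H; apply: H01 => //.
  have {}H := scale_basis n1 n1 (invr_neq0 k20) n1 H.
  by apply: (pres_cast H); congr (_, _); field.
- rewrite k20 in H; apply: H10 => //.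
  have {}H := scale_basis n1 n1 (invr_neq0 k10) n1 H.
  by apply: (pres_cast H); congr (_, _); field.
- apply: H11 => //.
  have {}H := scale_basis n1 (mulf_neq0 k20 (invr_neq0 k10)) (invr_neq0 k10) n1 H.
  by apply: (pres_cast H); congr (_, _); field; rewrite ?k10 ?k20.
Qed.

Lemma mulf0r (x y : F) : y != 0 -> x * y = 0 -> x = 0.
Proof. by move=> y0 /eqP; rewrite mulf_eq0 (negPf y0) orbF => /eqP. Qed.

Lemma null_classified : evens A (1, 0) (0, 0) (0, 0) -> classified.
Proof.
case=> p1 [p2 [q1 [q2 [k /(odd_diagonal jA)]]]].
case=> l [m [[q11 q12] [[q21 q22] [[k1 k2] [/eigenpairsP Elm H _]]]]].
have n1 := oner_neq0 F.
case: Elm H => H.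
- move: H => /second_triangular {q11 q12 q21 q22 k1 k2} [q11 [q12 [q22 [k1 [k2 H]]]]].
  kill_pow H q11 3%N 1%N 1%N 1%N 2%N 2%N (2^-1 : F).
  kill_pow H q22 3%N 1%N 1%N 1%N 3%N 3%N (2^-1 : F).
  kill H k1 0%N 0%N 2%N 3%N 0%N (- 1 : F).
  have [q0|q0] := eqVneq q12 0.
    rewrite q0 in H; apply: (product_classified H) => [{}H|_ {}H||]; rewrite ?eqxx //.
    + entry 21%N (0 : F) H.
    + entry 22%N (0 : F) H.
  case: (scale_nilpotent n1 q0 H) => {}H; [entry 23%N (0 : F) H | entry 24%N (0 : F) H].
- kill H q12 0%N 0%N 1%N 2%N 3%N (- 2 : F). kill H q21 0%N 0%N 3%N 1%N 2%N (2 : F).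
  kill H k1 0%N 0%N 3%N 2%N 0%N (2 : F). kill H k2 0%N 0%N 3%N 2%N 1%N (- 2 : F).
  kill_pow H q22 2%N 1%N 1%N 0%N 3%N 3%N (1 : F).
  kill_pow H q11 3%N 1%N 1%N 1%N 2%N 2%N (2^-1 : F).
  entry 25%N (0 : F) H.
- kill H q12 0%N 0%N 1%N 2%N 3%N (- 1 : F). kill H q21 0%N 0%N 3%N 1%N 2%N (1 : F).
  kill H k1 0%N 0%N 2%N 3%N 0%N (1 : F). kill H k2 0%N 0%N 3%N 2%N 1%N (- 1 : F).
  kill H q22 0%N 0%N 1%N 3%N 3%N (1 : F).
  kill_pow H q11 3%N 1%N 1%N 1%N 2%N 2%N (2^-1 : F).
  entry 26%N (0 : F) H.
- move: H => /second_triangular {q11 q12 q21 q22 k1 k2} [q11 [q12 [q22 [k1 [k2 H]]]]].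
  kill_pow H q11 2%N 0%N 1%N 1%N 2%N 2%N (1 : F).
  kill_pow H q22 2%N 0%N 1%N 1%N 3%N 3%N (1 : F).
  have [q0|q0] := eqVneq q12 0.
    rewrite q0 in H; apply: (product_classified H) => [{}H|_ {}H|_ {}H|_ {}H].
    + entry 27%N (0 : F) H.
    + entry 28%N (0 : F) H.
    + entry 29%N (0 : F) H.
    + entry 30%N (0 : F) H.
  have k10 : k1 = 0 by apply: (mulf0r q0); jac H 0%N 1%N 2%N 2%N 0%N (1 : F).
  subst k1; case: (scale_nilpotent n1 q0 H) => {}H;
    [entry 31%N (0 : F) H | entry 32%N (0 : F) H].
- kill H q21 0%N 0%N 1%N 3%N 2%N (2 : F). kill H q22 0%N 0%N 1%N 3%N 3%N (1 : F).
  kill H q12 0%N 0%N 2%N 1%N 3%N (- 2 : F).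
  kill H k1 0%N 0%N 2%N 3%N 0%N (2 : F). kill H k2 0%N 0%N 2%N 3%N 1%N (- 2 : F).
  kill_pow H q11 2%N 0%N 1%N 1%N 2%N 2%N (1 : F).
  entry 33%N (0 : F) H.
- kill H q11 0%N 0%N 1%N 2%N 2%N (1 : F). kill H q12 0%N 0%N 1%N 2%N 3%N (1 : F).
  kill H q21 0%N 0%N 1%N 3%N 2%N (1 : F). kill H q22 0%N 0%N 1%N 3%N 3%N (1 : F).
  kill H k2 0%N 0%N 2%N 3%N 1%N (- 1 : F).
  have [k0|k0] := eqVneq k1 0; first by rewrite k0 in H; entry 34%N (0 : F) H.
  have {}H := scale_basis n1 n1 (invr_neq0 k0) n1 H.
  entry 35%N (0 : F) H.
Qed.

Lemma unital_classified : evens A (1, 0) (0, 1) (0, 0) -> classified.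
Proof.
case=> p1 [p2 [q1 [q2 [k /(odd_diagonal jA)]]]].
case=> l [m [[q11 q12] [[q21 q22] [[k1 k2] [/eigenpairsP Elm H _]]]]].
have n1 := oner_neq0 F.
case: Elm H => H.
- kill H q11 0%N 0%N 1%N 2%N 2%N (1 : F). kill H q12 0%N 0%N 1%N 2%N 3%N (1 : F).
  kill H q21 0%N 0%N 1%N 3%N 2%N (1 : F). kill H q22 0%N 0%N 1%N 3%N 3%N (1 : F).
  kill H k1 0%N 0%N 2%N 3%N 0%N (- 1 : F). kill H k2 0%N 0%N 2%N 3%N 1%N (- 1 : F).
  entry 36%N (0 : F) H.
- kill H q11 0%N 0%N 1%N 2%N 2%N (1 : F). kill H q12 0%N 0%N 1%N 2%N 3%N (2 : F).
  kill H q21 0%N 0%N 3%N 1%N 2%N (- 2 : F).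
  kill H k1 0%N 0%N 3%N 2%N 0%N (2 : F). kill H k2 0%N 0%N 3%N 2%N 1%N (2 : F).
  kill_pow H q22 2%N 0%N 1%N 1%N 3%N 3%N (- 1 : F).
  entry 37%N (0 : F) H.
- kill H q11 0%N 0%N 1%N 2%N 2%N (1 : F). kill H q21 0%N 0%N 1%N 3%N 2%N (- 1 : F).
  kill H q12 0%N 0%N 2%N 1%N 3%N (1 : F).
  kill H k1 0%N 0%N 2%N 3%N 0%N (1 : F). kill H k2 0%N 0%N 2%N 3%N 1%N (1 : F).
  kill_pow H q22 3%N 1%N 1%N 1%N 3%N 3%N (2^-1 : F).
  entry 38%N (0 : F) H.
- move: H => /second_triangular {q11 q12 q21 q22 k1 k2} [q11 [q12 [q22 [k1 [k2 H]]]]].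
  kill_pow H q11 2%N 0%N 1%N 1%N 2%N 2%N (- 1 : F).
  kill_pow H q22 2%N 0%N 1%N 1%N 3%N 3%N (- 1 : F).
  kill H k1 0%N 1%N 2%N 3%N 1%N (- 2 : F).
  have [q0|q0] := eqVneq q12 0.
    rewrite q0 in H; apply: (product_classified H) => [{}H|_ {}H||]; rewrite ?eqxx //.
    + entry 39%N (0 : F) H.
    + entry 40%N (0 : F) H.
  case: (scale_nilpotent n1 q0 H) => {}H; [entry 41%N (0 : F) H | entry 42%N (0 : F) H].
- kill H q21 0%N 0%N 1%N 3%N 2%N (- 2 : F). kill H q12 0%N 0%N 2%N 1%N 3%N (2 : F).
  kill H k1 0%N 0%N 2%N 3%N 0%N (2 : F). kill H k2 0%N 0%N 2%N 3%N 1%N (2 : F).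
  kill_pow H q11 2%N 1%N 1%N 0%N 2%N 2%N (- 1 : F).
  kill_pow H q22 3%N 1%N 1%N 1%N 3%N 3%N (2^-1 : F).
  entry 43%N (0 : F) H.
- move: H => /second_triangular {q11 q12 q21 q22 k1 k2} [q11 [q12 [q22 [k1 [k2 H]]]]].
  kill_pow H q11 3%N 1%N 1%N 1%N 2%N 2%N (2^-1 : F).
  kill_pow H q22 3%N 1%N 1%N 1%N 3%N 3%N (2^-1 : F).
  have [q0|q0] := eqVneq q12 0.
    rewrite q0 in H; apply: (product_classified H) => [{}H|_ {}H|_ {}H|_ {}H].
    + entry 44%N (0 : F) H.
    + entry 45%N (0 : F) H.
    + entry 46%N (0 : F) H.
    + entry 47%N (0 : F) H.
  have k10 : k1 = 0 by apply: (mulf0r q0); jac H 1%N 1%N 2%N 2%N 1%N (2^-1 : F).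
  subst k1; case: (scale_nilpotent n1 q0 H) => {}H;
    [entry 48%N (0 : F) H | entry 49%N (0 : F) H].
Qed.

Lemma half_classified : evens A (1, 0) (0, 2^-1) (0, 0) -> classified.
Proof.
case=> p1 [p2 [q1 [q2 [k /(odd_diagonal jA)]]]].
case=> l [m [[q11 q12] [[q21 q22] [[k1 k2] [/eigenpairsP Elm H _]]]]].
have n1 := oner_neq0 F.
have nN1 : - 1 != 0 :> F by rewrite oppr_eq0.
case: Elm H => H.
- kill H q11 0%N 0%N 1%N 2%N 2%N (2 : F). kill H q12 0%N 0%N 1%N 2%N 3%N (2 : F).
  kill H q21 0%N 0%N 1%N 3%N 2%N (2 : F). kill H q22 0%N 0%N 1%N 3%N 3%N (2 : F).
  kill H k1 0%N 0%N 2%N 3%N 0%N (- 1 : F). kill H k2 0%N 0%N 2%N 3%N 1%N (- 2 : F).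
  entry 50%N (0 : F) H.
- kill H q11 0%N 0%N 1%N 2%N 2%N (2 : F). kill H q22 0%N 1%N 0%N 3%N 3%N (- 4 : F).
  kill H k1 0%N 0%N 3%N 2%N 0%N (2 : F).
  (* The square of the action of [e2] is the scalar q12 q21, so at most one of the two is nonzero.
     The odd vectors have different eigenvalues for [e1] and cannot be interchanged, so the two
     possibilities lead to different entries. *)
  have qq : q21 * q12 = 0 by jac H 1%N 1%N 0%N 3%N 3%N (- 1 : F).
  have [q0|q0] := eqVneq q12 0; last first.
    have E := mulf0r q0 qq; subst q21.
    case: (scale_nilpotent n1 q0 H) => {}H; [entry 55%N (0 : F) H | entry 56%N (0 : F) H].
  subst q12; have [q0|q0] := eqVneq q21 0.
    rewrite q0 in H; apply: (product_classified H) => [{}H|_ {}H||]; rewrite ?eqxx //.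
    + entry 51%N (0 : F) H.
    + entry 52%N (0 : F) H.
  move/swap_odd in H; rewrite oppr0 in H.
  case: (scale_nilpotent nN1 q0 H) => {}H; move/swap_odd in H;
    [entry 53%N (0 : F) H | entry 54%N (0 : F) H].
- kill H q11 0%N 0%N 1%N 2%N 2%N (2 : F). kill H q12 0%N 0%N 1%N 2%N 3%N (- 2 : F).
  kill H q21 0%N 0%N 1%N 3%N 2%N (- 2 : F). kill H q22 0%N 0%N 1%N 3%N 3%N (2 : F).
  kill H k1 0%N 0%N 2%N 3%N 0%N (1 : F). kill H k2 0%N 0%N 2%N 3%N 1%N (2 : F).
  entry 57%N (0 : F) H.
- kill H q11 0%N 1%N 0%N 2%N 2%N (- 4 : F). kill H q12 0%N 1%N 0%N 2%N 3%N (- 4 : F).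
  kill H q21 0%N 1%N 0%N 3%N 2%N (- 4 : F). kill H q22 0%N 1%N 0%N 3%N 3%N (- 4 : F).
  kill H k2 0%N 2%N 0%N 3%N 1%N (- 4 : F). kill H k1 1%N 2%N 0%N 3%N 1%N (4 : F).
  entry 58%N (0 : F) H.
- kill H q22 0%N 0%N 1%N 3%N 3%N (2 : F). kill H k1 0%N 0%N 2%N 3%N 0%N (2 : F).
  kill H q11 0%N 1%N 0%N 2%N 2%N (- 4 : F).
  have qq : q21 * q12 = 0 by jac H 1%N 1%N 0%N 2%N 2%N (1 : F).
  have [q0|q0] := eqVneq q12 0; last first.
    have E := mulf0r q0 qq; subst q21.
    case: (scale_nilpotent n1 q0 H) => {}H; [entry 63%N (0 : F) H | entry 64%N (0 : F) H].
  subst q12; have [q0|q0] := eqVneq q21 0.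
    rewrite q0 in H; apply: (product_classified H) => [{}H|_ {}H||]; rewrite ?eqxx //.
    + entry 59%N (0 : F) H.
    + entry 60%N (0 : F) H.
  move/swap_odd in H; rewrite oppr0 in H.
  case: (scale_nilpotent nN1 q0 H) => {}H; move/swap_odd in H;
    [entry 61%N (0 : F) H | entry 62%N (0 : F) H].
- kill H q11 0%N 0%N 1%N 2%N 2%N (2 : F). kill H q12 0%N 0%N 1%N 2%N 3%N (2 : F).
  kill H q21 0%N 0%N 1%N 3%N 2%N (2 : F). kill H q22 0%N 0%N 1%N 3%N 3%N (2 : F).
  kill H k2 0%N 0%N 2%N 3%N 1%N (- 2 : F). kill H k1 1%N 2%N 0%N 3%N 1%N (4 : F).
  entry 65%N (0 : F) H.
Qed.
End Idempotent.

(** * Nil even part *)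

Section Nilpotent.
Variable F : numClosedFieldType.
Variables (A : superalgebra F).
Hypothesis jA : jordan A.
Local Notation pres := (pres A).
Local Notation classified := (classified A).

Ltac eqs := rewrite /lin /m00 /m01 /m11 /=; congr (_, _); by field.

Lemma square_classified : evens A (0, 1) (0, 0) (0, 0) -> classified.
Proof.
case=> p1 [p2 [q1 [q2 [[k1 k2] H]]]]; have n1 := oner_neq0 F.
(* The action of [e2] is made triangular first; if it turns out to vanish, it is the scalar 0 and
   leaves the odd basis free for [e1]. *)
have {p1 p2 q1 q2 k1 k2 H} [p11 [p12 [p21 [p22 [q11 [q12 [q22 [k1 [k2 H]]]]]]]]] :
  exists p11 p12 p21 p22 q11 q12 q22 k1 k2,
    pres (0, 1) (0, 0) (0, 0) (p11, p12) (p21, p22) (q11, q12) (0, q22) (k1, k2).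
  move/swap_even/odd_triangular in H.
  case: H => [[q11 q12] [q22 [[p11 p12] [[p21 p22] [[k1' k2'] [H _]]]]]].
  by move/swap_even in H; exists p11, p12, p21, p22, q11, q12, q22, k2', k1'.
kill_pow H q11 3%N 1%N 1%N 1%N 2%N 2%N (2^-1 : F).
kill_pow H q22 3%N 1%N 1%N 1%N 3%N 3%N (2^-1 : F).
have [q0|q0] := eqVneq q12 0; last first.
  have E : p21 = 0 by apply: (mulf0r q0); jac H 0%N 0%N 2%N 0%N 2%N (3^-1 : F).
  subst p21.
  have E : k1 = 0 by apply: (mulf0r q0); jac H 0%N 0%N 2%N 2%N 0%N (- 1 : F).
  subst k1.
  have E : k2 = 0 by apply: (mulf0r q0); jac H 0%N 0%N 2%N 2%N 1%N (- 1 : F).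
  subst k2.
  have E : p11 = p22.
    apply: subr0_eq; apply: (mulf0r q0).
    by jac H 0%N 0%N 2%N 0%N 3%N (- 3^-1 : F).
  subst p22.
  have E : p11 = 0.
    apply: (@expf0 _ 2); apply: (mulf0r q0).
    by jac H 0%N 0%N 1%N 2%N 3%N (2^-1 : F).
  subst p11.
  suff H' : pres (0, 1) (0, 0) (0, 0) (0, 0) (0, 0) (0, 1) (0, 0) (0, 0) by entry 69%N (0 : F) H'.
  (* Subtracting p12 / q12 times [e2] from [e1] makes it annihilate [f1]; the square of [e1] is
     unchanged because [e2] multiplies the even part by zero. *)
  apply: (change (x := (1, - p12 / q12)) (y := (0, 1)) (u := (1, 0)) (v := (0, q12)) H);
    rewrite ?mulr0 ?subr0 ?mulr1 ?mul1r //; eqs.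
subst q12; have {p11 p12 p21 p22 k1 k2 H} [p11 [p12 [p22 [k1 [k2 H]]]]] :
  exists p11 p12 p22 k1 k2,
    pres (0, 1) (0, 0) (0, 0) (p11, p12) (0, p22) (0, 0) (0, 0) (k1, k2).
  move/odd_triangular in H.
  case: H => [[p11' p12'] [p22' [q1' [q2' [[k1' k2'] [H Hs]]]]]].
  have [E1 E2] := Hs 0 erefl erefl; subst.
  by exists p11', p12', p22', k1', k2'.
kill_pow H p11 3%N 0%N 0%N 0%N 2%N 2%N (2^-1 : F).
kill_pow H p22 3%N 0%N 0%N 0%N 3%N 3%N (2^-1 : F).
have [p0|p0] := eqVneq p12 0; last first.
  have E : k1 = 0 by apply: (mulf0r p0); jac H 0%N 0%N 2%N 2%N 1%N (2^-1 : F).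
  subst k1; have [k20|k20] := eqVneq k2 0.
    rewrite k20 in H; have {}H := scale_basis n1 n1 n1 p0 H; entry 70%N (0 : F) H.
  pose r := sqrtC (p12 * k2); have rE : r ^+ 2 = p12 * k2 by exact: sqrtCK.
  have r0 : r != 0 by rewrite -sqrf_eq0 rE mulf_neq0.
  have k2E : k2 = r ^+ 2 / p12 by rewrite rE; field.
  rewrite k2E in H.
  have {}H := scale_basis n1 n1 (invr_neq0 r0) (mulf_neq0 p0 (invr_neq0 r0)) H.
  suff H' : pres (0, 1) (0, 0) (0, 0) (0, 1) (0, 0) (0, 0) (0, 0) (0, 1) by entry 71%N (0 : F) H'.
  by apply: (pres_cast H); congr (_, _); field; rewrite ?p0 ?r0.
subst p12; have [k10|k10] := eqVneq k1 0.
  subst k1; have [k20|k20] := eqVneq k2 0; first by rewrite k20 in H; entry 66%N (0 : F) H.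
  have {}H := scale_basis n1 n1 (invr_neq0 k20) n1 H; entry 67%N (0 : F) H.
suff H' : pres (0, 1) (0, 0) (0, 0) (0, 0) (0, 0) (0, 0) (0, 0) (1, 0) by entry 68%N (0 : F) H'.
(* The new [e1] is the product of [f1] and [f2], and the new [e2] is its square. *)
apply: (change (x := (k1, k2)) (y := (0, k1 ^+ 2)) (u := (1, 0)) (v := (0, 1)) H);
  rewrite /= ?mulr0 ?subr0 ?mulr1 ?mulf_neq0 ?sqrf_eq0 //; eqs.
Qed.

Lemma pres_zero : pres (0, 0) (0, 0) (0, 0) (0, 0) (0, 0) (0, 0) (0, 0) (0, 0) ->
  ~ has_nonzero_product A.
Proof.
case=> phi [psi co] [x [y]]; case: (co) => phiK psiK _ _.
rewrite -[x]psiK -[y]psiK (coord_smul co) => /eqP; apply.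
rewrite -[RHS](linear0 phi); congr (phi _); apply/rowP => l; rewrite !mxE.
apply: big1 => i _; apply: big1 => j _.
by case: i => [[|[|[|[|//]]]] ?]; case: j => [[|[|[|[|//]]]] ?];
  case: l => [[|[|[|[|//]]]] ?]; rewrite /= ?oppr0 mulr0.
Qed.

(** In a suitable odd basis both even vectors send [f1] to multiples of [f2] and kill [f2], so some
    nonzero combination annihilates the odd part; it becomes the new [e1]. *)
Lemma zero_even_reduce : evens A (0, 0) (0, 0) (0, 0) ->
  exists q12 k1 k2, pres (0, 0) (0, 0) (0, 0) (0, 0) (0, 0) (0, q12) (0, 0) (k1, k2).
Proof.
case=> p1 [p2 [[q11 q12] [[q21 q22] [[k1 k2]]]]].
case/odd_triangular => [[p11 p12] [p22 [[q11' q12'] [[q21' q22'] [[k1' k2'] [H _]]]]]].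
kill_pow H p11 3%N 0%N 0%N 0%N 2%N 2%N (2^-1 : F).
kill_pow H p22 3%N 0%N 0%N 0%N 3%N 3%N (2^-1 : F).
have [p0|p0] := eqVneq p12 0.
  subst p12; move: H => /second_triangular [r11 [r12 [r22 [m1 [m2 H]]]]].
  kill_pow H r11 3%N 1%N 1%N 1%N 2%N 2%N (2^-1 : F).
  kill_pow H r22 3%N 1%N 1%N 1%N 3%N 3%N (2^-1 : F).
  by exists r12, m1, m2.
have E : q21' = 0.
  (* The available component of the identity is q21' multiplied by the square of p12. *)
  apply: (mulf0r p0); apply: (mulf0r p0).
  by jac H 0%N 0%N 1%N 2%N 3%N (2^-1 : F).
subst q21'.
kill_pow H q11' 3%N 1%N 1%N 1%N 2%N 2%N (2^-1 : F).
kill_pow H q22' 3%N 1%N 1%N 1%N 3%N 3%N (2^-1 : F).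
exists p12, k2', (k1' + k2' * q12' / p12).
apply: (change (x := (- q12' / p12, 1)) (y := (1, 0)) (u := (1, 0)) (v := (0, 1)) H);
  rewrite /= ?mulr0 ?mul1r ?sub0r ?subr0 ?oppr_eq0 ?oner_eq0 //; eqs.
Qed.

Lemma zero_even_classified : has_nonzero_product A ->
  evens A (0, 0) (0, 0) (0, 0) -> classified.
Proof.
move=> nzA /zero_even_reduce [q12 [k1 [k2 H]]]; have n1 := oner_neq0 F.
have [q0|q0] := eqVneq q12 0.
  subst q12.
  suff H' : pres (0, 0) (0, 0) (0, 0) (0, 0) (0, 0) (0, 0) (0, 0) (1, 0) by entry 17%N (0 : F) H'.
  have [k10|k10] := eqVneq k1 0; last first.
    apply: (change (x := (k1, k2)) (y := (0, 1)) (u := (1, 0)) (v := (0, 1)) H);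
      rewrite /= ?mulr0 ?subr0 ?mulr1 ?oner_eq0 //; eqs.
  have [k20|k20] := eqVneq k2 0; first by subst; case: (pres_zero H nzA).
  apply: (change (x := (k1, k2)) (y := (1, 0)) (u := (1, 0)) (v := (0, 1)) H);
    rewrite /= ?mulr0 ?subr0 ?mulr1 ?sub0r ?oppr_eq0 ?oner_eq0 //; eqs.
have [k20|k20] := eqVneq k2 0.
  subst k2; have [k10|k10] := eqVneq k1 0.
    subst k1; have {}H := scale_basis n1 n1 n1 q0 H; entry 18%N (0 : F) H.
  have {}H := scale_basis (mulf_neq0 q0 k10) n1 n1 q0 H.
  suff H' : pres (0, 0) (0, 0) (0, 0) (0, 0) (0, 0) (0, 1) (0, 0) (1, 0) by entry 19%N (0 : F) H'.
  by apply: (pres_cast H); congr (_, _); field; rewrite ?q0 ?k10.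
pose r := sqrtC (q12 * k2); have rE : r ^+ 2 = q12 * k2 by exact: sqrtCK.
have r0 : r != 0 by rewrite -sqrf_eq0 rE mulf_neq0.
have qE : q12 = r ^+ 2 / k2 by rewrite rE; field.
rewrite qE in H.
suff H' : pres (0, 0) (0, 0) (0, 0) (0, 0) (0, 0) (0, 1) (0, 0) (0, 1) by entry 20%N (0 : F) H'.
(* The new [e2] is the product of [f1] and [f2], which inverse scalings of these vectors preserve;
   it sends [f1] to k2 q12 [f2], and r^2 = q12 k2 normalizes this coefficient. *)
apply: (change (x := (1, 0)) (y := (k1, k2)) (u := (r^-1, 0)) (v := (0, r)) H);
  rewrite /= ?mul0r ?subr0 ?mul1r ?mulVf ?oner_eq0 //; rewrite /lin /m00 /m01 /m11 /=;
  by congr (_, _); field; rewrite ?r0 ?k20.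
Qed.

Lemma classification : of_type A 2 2 -> has_nonzero_product A -> classified.
Proof.
move=> tA nzA; have [a [b [c [p1 [p2 [q1 [q2 [k H]]]]]]]] := of_type_pres jA tA.
have Ev : evens A a b c by exists p1, p2, q1, q2, k.
case: (even_forms jA Ev) => [[]||].
- exact: split_classified.
- exact: null_classified.
- exact: unital_classified.
- exact: half_classified.
- exact: square_classified.
- exact: zero_even_classified.
Qed.
End Nilpotent.

Theorem theorem11 (R : realType) :
  [/\ (forall (k : nat) (t : R[i]), (1 <= k <= 71)%N ->
         [/\ jordan (listed_alg (listing t k)),
             of_type (listed_alg (listing t k)) 2 2
           & has_nonzero_product (listed_alg (listing t k))]),
      (forall A : superalgebra R[i],
         jordan A -> of_type A 2 2 -> has_nonzero_product A ->
         exists (k : nat) (t : R[i]),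
           (1 <= k <= 71)%N /\ isomorphic A (listed_alg (listing t k))),
      (forall (k l : nat) (s t : R[i]),
         (1 <= k <= 71)%N -> (1 <= l <= 71)%N ->
         isomorphic (listed_alg (listing s k)) (listed_alg (listing t l)) ->
         k = l),
      (forall (k : nat) (t : R[i]), (1 <= k <= 71)%N ->
         (orbit_dim (listed_alg (listing t k)) + nparams k)%N
           = listed_dim (listing t k))
    & (forall (k : nat) (t : R[i]), (1 <= k <= 71)%N ->
         decomposes_as (listed_alg (listing t k))
           (listed_decomposition (listing t k)))].
Proof.
split=> [k t kP|A jA tA nzA|k l s t|k t|k t].
- split; [exact: listing_jordan | exact: listing_of_type | exact: listing_nonzero].
- exact: classification.
- exact: listing_inj.
- exact: listing_orbit_dim.
- exact: listing_decomposition.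
Qed.
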